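(* Let $\alpha > 0$ and $0 \leq \beta < 1$. There exists a Borel probability measure $\mu$ on $\mathbb{R}$ such that the following hold: (i) The support of $\mu$ is contained in $[-1/2,1/2] \cap E(\alpha)$. (ii) For any $\epsilon > 0$ there is a constant $C_\epsilon > 0$ such that $\mu(I) \leq C_\epsilon |I|^{\frac{2}{2+\alpha}-\epsilon}$ for every interval $I \subseteq \mathbb{R}$. (iii) For any $\epsilon > 0$ there is a constant $C_\epsilon > 0$ such that $|\mathcal{F}(\mu)(\xi)| \leq C_\epsilon (1+|\xi|)^{-\frac{1-\beta}{2+\alpha}+\epsilon}$ for every $\xi \in \mathbb{R}$. (iv) There exists a sequence of nonnegative functions $\{f_k\}_{k \in \mathbb{N}}$ such that, for all $1 < q < \infty$ and $1 \le p < \infty$, $$\sup_{k \geq 1} \frac{\|\mathcal{F}(f_k \mu)\|_{L^p(\lambda)}}{\|f_k\|_{L^q(\mu)}} = \infty \qquad \text{whenever} \quad p < p_+(q) := \frac{q}{q-1}\left(\frac{1+\alpha-\beta}{1-\beta}\right).$$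
   Context: $E(\alpha)$ is the set of all $x \in \mathbb{R}$ such that $|x - r/q| \leq |q|^{-(2+\alpha)}$ for infinitely many pairs $(q,r) \in \mathbb{Z}\times\mathbb{Z}$ with $q \neq 0$. For a finite (complex) measure $\nu$ on $\mathbb{R}$, $\mathcal{F}(\nu)(\xi) = \int_{\mathbb{R}} e^{-2\pi i x \xi}\, d\nu(x)$. $\lambda$ is Lebesgue measure on $\mathbb{R}$, $|I|$ is the Lebesgue measure of the interval $I$, and $f_k\mu$ is the measure with density $f_k$ with respect to $\mu$.
   Formalization: In (ii), for ε > 2/(2+α) the bound is claimed only for intervals with |I| ≤ 1, because for such ε the exponent is negative and the literal claim fails for I = [−N,N] as N → ∞; for ε ≤ 2/(2+α) every interval is covered. *)

(* Defs.v *)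
From HB Require Import structures.
From mathcomp Require Import all_boot all_order all_algebra.
From mathcomp Require Import all_classical all_reals all_analysis.
From mathcomp Require Import measurable_realfun complex.
Set Implicit Arguments.
Unset Strict Implicit.
Unset Printing Implicit Defensive.
Import Order.TTheory GRing.Theory Num.Theory.
Import numFieldNormedType.Exports.
Local Open Scope classical_set_scope.
Local Open Scope ring_scope.

Definition well_approximable (R : realType) (alpha : R) : set R :=
  [set x | infinite_set [set qr : int * int | qr.1 != 0 /\
    `|x - qr.2%:~R / qr.1%:~R| <= `|qr.1%:~R| `^ (- (2 + alpha))]].

Definition msupport (R : realType)
    (mu : {measure set (measurableTypeR R) -> \bar R}) : set R :=
  [set x : R | forall U : set R, open U -> U x -> (0 < mu U)%E].

Definition expi (R : realType) (t : R) : R[i] := Complex (cos t) (sin t).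

Definition cintegral d (T : measurableType d) (R : realType)
    (nu : {measure set T -> \bar R}) (g : T -> R[i]) : R[i] :=
  Complex (\int[nu]_x complex.Re (g x)) (\int[nu]_x complex.Im (g x)).

(* Meaningful when nu is finite: Rintegral is 0 on infinite integrals. *)
Definition fourier (R : realType)
    (nu : {measure set (measurableTypeR R) -> \bar R}) (xi : R) : R[i] :=
  cintegral nu (fun x : measurableTypeR R => expi (- (2 * pi * x * xi))).

(* The modulus normc is real-valued, whereas `|z| is again in R[i]. *)
Definition fourier_norm (R : realType)
    (nu : {measure set (measurableTypeR R) -> \bar R}) (xi : R) : R :=
  Normc.normc (fourier nu xi).

(* The proof of nonnegativity is an argument so that the set function is
   canonically a measure. *)
Definition density d (T : measurableType d) (R : realType)
    (mu : {measure set T -> \bar R}) (f : {mfun T >-> R})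
    (f0 : forall x, 0 <= f x) (A : set T) : \bar R :=
  \int[mu]_(x in A) (f x)%:E.

Section density_measure.
Context d (T : measurableType d) (R : realType).
Variables (mu : {measure set T -> \bar R}) (f : {mfun T >-> R}).
Hypothesis f0 : forall x, 0 <= f x.

Let density0 : density mu f0 set0 = 0%E.
Proof. exact: integral_set0. Qed.

Let density_ge0 A : (0 <= density mu f0 A)%E.
Proof. by apply: integral_ge0 => x _; rewrite lee_fin. Qed.

Let density_sigma_additive : semi_sigma_additive (density mu f0).
Proof.
apply: semi_sigma_additive_nng_induced => [|x]; last by rewrite lee_fin.
exact/measurable_EFinP.
Qed.

HB.instance Definition _ := isMeasure.Build _ _ _
  (density mu f0) density0 density_ge0 density_sigma_additive.

End density_measure.

(* Main.v *)
(** The measure is the law of Y(u) for u uniform in ]0, 1[.  On the dyadic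
    interval J_k = [2^-(k+1), 2^-k[ put Y(u) = -1/2 + s_k j + d_k X, where j is
    the integer part of u / s_k and X, a function of the fractional part, has
    the law of a random sum of lacunarily scaled fractions r/p, with p a random
    prime and 0 < r < p.  The partial sums of X are rational and approximate X
    with exponent 2 + alpha; distinct fractions are well separated, which gives
    the Frostman exponent 2/(2+alpha); and an integer frequency is divisible by
    few primes, which gives Fourier decay of order 1/(2+alpha).

    The scales are d_k^((1-beta)/(2+alpha)) = |J_k| and s_k = d_k^(2/(2+alpha)).
    The copies of the law of X are then spaced exactly so that the Frostman
    exponent survives, and the mass |J_k| of the k-th piece compensates its
    lack of decay at frequencies below 1/d_k.  At a frequency which is slightly
    above a multiple of 1/s_k, within 2^k/16, and much smaller than 1/d_k, the
    arithmetic progression of the copies resonates: the transform of the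
    restriction of the measure to the k-th piece has size at least |J_k|/2
    there.  These frequencies have measure comparable with 2^k s_k/d_k, while
    the L^q norm of the indicator of the piece is |J_k|^(1/q); the quotient is
    unbounded in k below the exponent p_+(q). *)

Require Import Defs.
From HB Require Import structures.
From mathcomp Require Import all_boot all_order all_algebra.
From mathcomp Require Import all_classical all_reals all_analysis.
From mathcomp Require Import measurable_realfun complex.
From mathcomp Require Import ring lra zify.
Import Order.TTheory GRing.Theory Num.Theory.
Import numFieldNormedType.Exports.
Local Open Scope classical_set_scope.
Local Open Scope ring_scope.
Set Implicit Arguments.
Unset Strict Implicit.

(** * Chebyshev's lower bound for the number of primes *)

Section Chebyshev.
Local Open Scope nat_scope.

(** The exponents of the law of [X] come from one count. With [m = lgM l], a digit takes about
    [4 ^ m] values, its mean exponential is about [2 ^- m] at high frequencies, both up to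
    polynomials in the logarithms, and the next scale is about [2 ^- ((2 + alpha) * m)]; hence
    [2 / (2 + alpha)] and [1 / (2 + alpha)]. The polynomial losses disappear in epsilon, so
    Chebyshev's bound for the primes is enough. Both scales of the k-th piece are extremal. A copy
    of diameter [d] carries mass [s], so the Frostman bound allows no [s] above [d ^ hdim]. The
    transform of the piece is comparable with its mass at some frequencies near [1 / d], so the
    decay allows no mass above [d ^ fdim]. Resonance gains from a large [s] and a small [d]. At the
    extremes the resonant frequencies have measure about [2 ^ (gamma * k)] with
    [gamma = (1 + alpha - beta) / (1 - beta)], and the quotient is at least about
    [2 ^ ((gamma / p - (q - 1) / q) * k)], which is how [p_+(q)] arises. *)

Definition primes_upto (n : nat) : seq nat :=
  [seq p <- index_iota 2 n.+1 | prime p].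

Lemma mem_primes_upto n p : (p \in primes_upto n) = prime p && (p <= n).
Proof.
rewrite mem_filter mem_index_iota ltnS.
by case pp : (prime p) => //=; rewrite prime_gt1.
Qed.

Lemma primes_upto_uniq n : uniq (primes_upto n).
Proof. exact/filter_uniq/iota_uniq. Qed.

Lemma leq_prod_const (s : seq nat) (F : nat -> nat) n :
  {in s, forall p, F p <= n} -> \prod_(p <- s) F p <= n ^ size s.
Proof.
elim: s => [|p s IHs] sn; first by rewrite big_nil.
rewrite big_cons expnS leq_mul ?sn ?mem_head// IHs// => q qs.
by rewrite sn// inE qs orbT.
Qed.

Lemma leq_const_prod (s : seq nat) (F : nat -> nat) n :
  {in s, forall p, n <= F p} -> n ^ size s <= \prod_(p <- s) F p.
Proof.
elim: s => [|p s IHs] sn; first by rewrite big_nil.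
rewrite big_cons expnS leq_mul ?sn ?mem_head// IHs// => q qs.
by rewrite sn// inE qs orbT.
Qed.

(** Legendre's formula writes the exponent as a sum over [i] of [n %/ p ^ i - k %/ p ^ i - (n - k)
    %/ p ^ i], each at most 1 and zero once [p ^ i > n]. *)
Lemma logn_bin_le (p n k : nat) : prime p -> k <= n -> 0 < n ->
  p ^ logn p 'C(n, k) <= n.
Proof.
move=> pp kn n0; have p1 := prime_gt1 pp.
rewrite (leq_trans _ (trunc_logP p1 n0))// leq_exp2l//.
have E : logn p n`! = logn p 'C(n, k) + (logn p k`! + logn p (n - k)`!).
  by rewrite -(bin_fact kn) !lognM ?muln_gt0 ?fact_gt0 ?bin_gt0.
have wid j : j <= n -> logn p j`! = \sum_(1 <= i < n.+1) j %/ p ^ i.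
  move=> jn; rewrite logn_fact// (big_cat_nat (n := j.+1) (p := n.+1))//=.
  rewrite [X in _ + X]big1_seq ?addn0// => i /=; rewrite mem_index_iota => /andP[ji _].
  by rewrite divn_small// (ltn_trans ji)// ltn_expl.
rewrite !wid// ?leq_subr// in E.
suff: \sum_(1 <= i < n.+1) n %/ p ^ i <=
   trunc_log p n + (\sum_(1 <= i < n.+1) k %/ p ^ i + \sum_(1 <= i < n.+1) (n - k) %/ p ^ i).
  by rewrite E leq_add2r.
have ltl : trunc_log p n <= n.
  by rewrite ltnW// (leq_trans _ (trunc_logP p1 n0))// ltn_expl.
(* The logarithm becomes a sum of indicators, so that the comparison is termwise. *)
have -> : trunc_log p n = \sum_(1 <= i < n.+1) (p ^ i <= n).
  rewrite (big_cat_nat (n := (trunc_log p n).+1))//=.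
  rewrite [X in X + _](eq_big_nat _ _ (F2 := fun=> 1)); last first.
    move=> i /andP[_ il]; rewrite (leq_trans _ (trunc_logP p1 n0))// leq_exp2l//.
  rewrite sum_nat_const_nat muln1 subSS subn0 [X in _ + X]big1_seq ?addn0//.
  move=> i /=; rewrite mem_index_iota => /andP[li _].
  apply/eqP; rewrite eqb0 -ltnNge.
  by rewrite (leq_trans (trunc_log_ltn n p1))// leq_exp2l.
rewrite -!big_split /=; apply: leq_sum => i _.
have pi0 : 0 < p ^ i by rewrite expn_gt0 prime_gt0.
case: (leqP (p ^ i) n) => h; last by rewrite divn_small.
rewrite -{1}(subnKC kn) divnD// addnC leq_add2r; exact: leq_b1.
Qed.

(** A prime dividing the binomial divides the factorial of [n], hence is at most [n], and its power
    in the factorization is at most [n] as well. *)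
Lemma bin_le_primes_upto n k : k <= n -> 0 < n ->
  'C(n, k) <= n ^ size (primes_upto n).
Proof.
move=> kn n0; have C0 : 0 < 'C(n, k) by rewrite bin_gt0.
have P : 'C(n, k) = \prod_(p <- primes_upto n) p ^ logn p 'C(n, k).
  rewrite {1}(prod_prime_decomp C0) prime_decompE big_map /=.
  rewrite [in RHS](bigID (mem (primes 'C(n, k)))) /=.
  rewrite [X in _ = _ * X]big1 ?muln1; last first.
    move=> p; have [lp _|] := boolP (logn p 'C(n, k) == 0); first by rewrite (eqP lp).
    by rewrite -lt0n logn_gt0 => ->.
  rewrite -[RHS]big_filter; apply: perm_big; rewrite perm_sym.
  apply: uniq_perm.
  - exact/filter_uniq/primes_upto_uniq.
  - exact: primes_uniq.
  move=> p; rewrite mem_filter mem_primes_upto.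
  case pC : (p \in primes 'C(n, k)) => //=.
  move: pC; rewrite mem_primes => /and3P[pp _ pd]; rewrite pp /=.
  rewrite leqNgt; apply/negP => np.
  have : p %| n`! by rewrite -(bin_fact kn) dvdn_mulr.
  rewrite fact_prod Euclid_dvd_prod//; apply/negP.
  rewrite big_has; apply/hasPn => i; rewrite mem_index_iota => /andP[i1 ni].
  by rewrite gtnNdvd// (leq_trans ni).
rewrite P; apply: leq_prod_const => p; rewrite mem_primes_upto => /andP[pp _].
exact: logn_bin_le.
Qed.

Lemma exp2_le_bin n : 2 ^ n <= 'C(n + n, n).
Proof.
elim: n => // n IHn; rewrite addSn addnS !binS expnS mul2n -addnn.
rewrite leq_add// (leq_trans IHn) ?leq_addl//.
by case: n {IHn} => // n; rewrite binS leq_addr.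
Qed.

(** With [N = 2 ^ m], the central binomial lies between [2 ^ N] and
    [(2 * N) ^ size (primes_upto (2 * N))]; the exponents of 2 are compared. *)
Lemma primes_upto_exp2 m : 2 ^ m <= m.+1 * size (primes_upto (2 ^ m.+1)).
Proof.
rewrite -(@leq_exp2l 2)// expnM (leq_trans (exp2_le_bin _))//.
rewrite addnn -mul2n -expnS bin_le_primes_upto// ?expn_gt0//.
by rewrite leq_exp2l.
Qed.

(* At most [t] primes are [<= t], so the remaining ones contribute at least
   [t] each; [t] is half the number of primes. *)
Lemma sum_primes_upto m :
  4 ^ m.+1 <= 20 * m.+1 ^ 2 * \sum_(p <- primes_upto (2 ^ m.+1)) p.-1.
Proof.
set P := primes_upto _; set t := (size P)./2.
have P2 : 2 \in P by rewrite mem_primes_upto /= expnS leq_pmulr// expn_gt0.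
have S1 : 1 <= \sum_(p <- P) p.-1.
  by rewrite (big_rem 2)//= leq_addr.
have St : t * (size P - t) <= \sum_(p <- P) p.-1.
  rewrite -(count_predC (fun p => p <= t) P).
  have ct : count (fun p => p <= t) P <= t.
    rewrite -size_filter -[X in _ <= X](size_iota 1) uniq_leq_size//.
      exact/filter_uniq/primes_upto_uniq.
    move=> p; rewrite mem_filter mem_primes_upto mem_iota => /and3P[pt pp _].
    by rewrite prime_gt0// add1n ltnS.
  rewrite (@leq_trans (t * count (predC (fun p => p <= t)) P))//.
    by rewrite leq_mul2l leq_subLR leq_add2r ct orbT.
  rewrite -sum1_count big_distrr/= big_mkcond/=; apply: leq_sum => p _.
  rewrite /=; case: (leqP p t) => //= tp; rewrite muln1.
  by rewrite -ltnS (leq_trans tp)// leqSpred.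
have S5 : size P ^ 2 <= 5 * \sum_(p <- P) p.-1.
  move: S1 St; rewrite /t; move: (\sum_(p <- P) _) => S.
  have := odd_double_half (size P); move: (size P) (size P)./2 => N h.
  case: (odd N) => /= <- S1 hS.
    have {}hS : h * h.+1 <= S by apply: leq_trans hS; rewrite leq_mul2l; lia.
    by rewrite -muln2; nia.
  have {}hS : h * h <= S by apply: leq_trans hS; rewrite leq_mul2l; lia.
  by rewrite -muln2; nia.
have -> : 4 ^ m.+1 = 4 * (2 ^ m) ^ 2 by rewrite expnS -expnM [in RHS]mulnC [in RHS](mulnC m) [in RHS]expnM mulnC.
have := primes_upto_exp2 m; rewrite -/P -leq_sqr expnMn.
move: S5; rewrite -!expnM; move: (_ ^ (m * 2)) (m.+1 ^ 2) (size P ^ 2) => a b c; nia.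
Qed.

(** The product of the distinct primes dividing [j] is at most [j < 2 ^ L], and each is at least 2.
    The Fourier decay rests on this sparsity. *)
Lemma count_primes_dvd n j L : 0 < j < 2 ^ L ->
  count (fun p => p %| j) (primes_upto n) <= L.
Proof.
case/andP=> j0 jL; rewrite -size_filter (@leq_trans (size (primes j)))//.
  apply: uniq_leq_size; first exact/filter_uniq/primes_upto_uniq.
  by move=> p; rewrite mem_filter mem_primes_upto mem_primes j0 => /and3P[-> -> _].
rewrite ltnW// -(@ltn_exp2l 2)// (leq_ltn_trans _ jL)//.
rewrite [leqRHS](prod_prime_decomp j0) prime_decompE big_map /=.
apply: leq_const_prod => p pj.
have pp : prime p by move: pj; rewrite mem_primes => /and3P[].
move: pj; rewrite -logn_gt0 => lp.
by rewrite (leq_trans (prime_gt1 pp))// -[leqLHS]expn1 leq_pexp2l// prime_gt0.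
Qed.
End Chebyshev.

(** * Complex exponentials and geometric sums *)

Section ComplexModulus.
Variable R : realType.
Implicit Types (z w : R[i]) (t u : R).

Local Notation cabs := (@Normc.normc R).

Lemma cabs_ge0 z : 0 <= cabs z.
Proof. by case: z => a b /=; rewrite sqrtr_ge0. Qed.

Lemma cabsM z w : cabs (z * w) = cabs z * cabs w.
Proof. exact: Normc.normcM. Qed.

Lemma cabsD z w : cabs (z + w) <= cabs z + cabs w.
Proof. exact: le_normcD. Qed.

Lemma cabsN z : cabs (- z) = cabs z.
Proof. exact: normcN. Qed.

Lemma cabs0 : cabs 0 = 0.
Proof. exact: Normc.normc0. Qed.

Lemma cabs1 : cabs 1 = 1.
Proof. exact: Normc.normc1. Qed.

Lemma cabs_real t : cabs (t%:C)%C = `|t|.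
Proof. by rewrite /= expr0n /= addr0 sqrtr_sqr. Qed.

Lemma cabs_conj z : cabs (conjc z) = cabs z.
Proof. by case: z => a b /=; rewrite sqrrN. Qed.

Lemma cabs_sum (I : Type) (s : seq I) (P : pred I) (F : I -> R[i]) :
  cabs (\sum_(i <- s | P i) F i) <= \sum_(i <- s | P i) cabs (F i).
Proof.
elim/big_ind2 : _ => //; first by rewrite cabs0.
by move=> z a w b za wb; rewrite (le_trans (cabsD _ _))// lerD.
Qed.

Lemma Re_le_cabs z : complex.Re z <= cabs z.
Proof.
case: z => a b /=; rewrite (le_trans (ler_norm a))// -sqrtr_sqr.
by rewrite ler_wsqrtr// lerDl sqr_ge0.
Qed.

Lemma cabs_le_ReIm z : cabs z <= `|complex.Re z| + `|complex.Im z|.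
Proof.
case: z => a b /=; rewrite -[leRHS]ger0_norm ?addr_ge0//.
rewrite -sqrtr_sqr ler_wsqrtr// sqrrD !real_normK ?num_real//.
by rewrite -addrA lerD2l addrC lerDl mulrn_wge0// mulr_ge0.
Qed.

Definition ex t : R[i] := expi (2 * pi * t).

Lemma expiD t u : expi (t + u) = expi t * expi u :> R[i].
Proof. by rewrite /expi cosD sinD; simpc; congr Complex; rewrite addrC. Qed.

Lemma exD t u : ex (t + u) = ex t * ex u.
Proof. by rewrite /ex mulrDr expiD. Qed.

Lemma ex0 : ex 0 = 1.
Proof. by rewrite /ex mulr0 /expi cos0 sin0. Qed.

Lemma exM_nat t n : ex (t * n%:R) = ex t ^+ n.
Proof.
elim: n => [|n IHn]; first by rewrite mulr0 ex0.
by rewrite mulrS mulrDr mulr1 exD IHn exprS.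
Qed.

Lemma cabs_expi t : cabs (expi t) = 1.
Proof. by rewrite /expi /= cos2Dsin2 sqrtr1. Qed.

Lemma cabs_ex t : cabs (ex t) = 1.
Proof. exact: cabs_expi. Qed.

Lemma exN t : ex (- t) = conjc (ex t).
Proof. by rewrite /ex /expi mulrN cosN sinN. Qed.

Lemma ex1 : ex 1 = 1.
Proof. by rewrite /ex mulr1 /expi [2 * pi]mulr_natl cos2pi sin2pi. Qed.

Lemma ex_nat n : ex n%:R = 1.
Proof. by rewrite -[n%:R]mul1r exM_nat ex1 expr1n. Qed.

Lemma cabs_ex_sub1 t : cabs (ex t - 1) = 2 * `|sin (pi * t)|.
Proof.
rewrite -[RHS]ger0_norm ?mulr_ge0// -sqrtr_sqr; congr Num.sqrt.
rewrite exprMn real_normK ?num_real// oppr0 addr0 -mulrA [2 * (pi * t)]mulr_natl.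
rewrite cos_mulr2n sin_mulr2n !mulr2n.
have := cos2Dsin2 (pi * t); set c := cos _; set s := sin _ => E.
have {}E : c ^+ 2 = 1 - s ^+ 2 by rewrite -E addrK.
transitivity ((2 * c ^+ 2 - 2) ^+ 2 + 4 * c ^+ 2 * s ^+ 2); first by ring.
by rewrite E; ring.
Qed.

(** With [s = t / 2], the mean value theorem gives [sin s >= s * cos s], so [sin t = 2 * sin s * cos
    s >= t * cos s ^ 2]; and [cos s ^ 2 >= 1 / 2] because [cos t >= 0]. *)
Lemma sin_ge_half t : 0 <= t <= pi / 2 -> t / 2 <= sin t.
Proof.
move=> /andP[t0 t2]; pose s := t / 2.
have ts : t = s *+ 2 by rewrite /s -mulr_natr divfK.
have [->|tn0] := eqVneq t 0; first by rewrite sin0 mul0r.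
have s0 : 0 < s by rewrite divr_gt0// lt_def tn0.
have pi0 := pi_gt0 R.
have spi : s <= pi by rewrite /s; lra.
have cs2 : 1 / 2 <= cos s ^+ 2.
  have : 0 <= cos t by apply: cos_ge0_pihalf; lra.
  by rewrite {1}ts cos_mulr2n mulr2n => ?; lra.
have cs0 : 0 <= cos s by apply: cos_ge0_pihalf; rewrite /s; lra.
have [c /andP[c0 cs]] := @MVT R sin cos 0 s s0 (fun x _ => is_derive_sin x)
   (continuous_subspaceT (@continuous_sin R)).
rewrite sin0 !subr0 => sE.
have ccs : cos s <= cos c.
  rewrite leNgt; apply/negP; by rewrite ltr_cos ?in_itv/= ?(ltW c0) ?(ltW s0) ?spi ?(le_trans (ltW cs) spi)// ltNge (ltW cs).
rewrite {2}ts sin_mulr2n sE -mulr_natr.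
have : 0 <= s * (cos c - cos s) * cos s by rewrite !mulr_ge0 ?subr_ge0// ltW.
have : 0 <= s * (cos s ^+ 2 - 1/2) by rewrite mulr_ge0 ?subr_ge0// ltW.
rewrite -/s; nra.
Qed.

Lemma sin_pi_ge t : 0 <= t <= 1 -> Num.min t (1 - t) <= sin (pi * t).
Proof.
have H u : 0 <= u <= 1/2 -> u <= sin (pi * u).
  move=> u01; have pi2 := pi_ge2 R; have pi0 := pi_gt0 R.
  apply: le_trans (sin_ge_half _); last by apply/andP; split; nra.
  nra.
move=> t01; have [t2|t2] := leP t (1/2).
  by rewrite (le_trans _ (H t _))// ?ge_min ?lexx//; lra.
have <- : sin (pi * (1 - t)) = sin (pi * t).
  by rewrite mulrBr mulr1 sinB sinpi cospi mul0r sub0r mulN1r opprK.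
by rewrite (le_trans _ (H (1 - t) _))// ?ge_min ?lexx ?orbT//; lra.
Qed.

(** Multiplying by [ex t - 1] telescopes the sum to modulus at most 2, while [ex t - 1] itself has
    modulus at least twice the distance from [t] to the nearest integer. *)
Lemma geometric_ex_le (p : nat) t : 0 < t < 1 ->
  cabs (\sum_(r < p) ex (t * r%:R)) <= t^-1 + (1 - t)^-1.
Proof.
move=> /andP[t0 t1].
have mt : 0 < Num.min t (1 - t) by rewrite lt_min t0 subr_gt0.
have st : Num.min t (1 - t) <= sin (pi * t) by rewrite sin_pi_ge// !ltW.
have sge : 0 < sin (pi * t) by rewrite (lt_le_trans mt).
have : 2 * sin (pi * t) * cabs (\sum_(r < p) ex (t * r%:R)) <= 2.
  rewrite -[sin _]gtr0_norm// -cabs_ex_sub1 -cabsM.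
  under eq_bigr do rewrite exM_nat.
  rewrite -subrX1 -exM_nat cabs_ex_sub1 ger_pMr// (le_trans _ (sin_max (pi * (t * p%:R))))//.
rewrite -mulrA ger_pMr// -ler_pdivlMl// mulr1 => /le_trans; apply.
rewrite (le_trans (y := (Num.min t (1 - t))^-1))//.
  by rewrite lef_pV2.
by case: (leP t (1 - t)) => _; rewrite ?lerDl ?lerDr invr_ge0 ?subr_ge0 ltW.
Qed.

End ComplexModulus.

(** * Exponential sums with one prime denominator *)

Section PrimeFractions.
Variable R : realType.
Local Notation cabs := (@Normc.normc R).

(** The value 1 at 0 turns [p * harm i] into the trivial bound [p] when the remainder vanishes and
    the geometric bound is void. *)
Definition harm (i : nat) : R := (maxn i 1)%:R^-1.

Lemma harm_ge0 i : 0 <= harm i. Proof. by rewrite invr_ge0. Qed.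

Lemma harm0 : harm 0 = 1. Proof. exact: invr1. Qed.

(** Each dyadic block of indices contributes at most 1. *)
Lemma sum_harm m : \sum_(i < 2 ^ m) harm i <= m.+1%:R.
Proof.
elim: m => [|m IHm]; first by rewrite expn0 big_ord1 /harm invr1.
rewrite expnS mul2n -addnn -(big_mkord xpredT) (big_cat_nat (n := (2 ^ m)%N))//= ?leq_addr//.
rewrite big_mkord -[m.+2]addn1 natrD lerD// -{1}[(2 ^ m)%N]add0n big_addn addnK.
rewrite (@le_trans _ _ (\sum_(0 <= i < 2 ^ m) (2 ^ m)%:R^-1))//.
  apply: ler_sum => i _; rewrite /harm lef_pV2 ?posrE ?ltr0n ?expn_gt0//; last first.
    by rewrite leq_max orbT.
  by rewrite ler_nat leq_max leq_addl.
by rewrite big_const_nat subn0 iter_addr_0 -[_ *+ _]mulr_natr mulVf// pnatr_eq0 -lt0n expn_gt0.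
Qed.

(** Whole multiples of [p] in [eta] do not change the sum; what remains is the phase [(a + th) / p]
    with [a] the remainder and [0 <= th < 1]. The geometric bound gives [p / a] and
    [p / (p - 1 - a)], and the summand 1 is the missing term [r = 0]. *)
Lemma prime_ex_sum (p : nat) (eta : R) : (0 < p)%N -> 0 <= eta ->
  cabs (\sum_(1 <= r < p) ex (eta * (r%:R / p%:R))) <=
  1 + p%:R * (harm (Num.truncn eta %% p) + harm (p.-1 - Num.truncn eta %% p)).
Proof.
move=> p0 eta0; set a := (Num.truncn eta %% p)%N; pose b := (Num.truncn eta %/ p)%N.
have pR : 0 < p%:R :> R by rewrite ltr0n.
have ap : (a < p)%N by rewrite ltn_mod.
have /andP[n1 n2] := truncn_itv eta0.
have nE : Num.truncn eta = (b * p + a)%N by rewrite -divn_eq.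
pose th := eta - (Num.truncn eta)%:R.
have th01 : 0 <= th < 1 by rewrite /th; apply/andP; split; [lra|move: n2; rewrite -natr1; lra].
have etaE : eta = b%:R * p%:R + (a%:R + th) by rewrite addrA -natrM -natrD -nE /th addrC subrK.
set S := \sum_(_ <= _ < _) _.
have -> : S = \sum_(r < p) ex ((a%:R + th) / p%:R * r%:R) - 1.
  rewrite -(big_mkord xpredT (fun r => ex ((a%:R + th) / p%:R * r%:R))).
  rewrite [in RHS]big_ltn// mulr0 ex0 [RHS]addrC addKr.
  apply: eq_bigr => r _; rewrite etaE mulrDl exD.
  have -> : b%:R * p%:R * (r%:R / p%:R) = (b * r)%N%:R :> R.
    by rewrite natrM; field; lra.
  by rewrite ex_nat mul1r; congr ex; field; lra.
rewrite addrC (le_trans (cabsD _ _))// cabsN cabs1 lerD2l.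
have triv : cabs (\sum_(r < p) ex ((a%:R + th) / p%:R * r%:R)) <= p%:R.
  rewrite (le_trans (cabs_sum _ _ _))//.
  rewrite (eq_bigr (fun=> 1)); last by move=> i _; rewrite cabs_ex.
  by rewrite sumr_const card_ord.
have [a0|a0] := posnP a.
  by rewrite (le_trans triv)// ler_peMr ?(ltW pR)// a0 harm0 lerDl harm_ge0.
have [pa|pa] := posnP (p.-1 - a).
  by rewrite (le_trans triv)// ler_peMr ?(ltW pR)// pa harm0 lerDr harm_ge0.
have aR : 0 < a%:R :> R by rewrite ltr0n.
have paR : 0 < (p.-1 - a)%:R :> R by rewrite ltr0n.
have paE : (p.-1 - a)%:R = p%:R - 1 - a%:R :> R.
  by rewrite natrB ?natrB -?subn1 ?natrB//; lia.
rewrite paE in paR.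
have t01 : 0 < (a%:R + th) / p%:R < 1.
  rewrite divr_gt0 ?ltr_pdivrMr//; lra.
rewrite (le_trans (geometric_ex_le _ t01))// mulrDr lerD//.
  by rewrite /harm (maxn_idPl a0) invf_div ler_wpM2l ?(ltW pR)// lef_pV2 ?posrE; lra.
have -> : 1 - (a%:R + th) / p%:R = (p%:R - a%:R - th) / p%:R by field; lra.
rewrite /harm (maxn_idPl pa) invf_div ler_wpM2l ?(ltW pR)// paE lef_pV2 ?posrE; lra.
Qed.

Definition fracs m : seq R :=
  [seq r%:R / p%:R : R | p <- primes_upto (2 ^ m), r <- iota 1 p.-1].

Lemma size_fracs m : size (fracs m) = \sum_(p <- primes_upto (2 ^ m)) p.-1.
Proof.
rewrite size_allpairs_dep sumnE big_map; apply: eq_bigr => p _.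
by rewrite size_iota.
Qed.

Lemma big_fracs (V : nmodType) m (F : R -> V) :
  \sum_(x <- fracs m) F x =
  \sum_(p <- primes_upto (2 ^ m)) \sum_(1 <= r < p) F (r%:R / p%:R).
Proof.
rewrite big_allpairs_dep; apply: eq_bigr => p _.
by rewrite /index_iota subn1.
Qed.

Lemma mem_fracs m x : x \in fracs m -> exists p r : nat,
  [/\ prime p, (p <= 2 ^ m)%N, (0 < r < p)%N & x = r%:R / p%:R].
Proof.
case/allpairsPdep => p [r [+ + ->]].
rewrite mem_primes_upto mem_iota => /andP[pp pm] /andP[r0 rp].
by exists p, r; rewrite pp pm r0; split=> //; lia.
Qed.

(** Exchange the sums: all primes with the same value [i = f p] divide the single integer [j i], so
    there are at most [L] of them, and the sum over [i] is harmonic. *)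
Lemma sum_harm_dvd m L (Q : pred nat) (f j : nat -> nat) :
  (forall p, p \in primes_upto (2 ^ m) -> Q p ->
     [/\ (f p < 2 ^ m)%N, (p %| j (f p))%N & (0 < j (f p) < 2 ^ L)%N]) ->
  \sum_(p <- primes_upto (2 ^ m) | Q p) p%:R * harm (f p) <=
  (2 ^ m)%:R * L%:R * m.+1%:R :> R.
Proof.
move=> H; set P := primes_upto _.
pose c (i p : nat) : nat := ((0 < j i < 2 ^ L) && (p %| j i))%N.
have : \sum_(p <- P | Q p) p%:R * harm (f p) <=
       \sum_(p <- P) \sum_(i < 2 ^ m) (2 ^ m)%:R * harm i * (c i p)%:R.
  rewrite big_mkcond big_seq [leRHS]big_seq; apply: ler_sum => p pP.
  have ge0 (k : nat) : 0 <= (2 ^ m)%:R * harm k * (c k p)%:R.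
    by rewrite !mulr_ge0 ?harm_ge0.
  case: ifPn => Qp; last exact: sumr_ge0.
  have [fm pj j0] := H _ pP Qp.
  rewrite (bigD1 (Ordinal fm))//= /c j0 pj mulr1 ler_wpDr ?sumr_ge0//.
  rewrite ler_wpM2r ?harm_ge0// ler_nat.
  by move: pP; rewrite mem_primes_upto => /andP[].
move/le_trans; apply; rewrite exchange_big/=.
rewrite (@le_trans _ _ (\sum_(i < 2 ^ m) (2 ^ m)%:R * L%:R * harm i))//; last first.
  by rewrite -mulr_sumr ler_wpM2l ?sum_harm// mulr_ge0.
apply: ler_sum => i _; rewrite -mulr_sumr mulrAC ler_wpM2r ?harm_ge0//.
rewrite ler_wpM2l// -natr_sum ler_nat /c; case: (boolP (0 < j i < 2 ^ L)%N) => [ji|_] /=.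
  rewrite -(big_map (fun p => (p %| j i)%N : nat) xpredT id) -sumnE sumn_count.
  exact: count_primes_dvd.
by rewrite big1_eq.
Qed.

End PrimeFractions.

(** * Exponential sums over all fractions with prime denominator *)

Section PrimeFractionSum.
Variable R : realType.
Local Notation cabs := (@Normc.normc R).

Lemma size_fracs_gt0 m : (0 < m)%N -> (0 < size (fracs R m))%N.
Proof.
case: m => // m _; rewrite size_fracs.
have := sum_primes_upto m; case: (\sum_(_ <- _) _)%N => //.
by rewrite muln0 leqn0 expn_eq0.
Qed.

Lemma size_fracs_ge m : (0 < m)%N ->
  (4 ^ m <= 20 * m ^ 2 * size (fracs R m))%N.
Proof. by case: m => // m _; rewrite size_fracs; exact: sum_primes_upto. Qed.

(** With [n] the integer part of [|eta|] and [a = n %% p], the sum for [p] is large only if [a] or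
    [p.-1 - a] is small, that is, if [p] divides an integer near [n]: it divides [n - a] and
    [n + 1 + (p.-1 - a)]. These integers are below [2 ^ L], so few primes qualify. *)
Lemma fracs_ex_sum m L (eta : R) : (0 < m)%N -> (0 < L)%N -> 1 <= `|eta| ->
  (Num.truncn `|eta| + 1 + 2 ^ m <= 2 ^ L)%N ->
  cabs (\sum_(x <- fracs R m) ex (eta * x)) <=
  (size (fracs R m))%:R * (4 / `|eta| + 60 * m%:R ^+ 2 * m.+1%:R * L%:R / (2 ^ m)%:R).
Proof.
move=> m0 L0; wlog eta0 : eta / 0 <= eta => [H|].
  have [e0|e0] := leP 0 eta; first exact: H.
  have := H (- eta); rewrite normrN oppr_ge0 => /(_ (ltW e0)) H1 e1 e2.
  rewrite (le_trans _ (H1 e1 e2))// -cabs_conj.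
  suff -> : conjc (\sum_(x <- fracs R m) ex (eta * x)) =
            \sum_(x <- fracs R m) ex (- eta * x) by [].
  by rewrite raddf_sum; apply: eq_bigr => x _; rewrite mulNr exN.
rewrite ger0_norm// => e1 nL; set n := Num.truncn eta in nL *.
have n1 : (1 <= n)%N by rewrite truncn_ge_nat.
have nR : 0 < n%:R :> R by rewrite ltr0n.
have en : eta <= 2 * n%:R.
  have /andP[_] := truncn_itv eta0; rewrite -/n -natr1.
  have : 1 <= n%:R :> R by rewrite ler1n.
  lra.
set P := primes_upto (2 ^ m).
have -> : size (fracs R m) = \sum_(p <- P) p.-1 by rewrite size_fracs.
set T := \sum_(p <- P) p.-1.
have PM : (size P)%:R <= (2 ^ m)%:R :> R.
  rewrite ler_nat -[X in (_ <= X)%N](size_iota 1) uniq_leq_size ?primes_upto_uniq//.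
  move=> p; rewrite mem_primes_upto mem_iota => /andP[pp pm].
  by rewrite prime_gt0//= add1n ltnS.
have T4 : (4 ^ m)%:R <= 20 * m%:R ^+ 2 * T%:R :> R.
  by rewrite -[20]/(20%:R) -natrX -!natrM ler_nat /T /P -(size_fracs R) size_fracs_ge.
rewrite big_fracs (le_trans (cabs_sum _ _ _))//.
have S1 : \sum_(p <- P) cabs (\sum_(1 <= r < p) ex (eta * (r%:R / p%:R))) <=
   (size P)%:R + (\sum_(p <- P) p%:R * harm R (n %% p) + \sum_(p <- P) p%:R * harm R (p.-1 - n %% p)).
  rewrite -sum1_size natr_sum -!big_split /= big_seq [leRHS]big_seq; apply: ler_sum => p.
  rewrite mem_primes_upto => /andP[pp _].
  by rewrite -mulrDr prime_ex_sum// prime_gt0.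
rewrite (le_trans S1)// (bigID (fun p => n < p)%N)/=.
(* Here [n - n %% p] is 0 and divisibility says nothing, but the remainder is [n] itself, so [harm]
   is [1 / n], and [p <= 2 * p.-1]. *)
have S2 : \sum_(p <- P | (n < p)%N) p%:R * harm R (n %% p) <= 2 * T%:R / n%:R.
  rewrite natr_sum mulr_sumr mulr_suml big_mkcond big_seq [leRHS]big_seq.
  apply: ler_sum => p; rewrite mem_primes_upto => /andP[pp _]; have p1 := prime_gt1 pp.
  case: ifP => np; last by rewrite divr_ge0// mulr_ge0.
  rewrite modn_small// /harm (maxn_idPl n1) ler_wpM2r ?invr_ge0//.
  by rewrite -natrM ler_nat; lia.
have S3 : \sum_(p <- P | ~~ (n < p)%N) p%:R * harm R (n %% p) <=
    (2 ^ m)%:R * L%:R * m.+1%:R.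
  apply: (@sum_harm_dvd R m L (fun p => ~~ (n < p)%N) (fun p => n %% p)%N
    (fun i => n - i)%N) => p.
  rewrite mem_primes_upto => /andP[pp pm]; rewrite -leqNgt => np.
  have np' : (n %% p < p)%N by rewrite ltn_mod prime_gt0.
  split; first by rewrite (leq_trans np').
    by rewrite {1}(divn_eq n p) addnK dvdn_mull.
  rewrite subn_gt0 (leq_trans np' np) (leq_ltn_trans (leq_subr _ _))//.
  by rewrite (leq_trans _ nL)// addn1 leq_addr.
have S4 : \sum_(p <- P) p%:R * harm R (p.-1 - n %% p) <=
    (2 ^ m)%:R * L%:R * m.+1%:R.
  apply: (@sum_harm_dvd R m L xpredT (fun p => p.-1 - n %% p)%N
    (fun i => n + 1 + i)%N) => p.
  rewrite mem_primes_upto => /andP[pp pm] _; have p0 := prime_gt0 pp.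
  have np' : (n %% p < p)%N by rewrite ltn_mod.
  split.
  - by rewrite (leq_ltn_trans (leq_subr _ _))// (leq_trans _ pm)// prednK.
  - have -> : (n + 1 + (p.-1 - n %% p) = (n %/ p).+1 * p)%N.
      rewrite {1}(divn_eq n p) mulSn; move: np' p0.
      by move: (n %% p)%N (n %/ p * p)%N => r t; clear; lia.
    exact: dvdn_mull.
  - apply/andP; split; first by rewrite addn1.
    rewrite (leq_trans _ nL)// ltn_add2l (leq_ltn_trans (leq_subr _ _))//.
    by rewrite (leq_trans _ pm)// prednK.
apply: (@le_trans _ _ ((2 ^ m)%:R + (2 * T%:R / n%:R + (2 ^ m)%:R * L%:R * m.+1%:R +
   (2 ^ m)%:R * L%:R * m.+1%:R))).
  by rewrite lerD// lerD// lerD.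
rewrite -[m.+1%:R]natr1.
have M0 : 0 < (2 ^ m)%:R :> R by rewrite ltr0n expn_gt0.
have T0 : 0 <= T%:R :> R by [].
have L1 : 1 <= L%:R :> R by rewrite ler1n.
have m1 : 1 <= m%:R :> R by rewrite ler1n.
have M4 : (4 ^ m)%:R = (2 ^ m)%:R * (2 ^ m)%:R :> R.
  by rewrite -natrM -expnMn.
have H1 : 2 * T%:R / n%:R <= T%:R * (4 / eta).
  rewrite ler_pdivrMr// [leRHS](_ : _ = T%:R * (2 * (2 * n%:R)) / eta); last by field; lra.
  rewrite ler_pdivlMr; last by lra.
  nra.
have H2 : (2 ^ m)%:R <= (20 * m%:R ^+ 2 * T%:R) / (2 ^ m)%:R :> R.
  by rewrite ler_pdivlMr// -M4.
(* Three error terms are at most [2 ^ m * (L * m.+1)], and [H2] trades [2 ^ m] for the number of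
   fractions with a factor 20: hence the 60. *)
have H3 : 1 <= L%:R * (m%:R + 1) :> R by nra.
have H4 : (2 ^ m)%:R * 3 * (L%:R * (m%:R + 1)) <=
   (20 * m%:R ^+ 2 * T%:R) / (2 ^ m)%:R * 3 * (L%:R * (m%:R + 1)) :> R.
  by rewrite ler_wpM2r ?ler_wpM2r//; lra.
rewrite [leRHS]mulrDr.
have -> : T%:R * (60 * m%:R ^+ 2 * (m%:R + 1) * L%:R / (2 ^ m)%:R) =
  (20 * m%:R ^+ 2 * T%:R) / (2 ^ m)%:R * 3 * (L%:R * (m%:R + 1)) :> R by field; lra.
apply: le_trans (lerD H1 H4).
nra.
Qed.

End PrimeFractionSum.

(** * Spacing of the fractions *)

Section FractionSpacing.
Variable R : realType.

Lemma exp2V_le (m n : nat) : (n <= m)%N -> 2 ^- m <= 2 ^- n :> R.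
Proof. by move=> nm; rewrite lef_pV2 ?posrE ?exprn_gt0// ler_weXn2l// ler1n. Qed.

Lemma exp2V_gt0 n : 0 < 2 ^- n :> R.
Proof. by rewrite invr_gt0 exprn_gt0. Qed.

Lemma exp2V_le1 n : 2 ^- n <= 1 :> R.
Proof. by rewrite invf_le1 ?exprn_gt0// exprn_ege1// ler1n. Qed.

Lemma exp2VD m n : 2 ^- (m + n) = 2 ^- m * 2 ^- n :> R.
Proof. by rewrite exprD invfM. Qed.

Lemma fracs_itv m x : x \in fracs R m -> 2 ^- m <= x <= 1 - 2 ^- m.
Proof.
case/mem_fracs => p [r [pp pm /andP[r0 rp] ->]].
have p0 : 0 < p%:R :> R by rewrite ltr0n prime_gt0.
have pV : 2 ^- m <= p%:R^-1 :> R.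
  by rewrite lef_pV2 ?posrE ?exprn_gt0// -natrX ler_nat.
have rp1 : r%:R <= p%:R - 1 :> R by rewrite lerBrDr natr1 ler_nat.
have r1 : 1 <= r%:R :> R by rewrite ler1n.
apply/andP; split.
  by rewrite (le_trans pV)// ler_peMl// invr_ge0 ltW.
rewrite (@le_trans _ _ (1 - p%:R^-1))// ?lerD2l ?lerN2//.
by rewrite ler_pdivrMr// mulrBl mul1r mulVf// lt0r_neq0.
Qed.

(** The difference has denominator at most [4 ^ m] and an integer numerator, nonzero because
    fractions with prime denominator are in lowest terms and so are listed once. Comparing indices
    makes the absence of repetitions part of the claim. *)
Lemma fracs_sep m i j : (i < size (fracs R m))%N -> (j < size (fracs R m))%N ->
  i != j -> 4 ^- m <= `|nth 0 (fracs R m) i - nth 0 (fracs R m) j|.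
Proof.
have uniq_fracs : uniq (fracs R m).
  apply: allpairs_uniq_dep => [|p _|]; first exact: primes_upto_uniq.
    exact: iota_uniq.
  move=> [p r] [p' r'] /allpairsPdep[p1 [r1 [+ + ->]]].
  move=> + + /allpairsPdep[p2 [r2 [+ + ->]]].
  rewrite !mem_primes_upto !mem_iota => /andP[pp1 _] rp1 /andP[pp2 _] rp2 /=.
  have p10 := prime_gt0 pp1; have p20 := prime_gt0 pp2.
  have p1R : p1%:R != 0 :> R by rewrite pnatr_eq0 -lt0n.
  have p2R : p2%:R != 0 :> R by rewrite pnatr_eq0 -lt0n.
  move/eqP; rewrite eqr_div// -!natrM eqr_nat => /eqP E.
  have p12 : p1 = p2.
    have : (p1 %| r1 * p2)%N by rewrite E dvdn_mull.
    rewrite Euclid_dvdM// => /orP[/dvdn_leq|]; first by lia.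
    by rewrite dvdn_prime2// => /eqP.
  by move/eqP: E; rewrite p12 eqn_pmul2r// => /eqP ->.
move=> im jm ij; have : nth 0 (fracs R m) i != nth 0 (fracs R m) j.
  by rewrite nth_uniq.
have /mem_fracs[p [r [pp pm _ ->]]] := mem_nth 0 im.
have /mem_fracs[p' [r' [pp' pm' _ ->]]] := mem_nth 0 jm.
have pR : 0 < p%:R :> R by rewrite ltr0n prime_gt0.
have pR' : 0 < p'%:R :> R by rewrite ltr0n prime_gt0.
move=> ne; have -> : r%:R / p%:R - r'%:R / p'%:R =
    (r%:R * p'%:R - r'%:R * p%:R) / (p%:R * p'%:R) :> R by field; lra.
rewrite normrM [X in _ * X]gtr0_norm ?invr_gt0 ?mulr_gt0// ler_pdivlMr ?mulr_gt0//.
rewrite (@le_trans _ _ 1)//.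
  rewrite mulrC ler_pdivrMr ?exprn_gt0// mul1r -natrM -natrX ler_nat.
  by rewrite -[4%N]/(2 * 2)%N expnMn leq_mul.
move: ne; rewrite -subr_eq0; apply: contraNT; rewrite -ltNge.
have -> : r%:R * p'%:R - r'%:R * p%:R = (r%:Z * p'%:Z - r'%:Z * p%:Z)%:~R :> R.
  by rewrite intrB !intrM.
rewrite -intr_norm -[1]/(1%:~R) ltr_int.
rewrite -!PoszM => H; have E : (r * p')%N = (r' * p)%N by lia.
by rewrite subr_eq0 eqr_div ?lt0r_neq0// -!natrM E.
Qed.

End FractionSpacing.

(** * The Cantor construction: levels, digits and points *)

Section CantorLevels.
Variables (R : realType) (alpha : R).
Hypothesis alpha_gt0 : 0 < alpha.

(* [pt l] enumerates, with multiplicity, the sums over [i < l] of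
   [2 ^- lev i * (r / p)] with [p <= 2 ^ lgM i] prime and [0 < r < p].  The
   recursion for [lev] makes such a sum, whose denominator is small, an
   approximation of exponent [2 + alpha] of every longer one; the multiple
   [3 * lev l] leaves room for the translations and dilations applied later. *)
Fixpoint lev (l : nat) : nat :=
  if l is l'.+1 then
    (Num.truncn ((2 + alpha) * (((lev l').+1 ^ 2 + 3 * lev l')%N)%:R)).+1
  else 0.

(** Quadratic in [lev l], so that [3 * lev l] is of lower order in the recursion and
    [lev l.+1 / lgM l] tends to [2 + alpha]; polynomials in [lev l.+1] are negligible against
    [2 ^ lgM l]. *)
Definition lgM (l : nat) : nat := ((lev l).+1 ^ 2)%N.

Definition digits (l : nat) : seq R := fracs R (lgM l).

Fixpoint cells (l : nat) : nat :=
  if l is l'.+1 then (cells l' * size (digits l'))%N else 1%N.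

Fixpoint pt (l i : nat) : R :=
  if l is l'.+1 then
    pt l' (i %/ size (digits l')) +
    2 ^- lev l' * nth 0 (digits l') (i %% size (digits l'))
  else 0.

Lemma lgM_gt0 l : (0 < lgM l)%N.
Proof. by rewrite expn_gt0. Qed.

Lemma size_digits_gt0 l : (0 < size (digits l))%N.
Proof. exact/size_fracs_gt0/lgM_gt0. Qed.

Lemma cells_gt0 l : (0 < cells l)%N.
Proof. by elim: l => //= l IHl; rewrite muln_gt0 IHl size_digits_gt0. Qed.

Lemma lev_itv l :
  (2 + alpha) * (lgM l + 3 * lev l)%:R < (lev l.+1)%:R <=
  (2 + alpha) * (lgM l + 3 * lev l)%:R + 1.
Proof.
have /truncn_itv : 0 <= (2 + alpha) * (lgM l + 3 * lev l)%:R.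
  by rewrite mulr_ge0// addr_ge0// ltW.
move=> /andP[h1 h2]; rewrite /= -/(lgM l) h2 andTb.
by rewrite -[X in X <= _]natr1 lerD2r.
Qed.

Lemma lev_geM l : (2 * (lgM l + 3 * lev l) < lev l.+1)%N.
Proof.
rewrite -(ltr_nat R) (le_lt_trans _ (andP (lev_itv l)).1)// natrM ler_wpM2r//.
by rewrite lerDl ltW.
Qed.

Lemma lev_lt l : (lev l < lev l.+1)%N.
Proof. by have := lev_geM l; lia. Qed.

Lemma lev_ge l : (l <= lev l)%N.
Proof. by elim: l => // l IHl; rewrite (leq_ltn_trans IHl)// lev_lt. Qed.

Lemma nth_digits_itv l i :
  2 ^- lgM l <= nth 0 (digits l) (i %% size (digits l)) <= 1 - 2 ^- lgM l.
Proof. by apply/fracs_itv/mem_nth; rewrite ltn_mod size_digits_gt0. Qed.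

(** The intervals of length [2 ^- lev l] starting at the points are nested: a digit stays
    [2 ^- lgM l] below 1, and this gap, scaled by [2 ^- lev l], has room for the next length. *)
Lemma pt_next l i : let a := pt l (i %/ size (digits l)) in
  (a <= pt l.+1 i /\ pt l.+1 i <= a + 2 ^- lev l - 2 ^- lev l.+1).
Proof.
move=> a; have /andP[x1 x2] := nth_digits_itv l i.
rewrite [pt l.+1 i]/= -/a; move: x1 x2; set x := nth _ _ _ => x1 x2.
have L : 2 ^- lev l.+1 <= 2 ^- lev l * 2 ^- lgM l :> R.
  by rewrite -exp2VD exp2V_le//; have := lev_geM l; lia.
have d0 := exp2V_gt0 R (lev l); have m0 := exp2V_gt0 R (lgM l).
by split; nra.
Qed.

Lemma pt_itv l i : 0 <= pt l i <= 1 - 2 ^- lev l.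
Proof.
elim: l i => [|l IHl] i; first by rewrite /= expr0 invr1; lra.
have [H1 H2] := pt_next l i; have := IHl (i %/ size (digits l))%N.
move: H1 H2; set a := pt l _; set b := pt l.+1 i; lra.
Qed.

End CantorLevels.

(** * Separation and mean exponentials of the points *)

Section CantorSums.
Variables (R : realType) (alpha : R).
Hypothesis alpha_gt0 : 0 < alpha.
Local Notation cabs := (@Normc.normc R).
Local Notation lev := (lev alpha).
Local Notation lgM := (lgM alpha).
Local Notation digits := (digits alpha).
Local Notation cells := (cells alpha).
Local Notation pt := (pt alpha).

(** Points with a common parent differ by a scaled difference of digits. Points with different
    parents stay apart because digits avoid a margin [2 ^- lgM l] at both ends of the parent
    interval. *)
Lemma pt_sep_next l :
  (forall i j, (i < cells l)%N -> (j < cells l)%N -> i != j ->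
     2 ^- lev l <= `|pt l i - pt l j|) ->
  forall i j, (i < cells l.+1)%N -> (j < cells l.+1)%N -> i != j ->
     2 ^- lev l * 4 ^- lgM l <= `|pt l.+1 i - pt l.+1 j|.
Proof.
move=> sep i j il jl ij; have T0 := size_digits_gt0 alpha l.
have d0 := exp2V_gt0 R (lev l); have m0 := exp2V_gt0 R (lgM l).
have m1 : 2 ^- lgM l <= 1 :> R by exact: exp2V_le1.
have [ab|ab] := eqVneq (i %/ size (digits l))%N (j %/ size (digits l))%N.
  rewrite [pt l.+1 i]/= [pt l.+1 j]/= ab opprD addrACA subrr add0r -mulrBr normrM gtr0_norm//.
  rewrite ler_wpM2l ?(ltW d0)// fracs_sep ?ltn_mod//.
  apply: contra ij => /eqP E; apply/eqP.
  by rewrite (divn_eq i (size (digits l))) (divn_eq j (size (digits l))) ab E.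
have := sep _ _ _ _ ab; rewrite !ltn_divLR// => /(_ il jl).
have := nth_digits_itv alpha l i; have := nth_digits_itv alpha l j.
rewrite [pt l.+1 i]/= [pt l.+1 j]/=.
set a := pt l _; set b := pt l _; set x := nth _ _ _; set y := nth _ _ _.
move=> /andP[x1 x2] /andP[y1 y2].
have -> : 4 ^- lgM l = 2 ^- lgM l * 2 ^- lgM l :> R.
  by rewrite -invfM -exprMn -natrM.
move: m0 m1 d0 x1 x2 y1 y2; set m := 2 ^- lgM l; set d := 2 ^- lev l.
move=> m0 m1 d0 x1 x2 y1 y2.
have h1 : d * (x - y) <= d * (1 - 2 * m) by rewrite ler_wpM2l ?(ltW d0)//; lra.
have h2 : d * (y - x) <= d * (1 - 2 * m) by rewrite ler_wpM2l ?(ltW d0)//; lra.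
have h3 : d * m * m <= d * m by rewrite ler_piMr// mulr_ge0// ltW.
have h4 : 0 < d * m by rewrite mulr_gt0.
have [ab0|ab0] := leP 0 (a - b).
  rewrite ger0_norm// => ?; rewrite (le_trans _ (ler_norm _))//; nra.
rewrite ltr0_norm// => ?; rewrite -normrN (le_trans _ (ler_norm _))//; nra.
Qed.

Lemma pt_sep l i j : (i < cells l)%N -> (j < cells l)%N -> i != j ->
  2 ^- lev l <= `|pt l i - pt l j|.
Proof.
elim: l i j => [|l IHl] i j; first by rewrite !ltnS !leqn0 => /eqP -> /eqP ->.
move=> il jl ij; apply: le_trans (pt_sep_next IHl il jl ij).
rewrite -[4]/(4%:R) -[4%N]/(2 ^ 2)%N natrX -exprM -exp2VD exp2V_le//.
by have := lev_geM alpha_gt0 l; lia.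
Qed.

(** The integer part of [(f i - c) / h] is injective on the indices counted. *)
Lemma count_separated (n : nat) (f : nat -> R) (h c len : R) :
  0 < h -> 0 <= len ->
  (forall i j, (i < n)%N -> (j < n)%N -> i != j -> h <= `|f i - f j|) ->
  (\sum_(i < n) (c <= f i <= c + len)%R)%:R <= len / h + 1.
Proof.
move=> h0 len0 sep; set P := fun i => c <= f i <= c + len.
rewrite -(big_mkord xpredT (fun i => P i : nat)).
rewrite -(big_map (fun i => P i : nat) xpredT id) -sumnE sumn_count -size_filter.
set s := [seq i <- _ | _].
have sP i : i \in s -> (i < n)%N /\ c <= f i <= c + len.
  by rewrite mem_filter mem_index_iota => /andP[-> /andP[_ ->]].
pose g i := Num.truncn ((f i - c) / h).
have gitv i : i \in s -> (g i)%:R * h <= f i - c < (g i).+1%:R * h.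
  move=> /sP[_ /andP[fi _]]; rewrite -ler_pdivlMr// -ltr_pdivrMr//.
  by rewrite truncn_itv// divr_ge0 ?subr_ge0// ltW.
have : (size (map g s) <= size (iota 0 (Num.truncn (len / h)).+1))%N.
  apply: uniq_leq_size.
    rewrite map_inj_in_uniq ?filter_uniq ?iota_uniq// => i j si sj gij.
    have /andP[i1 i2] := gitv _ si; have /andP[j1 j2] := gitv _ sj.
    apply/eqP/negPn/negP => ij.
    have [il _] := sP _ si; have [jl _] := sP _ sj.
    have := sep _ _ il jl ij; apply/negP; rewrite -ltNge ltr_norml.
    move: i1 i2 j1 j2; rewrite gij -natr1; nra.
  move=> k /mapP[i si ->]; rewrite mem_iota /= add0n ltnS.
  rewrite truncn_ge_nat; last by rewrite divr_ge0// ltW.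
  have /andP[i1 _] := gitv _ si; have [_ /andP[_ fc]] := sP _ si.
  rewrite ler_pdivlMr//; lra.
rewrite size_map size_iota -(ler_nat R) => /le_trans; apply.
rewrite -natr1 lerD2r.
by have /andP[] := truncn_itv (divr_ge0 len0 (ltW h0)).
Qed.

Lemma sum_cells (V : nmodType) l (F : nat -> V) :
  \sum_(i < cells l.+1) F i =
  \sum_(a < cells l) \sum_(b < size (digits l)) F (a * size (digits l) + b)%N.
Proof.
rewrite -(big_mkord xpredT) /= big_nat_mul -[RHS](big_mkord xpredT (fun a =>
  \sum_(b < size (digits l)) F (a * size (digits l) + b)%N)).
apply: eq_bigr => a _; rewrite -{1}[(a * _)%N]add0n big_addn mulSn addnK.
by rewrite big_mkord; apply: eq_bigr => b _; rewrite addnC.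
Qed.

Definition digit_hat l (eta : R) : R[i] :=
  (((size (digits l))%:R^-1)%:C)%C * \sum_(x <- digits l) ex (eta * x).

Definition pt_hat l (eta : R) : R[i] :=
  (((cells l)%:R^-1)%:C)%C * \sum_(i < cells l) ex (eta * pt l i).

(** Parent and digit vary independently, so [pt_hat] is a partial product of the transform of
    [X]. *)
Lemma pt_hatS l eta :
  pt_hat l.+1 eta = pt_hat l eta * digit_hat l (2 ^- lev l * eta).
Proof.
rewrite /pt_hat /digit_hat (sum_cells l (fun i => ex (eta * pt l.+1 i))) /= natrM invfM rmorphM /= -!mulrA; congr (_ * _).
rewrite [RHS]mulrCA; congr (_ * _).
rewrite mulr_suml; apply: eq_bigr => a _.
rewrite (big_nth 0) big_mkord mulr_sumr; apply: eq_bigr => b _.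
rewrite divnMDl ?size_digits_gt0// divn_small ?ltn_ord// addn0 modnMDl modn_small//.
by rewrite -exD; congr ex; ring.
Qed.

Lemma cabs_mean_le1 (I : Type) (s : seq I) (F : I -> R) :
  cabs ((((size s)%:R^-1)%:C)%C * \sum_(i <- s) ex (F i)) <= 1.
Proof.
rewrite cabsM cabs_real ger0_norm ?invr_ge0//.
have [->|s0] := posnP (size s); first by rewrite invr0 mul0r.
rewrite ler_pdivrMl ?ltr0n// mulr1 (le_trans (cabs_sum _ _ _))//.
rewrite (eq_bigr (fun=> 1)); last by move=> i _; rewrite cabs_ex.
by rewrite big_const_seq count_predT iter_addr_0.
Qed.

Lemma cabs_digit_hat_le1 l eta : cabs (digit_hat l eta) <= 1.
Proof. exact: cabs_mean_le1. Qed.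

Lemma cabs_pt_hat_le1 l eta : cabs (pt_hat l eta) <= 1.
Proof.
have := cabs_mean_le1 (index_iota 0 (cells l)) (fun i => eta * pt l i).
by rewrite size_iota subn0 big_mkord.
Qed.

Lemma cabs_pt_hat_homo eta l l' : (l <= l')%N ->
  cabs (pt_hat l' eta) <= cabs (pt_hat l eta).
Proof.
move=> ll; rewrite -(subnKC ll); elim: (l' - l)%N => [|n IHn]; first by rewrite addn0.
by rewrite addnS pt_hatS cabsM (le_trans _ IHn)// ler_piMr ?cabs_ge0 ?cabs_digit_hat_le1.
Qed.

End CantorSums.

(** * Growth of the levels *)

Section Growth.
Variable R : realType.

Lemma pow2D (x y : R) : 2 `^ (x + y) = 2 `^ x * 2 `^ y.
Proof. by rewrite powRD// pnatr_eq0 implybT. Qed.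

Lemma pow2_gt0 (x : R) : 0 < 2 `^ x.
Proof. exact: powR_gt0. Qed.

Lemma pow2_nat n : 2 `^ n%:R = 2 ^+ n :> R.
Proof. exact: powR_mulrn. Qed.

Lemma pow2N_nat n : 2 `^ (- n%:R) = 2 ^- n :> R.
Proof. by rewrite powRN pow2_nat. Qed.

Lemma ler_pow2 (x y : R) : x <= y -> 2 `^ x <= 2 `^ y.
Proof. by move=> xy; rewrite ler_powR// ler1n. Qed.

(** A single term of the exponential series at [t * ln 2]. *)
Lemma polynomial_le_pow2 N :
  exists2 C : R, 0 < C & forall t : R, 0 <= t -> t ^+ N.+1 <= C * 2 `^ t.
Proof.
have l2 : 0 < ln 2 :> R by rewrite ln_gt0// ltr1n.
have F0 : 0 < (N.+1)`!%:R :> R by rewrite ltr0n fact_gt0.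
exists ((N.+1)`!%:R / ln 2 ^+ N.+1); first by rewrite divr_gt0// exprn_gt0.
move=> t t0; rewrite -mulrA -ler_pdivrMl// mulrC [leRHS]mulrC ler_pdivlMr ?exprn_gt0//.
rewrite mulrAC -exprMn.
rewrite (le_trans _ (_ : expR (t * ln 2) <= _))//; last by rewrite /powR pnatr_eq0.
rewrite (le_trans _ (expR_ge1Dxn N _))//; last by rewrite mulr_ge0// ltW.
by rewrite lerDr.
Qed.

Variable alpha : R.
Hypothesis alpha_gt0 : 0 < alpha.
Local Notation lev := (lev alpha).
Local Notation lgM := (lgM alpha).

(** With [t = (lev l).+1] one has [lgM l = t ^ 2], and [gam * lev l.+1] is at most
    [(1 - kap) * t ^ 2 + 3 * t + 1]. The deficit [kap * t ^ 2] absorbs the linear term and every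
    polynomial factor; this is where epsilon is spent. *)
Lemma lev_pow2_le (gam : R) N : 0 <= gam -> gam < 1 / (2 + alpha) ->
  exists2 C : R, 0 < C & forall l,
    (lev l.+1).+1%:R ^+ N.+1 * 2 `^ (gam * (lev l.+1)%:R) <= C * 2 ^+ lgM l.
Proof.
move=> gam0 gam1; have al0 := alpha_gt0.
pose kap := 1 - gam * (2 + alpha).
have a2 : 0 < 2 + alpha by rewrite addr_gt0.
have kap0 : 0 < kap by rewrite /kap subr_gt0 -ltr_pdivlMr.
have gam_le1 : gam <= 1.
  have : 1 / (2 + alpha) <= 1 by rewrite ler_pdivrMr//; lra.
  lra.
pose K := 4 * (2 + alpha) + 2.
have K0 : 0 < K by rewrite /K; lra.
have [C1 C10 HC1] := polynomial_le_pow2 (2 * N.+1).-1.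
exists (K ^+ N.+1 * C1 * 2 `^ (4 / kap + 1)).
  by rewrite !mulr_gt0 ?exprn_gt0 ?pow2_gt0.
move=> l; pose t : R := (lev l).+1%:R.
have t1 : 1 <= t by rewrite ler1n.
have mt : (lgM l)%:R = t ^+ 2 by rewrite /lgM natrX.
have Dt : (lev l)%:R = t - 1 by rewrite /t -natr1 addrK.
have /andP[_ D1] := lev_itv alpha_gt0 l.
rewrite natrD natrM mt Dt in D1.
have D2 : (lev l.+1).+1%:R <= K * t ^+ 2.
  rewrite -natr1 (le_trans (lerD D1 (lexx 1)))// /K.
  have : (2 + alpha) * (t ^+ 2 + 3 * (t - 1)) <= (2 + alpha) * (4 * t ^+ 2).
    by rewrite ler_wpM2l ?(ltW a2)//; nra.
  nra.
have D3 : gam * (lev l.+1)%:R <= (1 + (3 * t - kap * t ^+ 2)) + t ^+ 2.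
  have : gam * (lev l.+1)%:R <= gam * ((2 + alpha) * (t ^+ 2 + 3 * (t - 1)) + 1).
    by rewrite ler_wpM2l.
  have -> : gam * ((2 + alpha) * (t ^+ 2 + 3 * (t - 1)) + 1) =
     (1 - kap) * (t ^+ 2 + 3 * (t - 1)) + gam by rewrite /kap; ring.
  have : 0 <= kap * (3 * (t - 1)) by rewrite mulr_ge0 ?(ltW kap0)//; lra.
  nra.
have P1 : (lev l.+1).+1%:R ^+ N.+1 <= K ^+ N.+1 * (C1 * 2 `^ t).
  rewrite (@le_trans _ _ ((K * t ^+ 2) ^+ N.+1))//.
    by rewrite lerXn2r ?nnegrE ?ler0n ?mulr_ge0 ?(ltW K0) ?sqr_ge0.
  rewrite exprMn -exprM ler_wpM2l ?exprn_ge0 ?(ltW K0)//.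
  by apply: HC1; lra.
have P2 : 2 `^ (gam * (lev l.+1)%:R) <=
    2 `^ (1 + (3 * t - kap * t ^+ 2)) * 2 ^+ lgM l.
  by rewrite -pow2_nat -pow2D ler_pow2// mt.
rewrite (le_trans (ler_pM _ _ P1 P2)) ?exprn_ge0 ?powR_ge0//.
rewrite !mulrA ler_wpM2r ?exprn_ge0// -!mulrA ler_wpM2l ?exprn_ge0 ?(ltW K0)//.
rewrite ler_wpM2l ?(ltW C10)// -pow2D ler_pow2//.
(* Completing the square: [4 * t + 1 - kap * t ^ 2] is largest at [t = 2 / kap]. *)
have -> : 4 / kap + 1 = t + (1 + (3 * t - kap * t ^+ 2)) + (2 - kap * t) ^+ 2 / kap.
  by field; lra.
by rewrite lerDl divr_ge0 ?sqr_ge0// ltW.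
Qed.

End Growth.

(** * Fourier decay of the Cantor points *)

Section CantorEstimates.
Variables (R : realType) (alpha : R).
Hypothesis alpha_gt0 : 0 < alpha.
Local Notation cabs := (@Normc.normc R).
Local Notation lev := (lev alpha).
Local Notation lgM := (lgM alpha).
Local Notation pt_hat := (pt_hat alpha).
Local Notation digit_hat := (digit_hat alpha).

Lemma powR_anti (a b gam : R) : 0 < a -> a <= b -> 0 <= gam ->
  b `^ (- gam) <= a `^ (- gam).
Proof.
move=> a0 ab g0; rewrite !powRN lef_pV2 ?posrE ?powR_gt0 ?(lt_le_trans a0)//.
by rewrite ge0_ler_powR// nnegrE ?(ltW a0)// (le_trans (ltW a0)).
Qed.

Lemma digit_hat_le l L (eta : R) : (0 < L)%N -> 1 <= `|eta| ->
  (Num.truncn `|eta| + 1 + 2 ^ lgM l <= 2 ^ L)%N ->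
  cabs (digit_hat l eta) <=
  4 / `|eta| + 60 * (lgM l)%:R ^+ 2 * (lgM l).+1%:R * L%:R / 2 ^+ lgM l.
Proof.
move=> L0 eta1 etaL; rewrite cabsM cabs_real ger0_norm ?invr_ge0//.
rewrite ler_pdivrMl ?ltr0n ?size_digits_gt0// -(natrX _ 2 (lgM l)).
exact: fracs_ex_sum (lgM_gt0 _ _) L0 eta1 etaL.
Qed.

Lemma lgM_lt_lev l : (lgM l < lev l.+1)%N.
Proof. by have := lev_geM alpha_gt0 l; lia. Qed.

Lemma lev_bracket (eta : R) : 1 <= eta ->
  exists k, 2 ^+ lev k <= eta < 2 ^+ lev k.+1.
Proof.
move=> eta1.
have ex : exists n, eta < 2 ^+ lev n.
  exists (Num.truncn eta).+1.
  have /truncn_itv/andP[_ h] : 0 <= eta by rewrite (le_trans _ eta1).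
  rewrite (lt_le_trans h)// -natrX ler_nat (leq_trans (lev_ge alpha_gt0 _))//.
  by rewrite ltnW// ltn_expl.
case: (ex_minnP ex) => -[|k]; first by rewrite expr0 ltNge eta1.
move=> h hmin; exists k; rewrite h andbT leNgt; apply/negP => /hmin.
by rewrite ltnn.
Qed.

(** Two digits matter when [2 ^ lev k <= |eta| < 2 ^ lev k.+1]. Digit [k] sees the frequency
    [2 ^- lev k * eta] and decays in that; the missing factor [2 ^ (- gam * lev k)] is supplied by
    digit [k.-1]. All other digits are bounded by 1. *)
Lemma pt_hat_decay (gam : R) : 0 <= gam -> gam < 1 / (2 + alpha) ->
  exists2 C : R, 0 < C & forall eta, exists l,
    cabs (pt_hat l eta) <= C * (1 + `|eta|) `^ (- gam).
Proof.
move=> gam0 gam1; have al0 := alpha_gt0.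
have gam_le1 : gam <= 1.
  have : 1 / (2 + alpha) <= 1 by rewrite ler_pdivrMr; lra.
  lra.
(* The fifth power pays for three factors of order [lgM] and for a length [L] which in [bound2] is
   quadratic in [lev k.+1]. *)
have [C0 C00 HC0] := lev_pow2_le alpha_gt0 4 gam0 gam1.
have {}HC0 l : (lev l.+1).+1%:R ^+ 5 / 2 ^+ lgM l <= C0 * 2 `^ (- (gam * (lev l.+1)%:R)).
  by rewrite ler_pdivrMr ?exprn_gt0// mulrAC powRN ler_pdivlMr ?powR_gt0.
pose K := 4 * (2 + alpha) + 3.
have K0 : 0 < K by rewrite /K; lra.
have bound1 k (eta : R) : 2 ^+ lev k <= `|eta| -> `|eta| < 2 ^+ lev k.+1 ->
    cabs (digit_hat k (2 ^- lev k * eta)) <=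
    (4 + 120 * C0) * (2 ^- lev k * `|eta|) `^ (- gam).
  move=> e1 e2; set tau := 2 ^- lev k * `|eta|.
  have tauE : `|2 ^- lev k * eta| = tau by rewrite normrM gtr0_norm ?exp2V_gt0.
  have tau1 : 1 <= tau by rewrite ler_pdivlMl ?exprn_gt0// mulr1.
  have tau2 : tau <= 2 ^+ lev k.+1.
    by rewrite (le_trans _ (ltW e2))// ler_piMl// exp2V_le1.
  apply: le_trans (@digit_hat_le k (lev k.+1).+2 _ _ _ _) _ => //; rewrite ?tauE//.
    rewrite expnS expnS.
    have : (Num.truncn tau <= 2 ^ lev k.+1)%N.
      rewrite -(ler_nat R) natrX (le_trans _ tau2)//.
      by have /truncn_itv/andP[] : 0 <= tau by rewrite (le_trans _ tau1).
    have : (2 ^ lgM k <= 2 ^ lev k.+1)%N by rewrite leq_exp2l// ltnW// lgM_lt_lev.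
    have : (0 < 2 ^ lev k.+1)%N by rewrite expn_gt0.
    by move: (2 ^ lev k.+1)%N (2 ^ lgM k)%N (Num.truncn tau) => x y z; clear; lia.
  rewrite [leRHS]mulrDl lerD//.
    rewrite ler_wpM2l// -powR_inv1 ?(le_trans _ tau1)//.
    by rewrite ler_powR// lerN2.
  rewrite (@le_trans _ _ (120 * ((lev k.+1).+1%:R ^+ 5 / 2 ^+ lgM k)))//.
    rewrite mulrA ler_wpM2r ?invr_ge0 ?exprn_ge0//.
    rewrite -[120]/(120%:R) -[60]/(60%:R) -!natrX -!natrM ler_nat.
    have := lgM_lt_lev k; set m := lgM k; set D := lev k.+1 => mD.
    rewrite (_ : 120 * D.+1 ^ 5 = 60 * (D.+1 ^ 2) * D.+1 * (D.+1 * (2 * D.+1)))%N; last first.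
      rewrite !expnS expn0; ring.
    by rewrite !leq_mul ?leq_sqr//; move: mD; clear; lia.
  rewrite -[leRHS]mulrA ler_wpM2l// (le_trans (HC0 k))// ler_wpM2l ?(ltW C00)//.
  by rewrite -mulNr mulrC powRrM pow2_nat powR_anti// (lt_le_trans _ tau1).
(* The frequency seen by this digit exceeds [2 ^ lgM k], so the digit has reached its floor,
   [2 ^- lgM k] up to polynomials. *)
have bound2 k (eta : R) : 2 ^+ lev k.+1 <= `|eta| -> `|eta| < 2 ^+ lev k.+2 ->
    cabs (digit_hat k (2 ^- lev k * eta)) <=
    ((4 + 60 * K) * C0) * 2 `^ (- (gam * (lev k.+1)%:R)).
  move=> e1 e2; set tau := 2 ^- lev k * `|eta|.
  have tauE : `|2 ^- lev k * eta| = tau by rewrite normrM gtr0_norm ?exp2V_gt0.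
  have tau1 : 2 ^+ lgM k <= tau.
    rewrite ler_pdivlMl ?exprn_gt0// -exprD (le_trans _ e1)// ler_weXn2l ?ler1n//.
    by have := lev_geM alpha_gt0 k; lia.
  have tau0 : 1 <= tau by rewrite (le_trans _ tau1)// exprn_ege1// ler1n.
  have tau2 : tau <= 2 ^+ lev k.+2.
    by rewrite (le_trans _ (ltW e2))// ler_piMl// exp2V_le1.
  apply: le_trans (@digit_hat_le k (lev k.+2).+2 _ _ _ _) _ => //; rewrite ?tauE//.
    rewrite expnS expnS.
    have : (Num.truncn tau <= 2 ^ lev k.+2)%N.
      rewrite -(ler_nat R) natrX (le_trans _ tau2)//.
      by have /truncn_itv/andP[] : 0 <= tau by rewrite (le_trans _ tau0).
    have : (2 ^ lgM k <= 2 ^ lev k.+2)%N.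
      by rewrite leq_exp2l// ltnW// (ltn_trans (lgM_lt_lev _))// lev_lt.
    have : (0 < 2 ^ lev k.+2)%N by rewrite expn_gt0.
    by move: (2 ^ lev k.+2)%N (2 ^ lgM k)%N (Num.truncn tau) => x y z; clear; lia.
  set v : R := (lev k.+1).+1%:R.
  have v1 : 1 <= v by rewrite ler1n.
  have mv : (lgM k).+1%:R <= v by rewrite ler_nat ltnS ltnW// lgM_lt_lev.
  have mv' : (lgM k)%:R <= v by rewrite (le_trans _ mv)// ler_nat.
  have Lv : (lev k.+2).+2%:R <= K * v ^+ 2.
    have /andP[_ D1] := lev_itv alpha_gt0 k.+1.
    have Dv : (lev k.+1)%:R = v - 1 by rewrite /v -natr1 addrK.
    rewrite natrD natrM natrX -/v Dv in D1.
    rewrite -[in leLHS]addn2 natrD (le_trans (lerD D1 (lexx 2)))// /K.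
    have : (2 + alpha) * (v ^+ 2 + 3 * (v - 1)) <= (2 + alpha) * (4 * v ^+ 2).
      by rewrite ler_wpM2l ?addr_ge0 ?(ltW al0)//; nra.
    nra.
  rewrite (@le_trans _ _ ((4 + 60 * K) * (v ^+ 5 / 2 ^+ lgM k)))//; last first.
    by rewrite -[leRHS]mulrA ler_wpM2l ?HC0// addr_ge0// mulr_ge0// ltW.
  rewrite [leRHS]mulrDl lerD//.
    rewrite ler_wpM2l// (@le_trans _ _ (2 ^+ lgM k)^-1)//.
      by rewrite lef_pV2 ?posrE ?exprn_gt0// (lt_le_trans _ tau0).
    by rewrite ler_pdivlMr ?exprn_gt0// mulVf ?lt0r_neq0 ?exprn_gt0// exprn_ege1.
  rewrite [leRHS]mulrA ler_wpM2r ?invr_ge0 ?exprn_ge0//.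
  rewrite (_ : 60 * K * v ^+ 5 = 60 * v ^+ 2 * v * (K * v ^+ 2)); last by ring.
  rewrite ler_pM ?mulr_ge0 ?exprn_ge0// ler_pM ?mulr_ge0 ?exprn_ge0//.
  by rewrite ler_wpM2l// lerXn2r ?nnegrE// (le_trans _ v1).
pose C1 := 4 + 120 * C0; pose C2 := (4 + 60 * K) * C0.
have C10 : 0 < C1 by rewrite addr_gt0// mulr_gt0.
have C20 : 0 < C2 by rewrite mulr_gt0// addr_gt0// mulr_gt0.
exists (2 * (1 + C1 + C1 * C2)); first by rewrite mulr_gt0// !addr_gt0// mulr_gt0.
have half (x : R) : 0 <= x -> x <= 1 -> 1 <= 2 * (1 + x) `^ (- gam).
  move=> x0 x1; rewrite powRN ler_pdivlMr ?powR_gt0 ?ltr_pwDl// mul1r.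
  rewrite (le_trans (ler1_powR _ gam_le1)) ?lerDl//; lra.
have dbl (x : R) : 1 <= x -> x `^ (- gam) <= 2 * (1 + x) `^ (- gam).
  move=> x1; have x0 : 0 < x by lra.
  rewrite (@le_trans _ _ (2 * (2 * x) `^ (- gam)))//; last first.
    by rewrite ler_wpM2l// powR_anti//; lra.
  rewrite powRM ?(ltW x0)// mulrA ler_peMl ?powR_ge0// powRN ler_pdivlMr ?powR_gt0//.
  by rewrite mul1r ler1_powR// ler1n.
move=> eta; have [e1|e1] := leP `|eta| 1.
  exists 0; rewrite (le_trans (cabs_pt_hat_le1 _ _ _))// (le_trans (half _ _ e1))//.
  rewrite ler_wpM2r ?powR_ge0// ler_pMr//.
  by rewrite -addrA lerDl addr_ge0// ltW// mulr_gt0.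
suff [l Hl] : exists l, cabs (pt_hat l eta) <= (1 + C1 + C1 * C2) * `|eta| `^ (- gam).
  exists l; rewrite (le_trans Hl)// [2 * _]mulrC -mulrA ler_wpM2l ?dbl ?(ltW e1)//.
  by have := mulr_gt0 C10 C20; lra.
have [k /andP[k1 k2]] := lev_bracket (ltW e1).
exists k.+1; rewrite pt_hatS cabsM.
have B1 := bound1 k eta k1 k2.
(* For [k = 0] no factor is missing, as [lev 0 = 0]. *)
case: k k1 k2 B1 => [|k] k1 k2 B1.
  rewrite (le_trans (ler_piMl (cabs_ge0 _) (cabs_pt_hat_le1 _ _ _)))// (le_trans B1)//.
  rewrite expr0 invr1 mul1r ler_wpM2r ?powR_ge0//.
  by have := mulr_gt0 C10 C20; rewrite -/C1; lra.
have B2 := bound2 k eta k1 k2.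
rewrite pt_hatS cabsM.
have B3 : cabs (pt_hat k eta) * cabs (digit_hat k (2 ^- lev k * eta)) <=
    C2 * 2 `^ (- (gam * (lev k.+1)%:R)).
  by rewrite (le_trans (ler_piMl (cabs_ge0 _) (cabs_pt_hat_le1 _ _ _))).
rewrite (le_trans (ler_pM _ (cabs_ge0 _) B3 B1)) ?mulr_ge0 ?cabs_ge0//.
rewrite powRM ?(ltW (exp2V_gt0 _ _))//.
have -> : (2 ^- lev k.+1) `^ (- gam) = (2 `^ (- (gam * (lev k.+1)%:R)))^-1 :> R.
  by rewrite -pow2N_nat -powRrM mulrNN powRN invrK mulrC.
have p0 : 2 `^ (- (gam * (lev k.+1)%:R)) != 0 :> R by rewrite lt0r_neq0// powR_gt0.
rewrite (_ : C2 * _ * _ = C1 * C2 * `|eta| `^ (- gam)); last by rewrite -/C1; field.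
by rewrite ler_wpM2r ?powR_ge0//; lra.
Qed.

End CantorEstimates.

(** * Frostman bound for the Cantor points *)

Section CantorFrostman.
Variables (R : realType) (alpha : R).
Hypothesis alpha_gt0 : 0 < alpha.
Local Notation lev := (lev alpha).
Local Notation lgM := (lgM alpha).
Local Notation digits := (digits alpha).
Local Notation cells := (cells alpha).
Local Notation pt := (pt alpha).

(** The last digit alone has enough values, by [lev_pow2_le] for [th / 2], squared. The spare fourth
    power is [lgM l ^ 2], the loss in the number of digits at the next level. *)
Lemma cells_ge (th : R) : 0 <= th -> th < 2 / (2 + alpha) ->
  exists2 C : R, 1 <= C & forall l,
    (lev l).+1%:R ^+ 4 * 2 `^ (th * (lev l)%:R) <= C * (cells l)%:R.
Proof.
move=> th0 th1; have al0 := alpha_gt0.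
have h0 : 0 <= th / 2 by rewrite divr_ge0.
have h1 : th / 2 < 1 / (2 + alpha) by rewrite ltr_pdivrMr// mulrAC mul1r.
have [C0 C00 HC0] := lev_pow2_le al0 2 h0 h1.
exists (1 + 20 * C0 ^+ 2); first by rewrite lerDl mulr_ge0// exprn_ge0// ltW.
case=> [|l]; first by rewrite /= expr1n mul1r mulr0 powRr0 mulr1 lerDl mulr_ge0// exprn_ge0// ltW.
set D := lev l.+1; set d : R := D.+1%:R.
have d1 : 1 <= d by rewrite ler1n.
have T0 : 0 < (size (digits l))%:R :> R by rewrite ltr0n size_digits_gt0.
have A1 : 1 <= (cells l)%:R :> R by rewrite ler1n cells_gt0.
have md : (lgM l)%:R <= d.
  have := lgM_lt_lev al0 l; by rewrite /d ler_nat -/D; lia.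

have m1 : 1 <= (lgM l)%:R :> R by rewrite ler1n lgM_gt0.
(* Two of the six powers are spent on the factor [lgM l ^ 2] between [4 ^ lgM l] and the number of
   digits. *)
have H1 : d ^+ 6 * 2 `^ (th * D%:R) <= C0 ^+ 2 * 4 ^+ lgM l.
  have := HC0 l; rewrite -/D -/d => H.
  have := ler_pM _ _ H H; rewrite ?mulr_ge0 ?exprn_ge0 ?powR_ge0// => /(_ isT isT).
  rewrite mulrACA -exprD -pow2D -mulrDl -splitr [X in _ <= X -> _]mulrACA.
  by rewrite -exprMn -natrM => /le_trans; apply; rewrite expr2.
have H2 : 4 ^+ lgM l <= 20 * (lgM l)%:R ^+ 2 * (size (digits l))%:R :> R.
  rewrite -[20]/(20%:R) -[4]/(4%:R) -!natrX -!natrM ler_nat.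
  by rewrite size_fracs_ge// lgM_gt0.
have H3 : d ^+ 6 * 2 `^ (th * D%:R) <= C0 ^+ 2 * (20 * d ^+ 2 * (size (digits l))%:R).
  rewrite (le_trans H1)// ler_wpM2l ?exprn_ge0 ?(ltW C00)// (le_trans H2)//.
  by rewrite ler_wpM2r ?(ltW T0)// ler_wpM2l// lerXn2r ?nnegrE.
have H4 : d ^+ 4 * 2 `^ (th * D%:R) <= 20 * C0 ^+ 2 * (size (digits l))%:R.
  have d2 : 0 < d ^+ 2 by rewrite exprn_gt0// (lt_le_trans _ d1).
  rewrite -(ler_pM2l d2) mulrA -exprD (le_trans H3)// le_eqVlt; apply/orP; left.
  by apply/eqP; ring.
rewrite (le_trans H4)//= natrM ler_pM ?mulr_ge0 ?exprn_ge0 ?(ltW C00) ?(ltW T0)//.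
  by rewrite lerDr.
by rewrite ler_peMl ?(ltW T0).
Qed.


(** For [len] between [2 ^- lev k.+1] and [2 ^- lev k], count at level [k.+1]. Below the spacing at
    most three points qualify; above it at most a multiple of [len] over the spacing, and
    [len / 2 ^- lev k <= 1] only grows when raised to [th <= 1]. The margin on the left is there
    because a limit point may exceed [pt l i] by [2 ^- lev l]. *)
Lemma pt_ball (th : R) : 0 <= th -> th < 2 / (2 + alpha) ->
  exists2 C : R, 1 <= C & forall len : R, 0 < len -> exists l, forall c : R,
    (\sum_(i < cells l) (c - 2 ^- lev l <= pt l i <= c + len)%R)%:R <=
      C * len `^ th * (cells l)%:R.
Proof.
move=> th0 th1; have al0 := alpha_gt0.
have th_le1 : th <= 1.
  have : 2 / (2 + alpha) <= 1 by rewrite ler_pdivrMr; lra.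
  lra.
have [C C1 HC] := cells_ge th0 th1.
exists (60 * C); first by lra.
move=> len len0; have [len1|len1] := leP 1 len.
  exists 0 => c; rewrite /= big_ord1 mulr1.
  rewrite (@le_trans _ _ 1)//; first by case: (_ && _).
  have : 1 <= len `^ th by rewrite -(powRr0 len) ler_powR.
  nra.
have [l /andP[l1 l2]] : exists k, 2 ^+ lev k <= len^-1 < 2 ^+ lev k.+1.
  by apply: lev_bracket => //; rewrite invf_ge1// ltW.
have {}l1 : len <= 2 ^- lev l by rewrite -[len]invrK lef_pV2 ?posrE ?exprn_gt0 ?invr_gt0.
have {}l2 : 2 ^- lev l.+1 <= len.
  by rewrite -[leRHS]invrK lef_pV2 ?posrE ?exprn_gt0 ?invr_gt0// ltW.
exists l.+1 => c.
set d : R := 2 ^- lev l in l1 *; set D := lev l.+1 in l2 *; set T := size (digits l).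
have d0 : 0 < d by exact: exp2V_gt0.
have T0 : 0 < T%:R :> R by rewrite ltr0n size_digits_gt0.
have sepd : 0 < d * 4 ^- lgM l by rewrite mulr_gt0// invr_gt0 exprn_gt0.
have := @count_separated R (cells l.+1) (pt l.+1) (d * 4 ^- lgM l) (c - 2 ^- D) (len + 2 ^- D)
  sepd _ (pt_sep_next (pt_sep al0 (l := l))).
rewrite (_ : c - 2 ^- D + (len + 2 ^- D) = c + len); last by ring.
rewrite addr_ge0 ?(ltW len0) ?(ltW (exp2V_gt0 _ _))// => /(_ isT) cnt.
rewrite (le_trans cnt)//.
have cnt2 : (len + 2 ^- D) / (d * 4 ^- lgM l) <= 2 * (len / (d * 4 ^- lgM l)).
  by rewrite mulrA ler_wpM2r ?invr_ge0 ?(ltW sepd)//; lra.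
have [small|big] := leP len (d * 4 ^- lgM l).
  have s1 : len / (d * 4 ^- lgM l) <= 1 by rewrite ler_pdivrMr// mul1r.
  rewrite (@le_trans _ _ 3)//; first by lra.
  have HD := HC l.+1; rewrite -/D in HD.
  have l3 : 2 `^ (- (th * D%:R)) <= len `^ th.
    rewrite -mulrN mulrC powRrM pow2N_nat.
    by rewrite ge0_ler_powR ?nnegrE ?(ltW len0) ?(ltW (exp2V_gt0 _ _)).
  have HD2 : 1 <= C * (cells l.+1)%:R * 2 `^ (- (th * D%:R)).
    rewrite powRN ler_pdivlMr ?powR_gt0// (le_trans _ HD)// ler_wpM2r ?powR_ge0//.
    by rewrite exprn_ege1// ler1n.
  have HD3 : 1 <= C * (cells l.+1)%:R * len `^ th.
    by rewrite (le_trans HD2)// ler_wpM2l// mulr_ge0//; lra.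
  by rewrite (_ : 60 * C * _ * _ = 60 * (C * (cells l.+1)%:R * len `^ th)); [lra|ring].
have s1 : 1 <= len / (d * 4 ^- lgM l) by rewrite ler_pdivlMr// mul1r ltW.
rewrite (@le_trans _ _ (3 * (len / (d * 4 ^- lgM l))))//; first by lra.
have -> : len / (d * 4 ^- lgM l) = (len / d) * 4 ^+ lgM l.
  by rewrite invf_div mulrA mulrAC.
set tau := len / d.
have tau0 : 0 < tau by rewrite divr_gt0.
have tau1 : tau <= 1 by rewrite ler_pdivrMr// mul1r.
have H2 : 4 ^+ lgM l <= 20 * (lgM l)%:R ^+ 2 * T%:R :> R.
  rewrite -[20]/(20%:R) -[4]/(4%:R) -!natrX -!natrM ler_nat.
  by rewrite size_fracs_ge// lgM_gt0.
have tauth : tau <= tau `^ th.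
  by rewrite -[leLHS]powRr1 ?(ltW tau0)// ger_powR// tau0 tau1.
have lenE : len `^ th = tau `^ th * 2 `^ (- (th * (lev l)%:R)).
  rewrite -mulrN [th * _]mulrC powRrM pow2N_nat -powRM ?(ltW tau0) ?(ltW d0)//.
  by rewrite /tau divfK// lt0r_neq0.
have m4 : (lgM l)%:R ^+ 2 = (lev l).+1%:R ^+ 4 :> R by rewrite natrX -exprM.
have HD : (lgM l)%:R ^+ 2 <= C * (cells l)%:R * 2 `^ (- (th * (lev l)%:R)).
  by rewrite m4 powRN ler_pdivlMr ?powR_gt0// HC.
rewrite (@le_trans _ _ (3 * (tau * (20 * (lgM l)%:R ^+ 2 * T%:R))))//.
  by rewrite ler_wpM2l// ler_wpM2l ?(ltW tau0).
rewrite lenE [cells _]/= natrM -/T.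
rewrite (@le_trans _ _ (60 * (T%:R * (tau `^ th * (C * (cells l)%:R * 2 `^ (- (th * (lev l)%:R)))))))//; last first.
  by rewrite le_eqVlt; apply/orP; left; apply/eqP; ring.
rewrite (_ : 3 * _ = 60 * (T%:R * (tau * (lgM l)%:R ^+ 2))); last by ring.
by rewrite ler_wpM2l// ler_wpM2l ?(ltW T0)// ler_pM ?(ltW tau0)// exprn_ge0.
Qed.

End CantorFrostman.

(** * Integrals and measures over cells of equal length *)

Section RestrictedIntegrals.
Variable R : realType.
Local Notation leb := (@lebesgue_measure R).
Local Notation span h a b := (`[(a%:R * h)%R, (b%:R * h)%R[%classic : set R) (only parsing).
Implicit Types (f g : R -> R) (D E : set R).

Lemma bounded_integrable f D M : measurable D -> (leb D < +oo)%E ->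
  measurable_fun D f -> (forall x, D x -> `|f x| <= M) ->
  leb.-integrable D (EFin \o f).
Proof.
move=> mD Dfin mf fM; apply: measurable_bounded_integrable => //.
exists M; split; first exact: num_real.
by move=> y My x Dx; apply: le_trans (fM _ Dx) (ltW My).
Qed.

Lemma Rintegral_le_cst f D M c : measurable D -> (leb D < +oo)%E ->
  measurable_fun D f -> (forall x, D x -> `|f x| <= M) ->
  (forall x, D x -> f x <= c) ->
  Rintegral leb D f <= c * fine (leb D).
Proof.
move=> mD Dfin mf fM fc; rewrite -(Rintegral_cst leb mD).
apply: le_Rintegral => //; first exact: bounded_integrable fM.
by apply: (@bounded_integrable _ _ `|c|).
Qed.

Lemma lebesgue_itvco (a b : R) : a <= b -> leb `[a, b[%classic = (b - a)%:E.
Proof.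
rewrite le_eqVlt => /orP[/eqP ->|ab]; last by rewrite lebesgue_measure_itv/= lte_fin ab.
by rewrite set_itvE measure0 subrr.
Qed.

Lemma Rintegral_le_step f (h M : R) (G : nat -> R) (a b : nat) : (a <= b)%N -> 0 < h ->
  measurable_fun setT f -> (forall x, `|f x| <= M) ->
  (forall i u, (a <= i < b)%N -> i%:R * h <= u < i.+1%:R * h -> f u <= G i) ->
  Rintegral leb (span h a b) f <= h * \sum_(a <= i < b) G i.
Proof.
move=> + h0 mf fM; elim: b => [|b IHb] ab fG.
  by move: ab; rewrite leqn0 => /eqP ->; rewrite set_itvE Rintegral_set0 big_geq// mulr0.
move: ab; rewrite leq_eqVlt => /orP[/eqP ->|]; first by rewrite set_itvE Rintegral_set0 big_geq// mulr0.
rewrite ltnS => ab; rewrite big_nat_recr//= mulrDr.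
have abR : a%:R * h <= b%:R * h by rewrite ler_wpM2r ?(ltW h0)// ler_nat.
have bbR : b%:R * h <= b.+1%:R * h by rewrite ler_wpM2r ?(ltW h0)// ler_nat.
have U : (span h a b.+1) =
    (span h a b) `|` (span h b b.+1).
  by apply: itv_bndbnd_setU; rewrite bnd_simp.
rewrite U Rintegral_setU//=; last 2 first.
- rewrite -U; apply: bounded_integrable => //.
  + by rewrite /= lebesgue_itvco ?ltry// (le_trans abR).
  + exact: measurable_funTS.
- apply/disj_setPS => x [] /=; rewrite !in_itv/= => /andP[_ x1] /andP[x2 _].
  by move: (le_lt_trans x2 x1); rewrite ltxx.
rewrite lerD//.
  by apply: IHb => // i u /andP[ai ib]; apply: fG; rewrite ai ltnS ltnW.
rewrite (le_trans (Rintegral_le_cst (M := M) (c := G b) _ _ _ _ _))//.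
- by rewrite /= lebesgue_itvco ?ltry.
- exact: measurable_funTS.
- move=> u /=; rewrite in_itv/=; apply: fG; rewrite ab ltnSn//.
by rewrite /= lebesgue_itvco//= -mulrBl -natrB// subSnn mul1r mulrC.
Qed.

Lemma measure_le_step (E : set R) (h : R) (Q : pred nat) (a b : nat) :
  (a <= b)%N -> 0 < h -> measurable E ->
  (forall i u, (a <= i < b)%N -> i%:R * h <= u < i.+1%:R * h -> E u -> Q i) ->
  (leb (E `&` (span h a b)) <= (h * (\sum_(a <= i < b) Q i)%:R)%:E)%E.
Proof.
move=> ab h0 mE EQ.
have abR : a%:R * h <= b%:R * h by rewrite ler_wpM2r ?(ltW h0)// ler_nat.
have Rfin : leb (E `&` (span h a b)) \is a fin_num.
  rewrite ge0_fin_numE//; apply: (@le_lt_trans _ _ (leb (span h a b))).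
    by apply: le_measure; rewrite ?inE//; exact: measurableI.
  by rewrite lebesgue_itvco// ltry.
rewrite -(fineK Rfin) lee_fin natr_sum.
have -> : fine (leb (E `&` (span h a b))) =
    Rintegral leb (span h a b) \1_E.
  by rewrite /Rintegral integral_indic.
apply: (@Rintegral_le_step _ _ 1) => //.
  by move=> x; rewrite indicE ger0_norm//; case: (_ \in _).
move=> i u iab ui; rewrite indicE; case: (boolP (u \in E)) => //.
by rewrite inE => /(EQ _ _ iab ui) ->.
Qed.

Lemma measure_ge_step (E : set R) (h : R) (Q : pred nat) (b : nat) :
  0 < h -> measurable E ->
  (forall i u, (i < b)%N -> i%:R * h <= u < i.+1%:R * h -> Q i -> E u) ->
  ((h * (\sum_(i < b) Q i)%:R)%:E <= leb E)%E.
Proof.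
move=> h0 mE EQ; rewrite -(big_mkord xpredT (fun i => Q i : nat)).
elim: b E mE EQ => [|b IHb] E mE EQ; first by rewrite big_geq// mulr0 measure_ge0.
have cell : measurable (span h b b.+1) by [].
have bbR : b%:R * h <= b.+1%:R * h by rewrite ler_wpM2r ?(ltW h0)// ler_nat.
rewrite big_nat_recr//= natrD mulrDr EFinD.
rewrite -(setUIDK E (span h b b.+1)) measureU//; last 3 first.
- exact: measurableI.
- exact: measurableD.
- by rewrite setDE setIACA setICr setI0.
rewrite addeC leeD//.
  case: (boolP (Q b)) => Qb; last by rewrite mulr0 measure_ge0.
  rewrite mulr1 (_ : E `&` _ = (span h b b.+1)).
    by rewrite /= lebesgue_itvco// -mulrBl -natrB// subSnn mul1r.
  apply/seteqP; split => [x []//|x xI]; split => //.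
  by apply: (EQ b) => //; move: xI; rewrite /= in_itv.
apply: IHb; first exact: measurableD.
move=> i u ib ui Qi; split; first by apply: (EQ i) => //; rewrite ltnS ltnW.
rewrite /= in_itv/= => /andP[bu _]; move: ui => /andP[_].
rewrite ltNge (le_trans _ bu)// ler_wpM2r ?(ltW h0)// ler_nat//.
Qed.

(** [nu] is known through its values on sets, so it is first replaced by the image under [Y] of
    Lebesgue measure restricted to [D]; the complement of [D] is null for that restriction. *)
Lemma Rintegral_law (nu : {measure set (measurableTypeR R) -> \bar R})
    (D : set R) (Y : R -> R) (g : R -> R) M :
  measurable D -> (leb D < +oo)%E -> measurable_fun setT Y ->
  (forall A, measurable A -> nu A = leb (Y @^-1` A `&` D)) ->
  measurable_fun setT g -> (forall x, `|g x| <= M) ->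
  Rintegral nu setT g = Rintegral leb D (g \o Y).
Proof.
move=> mD Dfin mY nuE mg gM; rewrite /Rintegral; congr fine.
pose P : {measure set (measurableTypeR R) -> \bar R} := mrestr leb mD.
have mY' : measurable_fun (setT : set (measurableTypeR R)) (Y : measurableTypeR R -> measurableTypeR R) := mY.
pose PY : {measure set (measurableTypeR R) -> \bar R} :=
  measure_function_pushforward__canonical__measure_function_Measure P mY'.
rewrite (eq_measure_integral PY) => [|A mA _]; last exact: nuE.
have intP : P.-integrable setT (EFin \o (g \o Y)).
  apply: measurable_bounded_integrable => //.
  - by rewrite /P /= /mrestr setTI.
  - exact: measurableT_comp.
  exists M; split; first exact: num_real.
  by move=> y My x _; apply: le_trans (gM _) (ltW My).
have mE : measurable_fun setT (EFin \o g) by exact/measurable_EFinP.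
rewrite (integral_pushforward mY' mE)// preimage_setT.
have mDC : measurable (~` D) by exact: measurableC.
have PDC : P (~` D) = 0%E by rewrite /P /= /mrestr setICl measure0.
have := @negligible_integral _ (measurableTypeR R) R P setT (~` D) _ mDC measurableT intP PDC.
rewrite setDE setCK setTI => NI; apply: (etrans NI).
by apply: eq_measure_integral => A mA AD; rewrite /P /= /mrestr (setIidl AD).
Qed.

Lemma measurable_truncn (h : R) (G : nat -> R) : 0 < h ->
  measurable_fun setT (fun u : R => G (Num.truncn (u / h))).
Proof.
move=> h0.
pose E (a : nat) : set R := [set u | Num.truncn (u / h) = a].
have mE a : measurable (E a).
  (* Negative reals truncate to 0, so the cell of index 0 is a half-line. *)
  have -> : E a = if a is 0 then `]-oo, h[%classic else (span h a a.+1).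
    apply/seteqP; case: a => [|a]; split => u; rewrite /E /= in_itv/=.
    - by move=> ua; rewrite -[h]mul1r -ltr_pdivrMr// -(truncn_le_nat _ 0) ua.
    - rewrite -[h in u < h]mul1r -ltr_pdivrMr// -(truncn_le_nat _ 0) leqn0.
      by move/eqP.
    - move=> ua; rewrite -ler_pdivlMr// -ltr_pdivrMr// -truncn_le_nat.
      by rewrite -truncn_gt_nat ua leqnn.
    - rewrite -ler_pdivlMr// -ltr_pdivrMr// -truncn_le_nat -truncn_gt_nat.
      by move=> ?; apply/eqP; rewrite eqn_leq andbC.
  by case: a => [|a].
have UE : \bigcup_a E a = setT.
  by apply/seteqP; split => // u _; exists (Num.truncn (u / h)).
rewrite -UE; apply/measurable_fun_bigcup => // a.
apply: (eq_measurable_fun (cst (G a))) => [u|]; last exact: measurable_cst.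
by rewrite inE /E /= => ->.
Qed.

End RestrictedIntegrals.

(** * The map from the unit interval to the line *)

Section Transport.
Variables (R : realType) (alpha : R).
Hypothesis alpha_gt0 : 0 < alpha.
Variables (n sg : nat -> nat).
Hypotheses (sg_gt : forall k, (k < sg k)%N) (n_ge : forall k, (sg k <= n k)%N).
Local Notation lev := (lev alpha).
Local Notation lgM := (lgM alpha).
Local Notation digits := (digits alpha).
Local Notation cells := (cells alpha).
Local Notation pt := (pt alpha).

(* On [dyad k] the map is [u |-> -1/2 + 2 ^- sg k * j + 2 ^- n k * X], where
   [j] is the index of the step of length [2 ^- sg k] containing [u], and [X]
   runs through the limit of the points [pt l] as [u] runs through that step.
   The approximation [apx k l] is constant on intervals of length [wd k l]. *)
Definition wd (k l : nat) : R := 2 ^- sg k / (cells l)%:R.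

Definition node (k l a : nat) : R :=
  - (1 / 2) + 2 ^- sg k * (a %/ cells l)%:R + 2 ^- n k * pt l (a %% cells l).

Definition apx (k l : nat) (u : R) : R := node k l (Num.truncn (u / wd k l)).

Definition cmap (k : nat) (u : R) : R := limn (fun l => apx k l u).

Definition dyad (k : nat) : set R := `[2 ^- k.+1, 2 ^- k[%classic.

(** The default 0 makes [ymap] equal to [cmap 0] outside the unit interval, hence measurable on the
    whole line. *)
Definition dyad_idx (u : R) : nat := xget 0%N [set k | dyad k u].

Definition ymap (u : R) : R := cmap (dyad_idx u) u.

(** Makes the cells of level [l.+1] refine those of level [l]: a cell index divided by the number of
    digits is the index of the parent. For negative [x] both sides are 0. *)
Lemma truncn_mul_div (x : R) T : (0 < T)%N ->
  (Num.truncn (x * T%:R) %/ T)%N = Num.truncn x.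
Proof.
move=> T0; have TR : 0 < T%:R :> R by rewrite ltr0n.
have [x0|x0] := leP 0 x; last first.
  have neg (y : R) : y < 0 -> Num.truncn y = 0%N.
    by move=> y0; apply/eqP; rewrite -leqn0 truncn_le_nat (lt_trans y0).
  by rewrite !neg ?div0n// nmulr_rlt0.
apply/esym/truncn_def.
have /truncn_itv/andP[t1 t2] : 0 <= x * T%:R by rewrite mulr_ge0.
apply/andP; split.
  by rewrite -(ler_pM2r TR) (le_trans _ t1)// -natrM ler_nat leq_trunc_div.
rewrite -(ltr_pM2r TR) (lt_le_trans t2)// -natrM ler_nat.
by rewrite ltn_ceil.
Qed.

Lemma wd_gt0 k l : 0 < wd k l.
Proof. by rewrite divr_gt0 ?exp2V_gt0// ltr0n cells_gt0. Qed.

Lemma div_wdS k l (u : R) : u / wd k l.+1 = (u / wd k l) * (size (digits l))%:R.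
Proof. by rewrite /wd /= natrM invf_div invf_div; ring. Qed.

Lemma truncn_wd k l (u : R) :
  (Num.truncn (u / wd k l) %/ cells l)%N = Num.truncn (u * 2 ^+ sg k).
Proof.
rewrite /wd invf_div invrK -(truncn_mul_div (u * 2 ^+ sg k) (cells_gt0 alpha l)).
by rewrite mulrA mulrAC.
Qed.

Lemma apx_next k l u : apx k l u <= apx k l.+1 u /\
  apx k l.+1 u <= apx k l u + 2 ^- n k * (2 ^- lev l - 2 ^- lev l.+1).
Proof.
have T0 := size_digits_gt0 alpha l.
rewrite /apx /node !truncn_wd.
set a := Num.truncn (u / wd k l); set b := Num.truncn (u / wd k l.+1).
have ab : (b %/ size (digits l))%N = a by rewrite /b div_wdS truncn_mul_div.
have [] := pt_next alpha_gt0 l (b %% cells l.+1); rewrite -modn_divl ab => p1 p2.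
have n0 := exp2V_gt0 R (n k).
by split; rewrite -?addrA lerD2l lerD2l -?mulrDr ler_wpM2l ?(ltW n0)// addrA.
Qed.

Lemma apx_bounds k l l' u : (l <= l')%N -> apx k l u <= apx k l' u /\
  apx k l' u <= apx k l u + 2 ^- n k * (2 ^- lev l - 2 ^- lev l').
Proof.
move=> ll; rewrite -(subnKC ll); elim: (l' - l)%N => [|m [IH1 IH2]].
  by rewrite addn0 subrr mulr0 addr0.
rewrite addnS; have [H1 H2] := apx_next k (l + m) u.
split; first exact: le_trans H1.
rewrite (le_trans H2)//; move: IH2; rewrite !mulrBr; lra.
Qed.

Lemma apx_cvg k u : cvgn (fun l => apx k l u).
Proof.
apply: nondecreasing_is_cvgn.
  by move=> l l' ll; have [] := apx_bounds k u ll.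
exists (apx k 0 u + 2 ^- n k) => _ [l _ <-].
have [_ h] := apx_bounds k u (leq0n l); rewrite (le_trans h)// lerD2l.
have n0 := exp2V_gt0 R (n k); have l0 := exp2V_gt0 R (lev l).
by rewrite ler_piMr ?(ltW n0)//= expr0 invr1; lra.
Qed.

Lemma cmap_bounds k l u : apx k l u <= cmap k u /\
  cmap k u <= apx k l u + 2 ^- n k * 2 ^- lev l.
Proof.
have n0 := exp2V_gt0 R (n k).
split.
  apply: limr_ge; first exact: apx_cvg.
  by exists l => // l' /= ll; have [] := apx_bounds k u ll.
apply: limr_le; first exact: apx_cvg.
exists l => // l' /= ll; have [_ h] := apx_bounds k u ll.
rewrite (le_trans h)// lerD2l ler_wpM2l ?(ltW n0)//.
by rewrite gerBl ltW// exp2V_gt0.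
Qed.

(** The upper bound is strict because the first digit stays [2 ^- lgM 0] below 1, which exceeds the
    remaining length [2 ^- lev 1]; so a copy fits in a half-open step. *)
Lemma cmap_cell k u : let j := Num.truncn (u * 2 ^+ sg k) in
  - (1 / 2) + 2 ^- sg k * j%:R <= cmap k u /\
  cmap k u < - (1 / 2) + 2 ^- sg k * j%:R + 2 ^- n k.
Proof.
move=> j; have [h1 h2] := cmap_bounds k 1 u.
have n0 := exp2V_gt0 R (n k).
rewrite /apx /node truncn_wd -/j in h1 h2.
set i := (_ %% _)%N in h1 h2.
have /andP[p0 _] := pt_itv alpha_gt0 1 i.
split; first by rewrite (le_trans _ h1)// lerDl mulr_ge0// ltW.
rewrite (le_lt_trans h2)// -!addrA ltrD2l ltrD2l -mulrDr gtr_pMr//.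
have /andP[_] := nth_digits_itv alpha 0 i.
have : 2 ^- lev 1 < 2 ^- lgM 0 :> R.
  by rewrite ltf_pV2 ?posrE ?exprn_gt0// ltr_eXn2l ?ltr1n// lgM_lt_lev.
rewrite [pt 1 i]/= add0r expr0 invr1 mul1r; lra.
Qed.

Lemma dyad_truncn k u : dyad k u ->
  (2 ^ (sg k - k.+1) <= Num.truncn (u * 2 ^+ sg k) < 2 ^ (sg k - k))%N.
Proof.
rewrite /dyad /= in_itv/= => /andP[u1 u2].
have s0 : 0 < 2 ^+ sg k :> R by rewrite exprn_gt0.
have u0 : 0 <= u * 2 ^+ sg k.
  by rewrite mulr_ge0 ?(ltW s0)// (le_trans _ u1)// ltW// exp2V_gt0.
have p (m : nat) : (m <= sg k)%N -> (2 ^ (sg k - m))%N%:R = 2 ^- m * 2 ^+ sg k :> R.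
  move=> mk; rewrite natrX -[in RHS](subnK mk) exprD mulrCA mulVf ?mulr1//.
rewrite truncn_ge_nat// truncn_lt_nat// !p ?(ltnW (sg_gt k))//.
by rewrite ler_pM2r// ltr_pM2r// u1 u2.
Qed.

Lemma dyad_natE k : (2 ^ (sg k - k.+1))%:R * 2 ^- sg k = 2 ^- k.+1 :> R /\
  (2 ^ (sg k - k))%:R * 2 ^- sg k = 2 ^- k :> R.
Proof.
have p (m : nat) : (m <= sg k)%N -> (2 ^ (sg k - m))%N%:R * 2 ^- sg k = 2 ^- m :> R.
  move=> mk; rewrite natrX -[in X in _ * X](subnK mk) exprD invfM mulrA mulfV ?mul1r//.
by rewrite !p// ltnW.
Qed.

(** A copy is no longer than a step, so the image of a step stays in that step shifted by [-1/2].
    Hence the pieces of the measure occupy disjoint intervals of the line. *)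
Lemma cmap_dyad k u : dyad k u -> dyad k (cmap k u + 1 / 2).
Proof.
move=> ku; have [c1 c2] := cmap_cell k u; have /andP[t1 t2] := dyad_truncn ku.
have [E1 E2] := dyad_natE k.
rewrite /dyad /= in_itv/= -E1 -E2; move: c1 c2 t1 t2; set j := Num.truncn _ => c1 c2 t1 t2.
have s0 := exp2V_gt0 R (sg k).
have ns : 2 ^- n k <= 2 ^- sg k :> R by rewrite exp2V_le.
have {t1}h1 : (2 ^ (sg k - k.+1))%:R * 2 ^- sg k <= 2 ^- sg k * j%:R :> R.
  by rewrite mulrC ler_wpM2l ?(ltW s0)// ler_nat.
have {t2}h2 : 2 ^- sg k * j%:R + 2 ^- sg k <= (2 ^ (sg k - k))%:R * 2 ^- sg k :> R.
  by rewrite -{2}[2 ^- sg k]mulr1 -mulrDr natr1 mulrC ler_wpM2r ?(ltW s0)// ler_nat.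
by apply/andP; split; lra.
Qed.

Lemma dyad_uniq k k' u : dyad k u -> dyad k' u -> k = k'.
Proof.
wlog : k k' / (k <= k')%N => [H ku k'u|].
  by have [?|/ltnW ?] := leqP k k'; [exact: H|apply/esym/H].
rewrite leq_eqVlt => /orP[/eqP//|kk]; rewrite /dyad /= !in_itv/= => /andP[u1 _] /andP[_ u2].
by have := le_trans u1 (ltW (lt_le_trans u2 (exp2V_le R kk))); have := lt_le_trans u2 (exp2V_le R kk); rewrite ltNge u1.
Qed.

Lemma dyad_idxE k u : dyad k u -> dyad_idx u = k.
Proof. by move=> ku; apply: xget_unique => //= k' k'u; exact: dyad_uniq ku. Qed.

Lemma dyad_ex u : 0 < u < 1 -> exists k, dyad k u.
Proof.
move=> /andP[u0 u1].
have ex : exists k, 2 ^- k <= u.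
  exists (Num.truncn u^-1).+1; rewrite -[leRHS]invrK lef_pV2 ?posrE ?exprn_gt0 ?invr_gt0//.
  rewrite (le_trans (ltW (truncnS_gt _)))// -natrX ler_nat.
  by apply: ltnW; exact: ltn_expl.
case: (ex_minnP ex) => -[|k]; first by rewrite expr0 invr1 leNgt u1.
move=> h hmin; exists k; rewrite /dyad /= in_itv/= h /= ltNge; apply/negP => /hmin.
by rewrite ltnn.
Qed.

Lemma dyad_bigcup : \bigcup_k dyad k = `]0, 1[%classic.
Proof.
apply/seteqP; split => [u [k _]|u]; rewrite /= !in_itv/=; last by case/dyad_ex => k; exists k.
by rewrite /dyad /= in_itv/= => /andP[u1 u2]; rewrite (lt_le_trans _ u1) ?exp2V_gt0//= (lt_le_trans u2)// exp2V_le1.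
Qed.

Lemma measurable_apx k l : measurable_fun setT (apx k l).
Proof. exact: (measurable_truncn (node k l) (wd_gt0 k l)). Qed.

Lemma measurable_cmap k : measurable_fun setT (cmap k).
Proof.
apply: (@measurable_fun_cvg _ _ _ _ (fun l => apx k l)) => [l|u _]; first exact: measurable_apx.
exact: apx_cvg.
Qed.

Lemma measurable_ymap : measurable_fun setT ymap.
Proof.
pose E (i : nat) : set R := if i is k.+1 then dyad k else ~` `]0, 1[%classic.
have mE i : measurable (E i).
  by case: i => [|k]; [exact: measurableC|rewrite /E /dyad].
have UE : \bigcup_i E i = setT.
  apply/seteqP; split => // u _; case: (boolP (u \in `]0, 1[)) => u01.
    by have [k ku] := dyad_ex u01; exists k.+1.
  by exists 0%N => //; rewrite /E /=; exact/negP.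
rewrite -UE; apply/(measurable_fun_bigcup _ mE) => -[|k].
  apply: (@eq_measurable_fun _ _ _ _ _ (cmap 0)) => [u|]; last by apply: measurable_funTS; exact: measurable_cmap.
  rewrite inE /E => u01; rewrite /ymap (_ : dyad_idx u = 0%N)//.
  apply: xgetPN => k ku; apply: u01; rewrite -dyad_bigcup.
  by exists k.
apply: (@eq_measurable_fun _ _ _ _ _ (cmap k)) => [u|]; last by apply: measurable_funTS; exact: measurable_cmap.
by rewrite inE /E => ku; rewrite /ymap (dyad_idxE ku).
Qed.

End Transport.

(** * Upper bound for the transform of a piece *)

Section PieceFourier.
Variables (R : realType) (alpha : R).
Hypothesis alpha_gt0 : 0 < alpha.
Variables (n sg : nat -> nat).
Hypotheses (sg_gt : forall k, (k < sg k)%N) (n_ge : forall k, (sg k <= n k)%N).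
Local Notation cabs := (@Normc.normc R).
Local Notation leb := (@lebesgue_measure R).
Local Notation lev := (lev alpha).
Local Notation cells := (cells alpha).
Local Notation pt := (pt alpha).
Local Notation wd := (wd alpha sg).
Local Notation node := (node alpha n sg).
Local Notation ymap := (ymap alpha n sg).
Local Notation dyad := (@dyad R).

Lemma derive_le1_lip (f df : R -> R) (x y : R) : continuous f ->
  (forall z : R, is_derive z (1 : R) f (df z)) -> (forall z, `|df z| <= 1) ->
  `|f x - f y| <= `|x - y|.
Proof.
move=> cf fdf df1; wlog xy : x y / y < x => [H|].
  have [?|?|->] := ltgtP y x; [exact: H| |by rewrite !subrr].
  by rewrite distrC [leRHS]distrC H.
have [c _ ->] := MVT xy (fun x _ => fdf x) (continuous_subspaceT cf).
by rewrite normrM ler_piMl.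
Qed.

Lemma cos_lip (x y : R) : `|cos x - cos y| <= `|x - y|.
Proof.
apply: (@derive_le1_lip _ (fun x => - sin x)) => [|z]; first exact: continuous_cos.
by rewrite normrN sin_max.
Qed.

Lemma sin_lip (x y : R) : `|sin x - sin y| <= `|x - y|.
Proof.
apply: (@derive_le1_lip _ cos) => [|z]; [exact: continuous_sin|exact: cos_max].
Qed.

(** The Fourier transform of the image under [Y] of Lebesgue measure on [D], written over the
    parameter. *)
Definition hat (D : set R) (Y : R -> R) (xi : R) : R[i] :=
  Complex (Rintegral leb D (fun u => cos (- (2 * pi * Y u * xi))))
          (Rintegral leb D (fun u => sin (- (2 * pi * Y u * xi)))).

Lemma Rintegral_step_approx (f : R -> R) (h M e : R) (G : nat -> R) (a b : nat) :
  (a <= b)%N -> 0 < h -> measurable_fun setT f -> (forall x, `|f x| <= M) ->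
  (forall i u, (a <= i < b)%N -> i%:R * h <= u < i.+1%:R * h -> `|f u - G i| <= e) ->
  `|Rintegral leb `[(a%:R * h)%R, (b%:R * h)%R[%classic f - h * \sum_(a <= i < b) G i|
    <= e * (h * (b - a)%:R).
Proof.
move=> ab h0 mf fM fG.
have sumE (c : R) : \sum_(a <= i < b) (G i + c) = \sum_(a <= i < b) G i + c * (b - a)%:R.
  by rewrite big_split /= big_const_nat iter_addr_0 mulr_natr.
have U := @Rintegral_le_step R f h M (fun i => G i + e) a b ab h0 mf fM.
have L := @Rintegral_le_step R (fun x => - f x) h M (fun i => - G i + e) a b ab h0.
rewrite ler_norml -[e * _]opprK opprK; apply/andP; split.
  have : Rintegral leb `[(a%:R * h)%R, (b%:R * h)%R[%classic (fun x => - f x) <=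
      h * \sum_(a <= i < b) (- G i + e).
    apply: L; first exact: measurableT_comp.
      by move=> x; rewrite normrN.
    move=> i u iab ui; have := fG i u iab ui; rewrite ler_distl; lra.
  have -> : Rintegral leb `[(a%:R * h)%R, (b%:R * h)%R[%classic (fun x => - f x) =
            - Rintegral leb `[(a%:R * h)%R, (b%:R * h)%R[%classic f.
    rewrite -[RHS]mulN1r -RintegralZl//.
      by apply: eq_Rintegral => x _; rewrite mulN1r.
    apply: (bounded_integrable (M := M)) => //.
      by rewrite /= lebesgue_itvco ?ltry// ler_wpM2r ?ler_nat ?(ltW h0).
    exact: measurable_funTS.
  rewrite big_split /= sumrN big_const_nat iter_addr_0 mulrDr -[e *+ _]mulr_natr; lra.
have : Rintegral leb `[(a%:R * h)%R, (b%:R * h)%R[%classic f <= h * \sum_(a <= i < b) (G i + e).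
  apply: U => i u iab ui; have := fG i u iab ui; rewrite ler_distl; lra.
rewrite sumE mulrDr; lra.
Qed.

Lemma measurable_trig (Y : R -> R) (xi : R) : measurable_fun setT Y ->
  measurable_fun setT (fun u => cos (- (2 * pi * Y u * xi))) /\
  measurable_fun setT (fun u => sin (- (2 * pi * Y u * xi))).
Proof.
move=> mY; have m : measurable_fun setT (fun u => - (2 * pi * Y u * xi)).
  by apply: measurableT_comp => //; apply: measurable_funM => //; exact: measurable_funM.
split; apply: measurableT_comp m; apply: continuous_measurable_fun.
  exact: continuous_cos.
exact: continuous_sin.
Qed.

Lemma dyad_span k l :
  dyad k = `[((2 ^ (sg k - k.+1) * cells l)%N%:R * wd k l)%R,
               ((2 ^ (sg k - k) * cells l)%N%:R * wd k l)%R[%classic.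
Proof.
have [E1 E2] := dyad_natE R sg_gt k.
have A0 : (cells l)%:R != 0 :> R by rewrite pnatr_eq0 -lt0n cells_gt0.
by rewrite /wd /dyad -E1 -E2 !natrM mulrACA mulfV// mulr1 mulrACA mulfV// mulr1.
Qed.

Lemma truncn_cell (h u : R) i : 0 < h -> i%:R * h <= u < i.+1%:R * h ->
  Num.truncn (u / h) = i.
Proof. by move=> h0 ui; apply: truncn_def; rewrite ler_pdivlMr// ltr_pdivrMr. Qed.

Lemma exp_dyad_sub k : (2 ^ (sg k - k) - 2 ^ (sg k - k.+1) = 2 ^ (sg k - k.+1))%N.
Proof.
have -> : (sg k - k = (sg k - k.+1).+1)%N by have := sg_gt k; lia.
by rewrite expnS mul2n -addnn addnK.
Qed.

Lemma ymap_node k l i u : (2 ^ (sg k - k.+1) * cells l <= i < 2 ^ (sg k - k) * cells l)%N ->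
  i%:R * wd k l <= u < i.+1%:R * wd k l ->
  dyad k u /\ node k l i <= ymap u <= node k l i + 2 ^- n k * 2 ^- lev l.
Proof.
move=> /andP[i1 i2] ui; have h0 := wd_gt0 alpha sg k l.
have ku : dyad k u.
  rewrite (dyad_span k l) /= in_itv/=; move/andP: ui => [u1 u2].
  by apply/andP; split; [apply: le_trans u1|apply: lt_le_trans u2 _]; rewrite ler_wpM2r ?(ltW h0)// ler_nat.
split=> //; rewrite /ymap (dyad_idxE ku).
have [] := cmap_bounds alpha_gt0 n sg k l u.
by rewrite /apx (truncn_cell h0 ui) => -> ->.
Qed.

Lemma sum_blocks (V : nmodType) (a b A : nat) (F : nat -> V) : (a <= b)%N ->
  \sum_(a * A <= i < b * A) F i = \sum_(a <= j < b) \sum_(i < A) F (j * A + i)%N.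
Proof.
elim: b => [|b IHb]; first by rewrite leqn0 => /eqP ->; rewrite !big_geq.
rewrite leq_eqVlt => /orP[/eqP ->|]; first by rewrite !big_geq.
rewrite ltnS => ab; rewrite big_nat_recr//= -IHb// (big_cat_nat (n := (b * A)%N))/=.
- congr (_ + _); rewrite -{1}[(b * A)%N]add0n big_addn mulSn addnK big_mkord.
  by apply: eq_bigr => i _; rewrite addnC.
- by rewrite leq_mul2r ab orbT.
- by rewrite leq_mul2r leqnSn orbT.
Qed.

Lemma node_block k l j i : (i < cells l)%N ->
  node k l (j * cells l + i) = - (1 / 2) + 2 ^- sg k * j%:R + 2 ^- n k * pt l i.
Proof.
move=> il; rewrite /node divnMDl ?cells_gt0// divn_small// addn0.
by rewrite modnMDl modn_small.
Qed.

(** The sum factors into an arithmetic progression over the steps [j] and the mean exponential of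
    [X] at the dilated frequency. The progression is bounded trivially; all decay comes from [X]. *)
Lemma cabs_sum_nodes k l (xi : R) :
  cabs (((wd k l)%:C)%C * \sum_(2 ^ (sg k - k.+1) * cells l <= i < 2 ^ (sg k - k) * cells l)
     ex (- xi * node k l i)) <=
  2 ^- k.+1 * cabs (pt_hat alpha l (- (2 ^- n k * xi))).
Proof.
have N : (2 ^ (sg k - k.+1) <= 2 ^ (sg k - k))%N by rewrite leq_exp2l//; lia.
rewrite sum_blocks//.
rewrite (eq_bigr (fun j => ex (- xi * (- (1 / 2) + 2 ^- sg k * j%:R)) *
   \sum_(i < cells l) ex (- (2 ^- n k * xi) * pt l i))); last first.
  move=> j _; rewrite mulr_sumr; apply: eq_bigr => i _.
  by rewrite node_block// -exD; congr ex; ring.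
rewrite -mulr_suml; set S1 := \sum_(_ <= _ < _) _; set S2 := \sum_(_ < _) _.
have S1le : cabs S1 <= (2 ^ (sg k - k.+1))%:R.
  rewrite (le_trans (cabs_sum _ _ _))// (eq_bigr (fun=> 1)).
    by rewrite big_const_nat iter_addr_0 exp_dyad_sub.
  by move=> j _; rewrite cabs_ex.
have A0 : 0 < (cells l)%:R :> R by rewrite ltr0n cells_gt0.
have h0 := wd_gt0 alpha sg k l.
rewrite !cabsM !cabs_real -/S2 (gtr0_norm h0) gtr0_norm ?invr_gt0//.
have [E1 _] := dyad_natE R sg_gt k.
rewrite -E1 (_ : wd k l * _ = (2 ^- sg k * ((cells l)%:R^-1 * cabs S2)) * cabs S1).
  rewrite [leRHS](_ : _ = 2 ^- sg k * ((cells l)%:R^-1 * cabs S2) *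
    (2 ^ (sg k - k.+1))%:R); last by ring.
  by rewrite ler_wpM2l ?mulr_ge0 ?invr_ge0 ?exprn_ge0 ?cabs_ge0.
by rewrite /wd; ring.
Qed.

(** The modulus of [pt_hat] decreases with the level, so the bound at [l0] persists at finer levels,
    where the integral is as close as desired to the sum over the nodes. *)
Lemma cabs_hat_dyad k l0 (xi B : R) :
  cabs (pt_hat alpha l0 (- (2 ^- n k * xi))) <= B ->
  cabs (hat (dyad k) ymap xi) <= 2 ^- k.+1 * B.
Proof.
move=> HB; apply/ler_addgt0Pr => e e0.
have pi0 := pi_gt0 R; have n0 := exp2V_gt0 R (n k); have k0 := exp2V_gt0 R k.+1.
have k1 := exp2V_le1 R k.+1.
pose K := 2 * pi * `|xi| * 2 ^- n k.
have K0 : 0 <= K by rewrite !mulr_ge0 ?(ltW pi0) ?(ltW n0).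
pose l := maxn l0 (Num.truncn (2 * K / e)).+1.
have Kl : K * 2 ^- lev l <= e / 2.
  have : 2 * K / e <= 2 ^+ lev l.
    rewrite (le_trans (ltW (truncnS_gt _)))// -natrX ler_nat.
    rewrite (@leq_trans l) ?leq_maxr// (leq_trans (lev_ge alpha_gt0 l))//.
    by apply: ltnW; exact: ltn_expl.
  rewrite ler_pdivrMr// => h; rewrite ler_pdivrMr ?exprn_gt0//; lra.
have {}HB : cabs (pt_hat alpha l (- (2 ^- n k * xi))) <= B.
  by apply: le_trans HB; apply: cabs_pt_hat_homo; rewrite leq_maxl.
have N : (2 ^ (sg k - k.+1) * cells l <= 2 ^ (sg k - k) * cells l)%N.
  by rewrite leq_mul2r leq_exp2l//; lia.
have h0 := wd_gt0 alpha sg k l.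
have [mc ms] := measurable_trig xi (measurable_ymap alpha_gt0 n sg).
have width : wd k l * (2 ^ (sg k - k) * cells l - 2 ^ (sg k - k.+1) * cells l)%:R = 2 ^- k.+1.
  have [E1 _] := dyad_natE R sg_gt k.
  rewrite -mulnBl exp_dyad_sub -E1 natrM /wd; field.
  by rewrite pnatr_eq0 -lt0n cells_gt0 expf_neq0// pnatr_eq0.
have close i u : (2 ^ (sg k - k.+1) * cells l <= i < 2 ^ (sg k - k) * cells l)%N ->
    i%:R * wd k l <= u < i.+1%:R * wd k l ->
    `|- (2 * pi * ymap u * xi) - - (2 * pi * node k l i * xi)| <= K * 2 ^- lev l.
  move=> iab ui; have [_ /andP[y1 y2]] := ymap_node iab ui.
  rewrite (_ : - (2 * pi * ymap u * xi) - _ = - (2 * pi * xi * (ymap u - node k l i))); last by ring.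
  rewrite normrN !normrM (ger0_norm (ltW pi0)) [`|2|]ger0_norm// /K -!mulrA.
  rewrite !ler_wpM2l// ?(ltW pi0)// ger0_norm ?subr_ge0//; lra.
have := @Rintegral_step_approx _ (wd k l) 1 (K * 2 ^- lev l)
   (fun i => cos (- (2 * pi * node k l i * xi))) _ _ N h0 mc (fun x => cos_max _)
   (fun i u iab ui => le_trans (cos_lip _ _) (close i u iab ui)).
have := @Rintegral_step_approx _ (wd k l) 1 (K * 2 ^- lev l)
   (fun i => sin (- (2 * pi * node k l i * xi))) _ _ N h0 ms (fun x => sin_max _)
   (fun i u iab ui => le_trans (sin_lip _ _) (close i u iab ui)).
rewrite -!dyad_span width => Hs Hc.
set z := ((wd k l)%:C)%C * \sum_(2 ^ (sg k - k.+1) * cells l <= i < 2 ^ (sg k - k) * cells l)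
     ex (- xi * node k l i).
have zB : cabs z <= 2 ^- k.+1 * B.
  by rewrite (le_trans (cabs_sum_nodes _ _ _))// ler_wpM2l ?(ltW k0).
have sumC (s : seq nat) (F : nat -> R[i]) : \sum_(i <- s) F i =
    Complex (\sum_(i <- s) complex.Re (F i)) (\sum_(i <- s) complex.Im (F i)).
  elim: s => [|i s IHs]; first by rewrite !big_nil.
  by rewrite !big_cons IHs; case: (F i).
have zE : z = Complex
   (wd k l * \sum_(2 ^ (sg k - k.+1) * cells l <= i < 2 ^ (sg k - k) * cells l) cos (- (2 * pi * node k l i * xi)))
   (wd k l * \sum_(2 ^ (sg k - k.+1) * cells l <= i < 2 ^ (sg k - k) * cells l) sin (- (2 * pi * node k l i * xi))).
  rewrite /z sumC /ex /expi /=.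
  have E i : 2 * pi * (- xi * node k l i) = - (2 * pi * node k l i * xi) by ring.
  under eq_bigr do rewrite E; under [X in Complex _ X]eq_bigr do rewrite E.
  by apply/eqP; rewrite eq_complex /= !mul0r subr0 addr0 !eqxx.
have dB : cabs (hat (dyad k) ymap xi - z) <= e.
  rewrite zE (le_trans (cabs_le_ReIm _))//= (le_trans (lerD Hc Hs))//.
  have : K * 2 ^- lev l * 2 ^- k.+1 <= e / 2.
    by rewrite (le_trans _ Kl)// ler_piMr// mulr_ge0// ltW// exp2V_gt0.
  lra.
rewrite -[hat _ _ _](subrK z) (le_trans (cabsD _ _))// addrC lerD//.
Qed.

(** [tail 0] is the whole parameter interval. Splitting off the first [K] dyadic pieces leaves a
    rest of measure [2 ^- K], so finite additivity suffices. *)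
Definition tail (K : nat) : set R := `]0, 2 ^- K[%classic.

Lemma tailS K : tail K = tail K.+1 `|` dyad K.
Proof.
have k0 := exp2V_gt0 R K.+1; have kk := exp2V_le R (leqnSn K).
apply/seteqP; split => u; rewrite /tail /dyad /= !in_itv/=.
  by move=> /andP[u0 uK]; have [h|h] := ltP u (2 ^- K.+1); [left; rewrite u0|right].
move=> [/andP[-> h]|/andP[h ->]]; first by rewrite (lt_le_trans h).
by rewrite (lt_le_trans k0 h).
Qed.

Lemma tail_dyad_disj K : tail K.+1 `&` dyad K = set0.
Proof.
apply/seteqP; split => // u []; rewrite /tail /dyad /= !in_itv/= => /andP[_ h] /andP[h' _].
by move: (lt_le_trans h h'); rewrite ltxx.
Qed.

Lemma leb_tail K : leb (tail K) = (2 ^- K)%:E.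
Proof. by rewrite /tail lebesgue_measure_itv/= lte_fin exp2V_gt0 sube0. Qed.

Lemma measurable_tail K : measurable (tail K).
Proof. by rewrite /tail. Qed.

Lemma measurable_dyad k : measurable (dyad k).
Proof. by rewrite /dyad. Qed.

Lemma leb_tail_lty K : (leb (tail K) < +oo)%E.
Proof. by rewrite leb_tail ltry. Qed.

Lemma cabs_hat_tail (Y : R -> R) (xi : R) K : measurable_fun setT Y ->
  cabs (hat (tail 0) Y xi) <= \sum_(0 <= k < K) cabs (hat (dyad k) Y xi) + 2 * 2 ^- K.
Proof.
move=> mY; have [mc ms] := measurable_trig xi mY.
have H K' : cabs (hat (tail 0) Y xi) <= \sum_(0 <= k < K') cabs (hat (dyad k) Y xi) + cabs (hat (tail K') Y xi).
  elim: K' => [|m IHm]; first by rewrite big_geq// add0r.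
  rewrite (le_trans IHm)// big_nat_recr// -addrA lerD2l.
  suff -> : hat (tail m) Y xi = hat (dyad m) Y xi + hat (tail m.+1) Y xi by exact: cabsD.
  have U (f : R -> R) : measurable_fun setT f -> (forall x, `|f x| <= 1) ->
      Rintegral leb (tail m) f = Rintegral leb (dyad m) f + Rintegral leb (tail m.+1) f.
    move=> mf f1.
    have intf : leb.-integrable (tail m.+1 `|` dyad m) (EFin \o f).
      rewrite -tailS; apply: (bounded_integrable (M := 1)) => //.
      - exact: measurable_tail.
      - exact: leb_tail_lty.
      - exact: measurable_funTS.
    have disj : [disjoint tail m.+1 & dyad m].
      by apply/disj_setPS; rewrite tail_dyad_disj.
    rewrite tailS Rintegral_setU; do ?by [exact: measurable_tail|exact: measurable_dyad|
      exact: intf|exact: disj|rewrite addrC].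
  by rewrite /hat !U//= => x; rewrite ?cos_max ?sin_max.
rewrite (le_trans (H K))// lerD2l (le_trans (cabs_le_ReIm _))//=.
have B (f : R -> R) : measurable_fun setT f -> (forall x, `|f x| <= 1) ->
    `|Rintegral leb (tail K) f| <= 2 ^- K.
  move=> mf f1; have mt := measurable_tail K; have ft := leb_tail_lty K.
  have mft : measurable_fun (tail K) f by exact: measurable_funTS.
  have intf := bounded_integrable mt ft mft (fun x _ => f1 x).
  rewrite (le_trans (le_normr_Rintegral _ intf))//.
  have mnf : measurable_fun (tail K) (fun x => `|f x|).
    by apply: measurable_funTS; exact: measurableT_comp.
  have := @Rintegral_le_cst _ (fun x => `|f x|) (tail K) 1 1 mt ft mnf.
  rewrite mul1r leb_tail/=; apply => // x _; first by rewrite normr_id.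
rewrite [leRHS]mulr_natl mulr2n lerD//.
  exact: (B _ mc (fun x => cos_max _)).
exact: (B _ ms (fun x => sin_max _)).
Qed.

End PieceFourier.

(** * Mass of an interval within one piece *)

Section PieceMass.
Variables (R : realType) (alpha : R).
Hypothesis alpha_gt0 : 0 < alpha.
Variables (n sg : nat -> nat).
Hypotheses (sg_gt : forall k, (k < sg k)%N) (n_ge : forall k, (sg k <= n k)%N).
Local Notation leb := (@lebesgue_measure R).
Local Notation lev := (lev alpha).
Local Notation cells := (cells alpha).
Local Notation pt := (pt alpha).
Local Notation wd := (wd alpha sg).
Local Notation node := (node alpha n sg).
Local Notation ymap := (ymap alpha n sg).
Local Notation dyad := (@dyad R).
Local Notation tail := (@tail R).

Definition in_itv_pre (c len : R) : set R := ymap @^-1` `[c, c + len]%classic.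

Lemma measurable_in_itv_pre c len : measurable (in_itv_pre c len).
Proof.
rewrite /in_itv_pre -[X in measurable X]setTI.
by apply: (measurable_ymap alpha_gt0 n sg) => //; exact: measurable_itv.
Qed.

(** With [s = 2 ^- sg k], at most [len / s + 3] steps have copies near the interval, and the
    hypothesis bounds the mass in each by [s * M]. *)
Lemma mass_dyad_le k l (c len M : R) : 0 < len -> 0 <= M ->
  (forall c' : R, (\sum_(i < cells l) (c' - 2 ^- lev l <= pt l i <= c' + len / 2 ^- n k)%R)%:R
     <= M * (cells l)%:R) ->
  (leb (in_itv_pre c len `&` dyad k) <= ((len + 3 * 2 ^- sg k) * M)%:E)%E.
Proof.
move=> len0 M0 HM; have h0 := wd_gt0 alpha sg k l.
have N1 : (2 ^ (sg k - k.+1) <= 2 ^ (sg k - k))%N by rewrite leq_exp2l//; lia.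
have N : (2 ^ (sg k - k.+1) * cells l <= 2 ^ (sg k - k) * cells l)%N by rewrite leq_mul2r N1 orbT.
have s0 := exp2V_gt0 R (sg k); have n0 := exp2V_gt0 R (n k).
have ns : 2 ^- n k <= 2 ^- sg k :> R by rewrite exp2V_le.
have A0 : 0 < (cells l)%:R :> R by rewrite ltr0n cells_gt0.
pose Q i := c - 2 ^- n k * 2 ^- lev l <= node k l i <= c + len.
(* The steps whose copy can meet the interval: a copy has diameter at most [2 ^- n k], and a node
   may lie up to another [2 ^- n k] to the left. *)
pose P (j : nat) := c + 1 / 2 - 2 * 2 ^- n k <= 2 ^- sg k * j%:R <= c + 1 / 2 - 2 * 2 ^- n k + (len + 2 * 2 ^- n k).
rewrite (dyad_span alpha sg_gt k l).
rewrite (le_trans (@measure_le_step _ _ _ Q _ _ N h0 (measurable_in_itv_pre _ _) _))//.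
  move=> i u iab ui; rewrite /in_itv_pre /= in_itv/= /Q => /andP[y1 y2].
  have [_ /andP[z1 z2]] := ymap_node alpha_gt0 n sg_gt iab ui.
  by apply/andP; split; lra.
rewrite lee_fin sum_blocks//.
have inner j : (\sum_(i < cells l) Q (j * cells l + i)%N)%:R <= (P j)%:R * (M * (cells l)%:R).
  rewrite /Q; under eq_bigr do rewrite node_block//.
  have [Pj|Pj] := boolP (P j).
    rewrite [leRHS]mul1r (le_trans _ (HM ((c + 1 / 2 - 2 ^- sg k * j%:R) / 2 ^- n k)))//.
    have [A AE] : exists A, A = c + 1 / 2 - 2 ^- sg k * j%:R by exists (c + 1 / 2 - 2 ^- sg k * j%:R).
    rewrite -AE ler_nat; apply: leq_sum => i _.
    have n0' : 2 ^- n k != 0 :> R by rewrite lt0r_neq0.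
    case: (boolP (_ <= _ <= _)) => // /andP[q1 q2]; rewrite lt0b.
    by apply/andP; split; rewrite -(ler_pM2r n0) ?mulrBl ?mulrDl ?divfK//; lra.
  rewrite [leRHS]mul0r big1// => i _; apply/eqP; rewrite eqb0; apply: contra Pj => /andP[q1 q2].
  have /andP[p0 p1] := pt_itv alpha_gt0 l i.
  have l0 := exp2V_gt0 R (lev l); have l1 := exp2V_le1 R (lev l).
  have p2 : 2 ^- n k * pt l i <= 2 ^- n k by rewrite ger_pMr//; lra.
  have p3 : 0 <= 2 ^- n k * pt l i by rewrite mulr_ge0 ?(ltW n0).
  have p4 : 2 ^- n k * 2 ^- lev l <= 2 ^- n k :> R by rewrite ger_pMr.
  by rewrite /P; apply/andP; split; lra.
have cnt : (\sum_(2 ^ (sg k - k.+1) <= j < 2 ^ (sg k - k)) P j)%:R <= len / 2 ^- sg k + 3.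
  have sep i j : (i < 2 ^ (sg k - k))%N -> (j < 2 ^ (sg k - k))%N -> i != j ->
      2 ^- sg k <= `|2 ^- sg k * i%:R - 2 ^- sg k * j%:R| :> R.
    move=> _ _ ij; rewrite -mulrBr normrM gtr0_norm// ler_peMr ?(ltW s0)//.
    rewrite -[i%:R]/(i%:~R) -[j%:R]/(j%:~R) -intrB -intr_norm -[1]/(1%:~R) ler_int.
    by move/eqP : ij => ij; lia.
  have l0 : 0 <= len + 2 * 2 ^- n k by rewrite addr_ge0 ?mulr_ge0 ?(ltW n0) ?(ltW len0).
  have := count_separated (c + 1 / 2 - 2 * 2 ^- n k) s0 l0 sep.
  rewrite -(big_mkord xpredT (fun j => P j : nat)) (big_cat_nat (n := (2 ^ (sg k - k.+1))%N))//= natrD => h.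
  have h1 : (len + 2 * 2 ^- n k) / 2 ^- sg k <= len / 2 ^- sg k + 2.
    rewrite mulrDl lerD2l ler_pdivrMr//; lra.
  have h2 : 0 <= (\sum_(0 <= i < 2 ^ (sg k - k.+1)) P i)%:R :> R by [].
  lra.
rewrite natr_sum (@le_trans _ _ (wd k l * ((len / 2 ^- sg k + 3) * (M * (cells l)%:R))))//.
  rewrite ler_wpM2l ?(ltW h0)// (le_trans (ler_sum _ (fun j _ => inner j)))//.
  rewrite -mulr_suml -natr_sum ler_wpM2r// mulr_ge0// ltW//.
rewrite /wd le_eqVlt; apply/orP; left; apply/eqP; field.
by rewrite (lt0r_neq0 A0) andbT expf_neq0// pnatr_eq0.
Qed.

Lemma mass_dyad_le_width k (E : set R) : measurable E ->
  (leb (E `&` dyad k) <= (2 ^- k.+1)%:E)%E.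
Proof.
move=> mE; have kk := exp2V_le R (leqnSn k).
have mEd : measurable (E `&` dyad k).
  by apply: measurableI; [exact: mE|exact: measurable_dyad].
have md := @measurable_dyad R k.
apply: (@le_trans _ _ (leb (dyad k))).
  by apply: le_measure; [rewrite inE; exact: mEd|rewrite inE; exact: md|exact: subIsetr].
rewrite /dyad /= lebesgue_itvco// lee_fin.
have -> : 2 ^- k = 2 * 2 ^- k.+1 :> R by rewrite exprS; field; rewrite expf_neq0// pnatr_eq0.
lra.
Qed.

Lemma mass_tail (E : set R) K : measurable E ->
  (leb (E `&` tail 0) <= \sum_(0 <= k < K) leb (E `&` dyad k) + (2 ^- K)%:E)%E.
Proof.
move=> mE.
have mEd k : measurable (E `&` dyad k).
  by apply: measurableI; [exact: mE|exact: measurable_dyad].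
have mEt k : measurable (E `&` tail k).
  by apply: measurableI; [exact: mE|exact: measurable_tail].
apply: (@le_trans _ _ (\sum_(0 <= k < K) leb (E `&` dyad k) + leb (E `&` tail K))%E).
  elim: K => [|K IHK]; first by rewrite big_geq// add0e.
  rewrite (le_trans IHK)// big_nat_recr//= -addeA leeD2l//.
  rewrite tailS setIUr addeC.
  by apply: measureU2; [exact: mEt|exact: mEd].
rewrite leeD2l// -leb_tail.
have mt := @measurable_tail R K.
by apply: le_measure; [rewrite inE; exact: mEt|rewrite inE; exact: mt|exact: subIsetr].
Qed.

End PieceMass.

(** * Choice of the scales and summation over the pieces *)

Section GlobalEstimates.
Variables (R : realType) (alpha beta : R).
Hypotheses (alpha_gt0 : 0 < alpha) (beta_ge0 : 0 <= beta) (beta_lt1 : beta < 1).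
Local Notation cabs := (@Normc.normc R).
Local Notation leb := (@lebesgue_measure R).

Definition fdim : R := (1 - beta) / (2 + alpha).
Definition hdim : R := 2 / (2 + alpha).
(* With [d = 2 ^- lgdil k] and [s = 2 ^- lgstep k]: [d ^ fdim] is about the
   length [2 ^- k.+1] of [dyad k], and [s] is about [d ^ hdim]. *)
Definition lgdil (k : nat) : nat := (Num.truncn (k.+1%:R / fdim)).+1.
Definition lgstep (k : nat) : nat := Num.truncn (hdim * (lgdil k)%:R).

Local Notation n := lgdil.
Local Notation sg := lgstep.
Local Notation ymap := (ymap alpha n sg).
Local Notation dyad := (@dyad R).
Local Notation tail := (@tail R).

Lemma fdim_itv : 0 < fdim <= 1.
Proof.
have al0 := alpha_gt0; have b0 := beta_ge0; have b1 := beta_lt1.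
by rewrite /fdim divr_gt0 ?ler_pdivrMr ?subr_gt0 ?addr_gt0//=; lra.
Qed.

Lemma hdim_itv : 0 < hdim < 1.
Proof.
have al0 := alpha_gt0.
by rewrite /hdim divr_gt0 ?ltr_pdivrMr ?addr_gt0//=; lra.
Qed.

Lemma lgdil_itv k : k.+1%:R / fdim < (n k)%:R <= k.+1%:R / fdim + 1.
Proof.
have /andP[f0 _] := fdim_itv.
rewrite truncnS_gt /= /lgdil -[(_.+1)%:R in leLHS]natr1 lerD2r.
by have /truncn_itv/andP[] : 0 <= k.+1%:R / fdim by rewrite divr_ge0// ltW.
Qed.

Lemma lgdil_ge k : (k.+1 <= n k)%N.
Proof.
have /andP[f0 f1] := fdim_itv; have /andP[h _] := lgdil_itv k.
rewrite -(ler_nat R) (le_trans _ (ltW h))// ler_pdivlMr//.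
by rewrite ler_piMr.
Qed.

Lemma lgstep_itv k : (sg k)%:R <= hdim * (n k)%:R < (sg k).+1%:R.
Proof.
have /andP[h0 _] := hdim_itv.
by apply: truncn_itv; rewrite mulr_ge0// ltW.
Qed.

(** The ratio [hdim / fdim = 2 / (1 - beta)] is at least 2. In particular [k < sg k], so [dyad k]
    consists of whole steps. *)
Lemma lgstep_ge k : (2 * k.+1 <= sg k)%N.
Proof.
have al0 := alpha_gt0; have b0 := beta_ge0; have b1 := beta_lt1.
have /andP[h0 _] := hdim_itv; have /andP[f0 _] := fdim_itv.
rewrite truncn_ge_nat; last by rewrite mulr_ge0// ltW.
have /andP[h _] := lgdil_itv k.
rewrite (@le_trans _ _ (hdim * (k.+1%:R / fdim)))//; last by rewrite ler_wpM2l ?(ltW h0)// ltW.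
have -> : hdim * (k.+1%:R / fdim) = 2 * k.+1%:R / (1 - beta).
  by rewrite /hdim /fdim; field; rewrite !lt0r_neq0//; lra.
rewrite ler_pdivlMr ?subr_gt0// natrM ler_piMr ?mulr_ge0//; lra.
Qed.

Lemma lgstep_gt k : (k < sg k)%N.
Proof. by have := lgstep_ge k; lia. Qed.

Lemma lgdil_ge_step k : (sg k <= n k)%N.
Proof.
have /andP[h0 h1] := hdim_itv; have /andP[h _] := lgstep_itv k.
by rewrite -(ler_nat R) (le_trans h)// ler_piMl// ltW.
Qed.

Lemma pow2N_lt1 (e : R) : 0 < e -> 2 `^ (- e) < 1.
Proof.
move=> e0; rewrite /powR pnatr_eq0 expR_lt1 mulNr oppr_lt0 mulr_gt0//.
by rewrite ln_gt0// ltr1n.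
Qed.

Lemma sum_pow2_le (e : R) K : 0 < e ->
  \sum_(0 <= k < K) 2 `^ (- (e * k.+1%:R)) <= (1 - 2 `^ (- e))^-1.
Proof.
move=> e0; set r := 2 `^ (- e).
have r0 : 0 < r by rewrite powR_gt0.
have r1 : r < 1.
  exact: pow2N_lt1.
under eq_bigr do rewrite -mulNr powRrM powR_mulrn ?powR_ge0// -/r.
rewrite big_mkord -[leRHS]mul1r ler_pdivlMr ?subr_gt0//.
under eq_bigr do rewrite exprS.
rewrite -mulr_sumr; have := subrX1 r K.
have : 0 <= r ^+ K by rewrite exprn_ge0// ltW.
have : r ^+ K <= 1 by rewrite exprn_ile1// ltW.
set S := \sum_(_ < _) _ => h1 h2 E.
rewrite (_ : r * S * (1 - r) = r * - ((r - 1) * S)); last by ring.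
rewrite -E; nra.
Qed.

(** Three ranges, with step [s] and dilation [d]. For [len] below [s], boundedly many steps count,
    and [s * (len / d) ^ th] is about [len ^ th * d ^ (hdim - th)]. Between [s] and the width of the
    piece the mass is of order [len]; above, it is at most the width. Each case leaves a geometric
    factor in [k]. *)
Lemma mass_dyad_pow (th : R) : 0 <= th -> th < hdim ->
  exists2 C : R, 0 < C & forall k c len, 0 < len ->
    (leb (in_itv_pre alpha n sg c len `&` dyad k) <=
     (C * len `^ th * 2 `^ (- ((hdim - th) * k.+1%:R)))%:E)%E.
Proof.
move=> th0 th1; have /andP[h0 h1] := hdim_itv.
have [C C1 HC] := pt_ball alpha_gt0 th0 th1.
exists (8 * C); first by lra.
move=> k c len len0.
have s0 := exp2V_gt0 R (sg k); have n0 := exp2V_gt0 R (n k).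
have n0' : 0 < 2 ^+ n k :> R by rewrite exprn_gt0.
have lth : 0 < len `^ th by rewrite powR_gt0.
have cmp (x : R) : 1 <= x -> 2 `^ (- (x * k.+1%:R)) <= 2 `^ (- ((hdim - th) * k.+1%:R)).
  by move=> x1; rewrite ler_pow2// lerN2 ler_wpM2r//; lra.
have [small|big] := leP len (2 ^- sg k).
  have ld0 : 0 < len / 2 ^- n k by rewrite divr_gt0.
  have [l Hl] := HC _ ld0.
  have M0 : 0 <= C * (len / 2 ^- n k) `^ th by rewrite mulr_ge0 ?powR_ge0//; lra.
  apply: le_trans (mass_dyad_le alpha_gt0 lgstep_gt lgdil_ge_step c len0 M0 Hl) _.
  rewrite lee_fin (@le_trans _ _ (4 * 2 ^- sg k * (C * (len / 2 ^- n k) `^ th)))//.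
    by rewrite ler_wpM2r//; lra.
  have sle : 2 ^- sg k <= 2 * 2 `^ (- (hdim * (n k)%:R)).
    have /andP[_ h] := lgstep_itv k.
    rewrite -pow2N_nat -{2}[2]powRr1// -pow2D ler_pow2//.
    by move: h; rewrite -[(sg k).+1%:R]natr1; lra.
  have dil : (len / 2 ^- n k) `^ th = len `^ th * 2 `^ (th * (n k)%:R).
    rewrite invrK powRM ?(ltW len0) ?(ltW n0')//.
    by rewrite -pow2_nat -powRrM [(n k)%:R * th]mulrC.
  rewrite dil (@le_trans _ _ (4 * (2 * 2 `^ (- (hdim * (n k)%:R))) * (C * (len `^ th * 2 `^ (th * (n k)%:R)))))//.
    apply: ler_wpM2r; last by rewrite ler_wpM2l.
    by rewrite mulr_ge0 ?mulr_ge0 ?powR_ge0//; lra.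
  rewrite (_ : 4 * _ * _ = 8 * C * len `^ th * (2 `^ (- (hdim * (n k)%:R)) * 2 `^ (th * (n k)%:R))); last by ring.
  rewrite -pow2D ler_wpM2l ?mulr_ge0 ?powR_ge0//; first by lra.
  rewrite ler_pow2// -mulNr -mulrDl -[leRHS]mulNr.
  have kn : k.+1%:R <= (n k)%:R :> R by rewrite ler_nat lgdil_ge.
  nra.
(* At level 0 there is one point, so [M = 1] and only steps are counted. *)
have HM (c' : R) : (\sum_(i < cells alpha 0) (c' - 2 ^- lev alpha 0 <= pt alpha 0 i <= c' + len / 2 ^- n k)%R)%:R
     <= 1 * (cells alpha 0)%:R :> R.
  by rewrite /= big_ord1 mulr1; case: (_ && _).
have B1 := mass_dyad_le alpha_gt0 lgstep_gt lgdil_ge_step c len0 ler01 HM.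
have B2 := mass_dyad_le_width k (measurable_in_itv_pre alpha_gt0 n sg c len).
have w0 := exp2V_gt0 R k.+1.
have wE : 2 ^- k.+1 = (2 ^- k.+1) `^ th * (2 ^- k.+1) `^ (1 - th) :> R.
  by rewrite -powRD ?lt0r_neq0 ?implybT// subrKC powRr1// ltW.
have wth : (2 ^- k.+1) `^ (1 - th) <= 2 `^ (- ((hdim - th) * k.+1%:R)) :> R.
  rewrite -pow2N_nat -powRrM ler_pow2// mulNr lerN2 [leRHS]mulrC ler_wpM2r//; lra.
have [lw|lw] := leP len (2 ^- k.+1).
  apply: le_trans B1 _; rewrite lee_fin mulr1.
  rewrite (@le_trans _ _ (4 * len))//; first by lra.
  have lE : len = len `^ th * len `^ (1 - th).
    by rewrite -powRD ?lt0r_neq0 ?implybT// subrKC powRr1// ltW.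
  have l2 : len `^ (1 - th) <= (2 ^- k.+1) `^ (1 - th).
    by rewrite ge0_ler_powR ?nnegrE ?(ltW w0) ?(ltW len0)//; lra.
  rewrite {1}lE -!mulrA [leRHS]mulrA ler_pM ?mulr_ge0 ?powR_ge0//; first by lra.
  by rewrite ler_wpM2l ?(ltW lth)// (le_trans l2).
apply: le_trans B2 _; rewrite lee_fin wE.
have l3 : (2 ^- k.+1) `^ th <= len `^ th.
  by rewrite ge0_ler_powR ?nnegrE ?(ltW w0) ?(ltW len0) ?(ltW lw).
rewrite ler_pM ?powR_ge0// (le_trans l3)// ler_peMl ?(ltW lth)//; lra.
Qed.

Lemma mass_pow (th : R) : 0 <= th -> th < hdim ->
  exists2 C : R, 0 < C & forall c len, 0 < len ->
    (leb (in_itv_pre alpha n sg c len `&` tail 0) <= (C * len `^ th)%:E)%E.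
Proof.
move=> th0 th1; have [C C0 HC] := mass_dyad_pow th0 th1.
have e0 : 0 < hdim - th by rewrite subr_gt0.
have r1 : 2 `^ (- (hdim - th)) < 1.
  exact: pow2N_lt1.
exists (C * (1 - 2 `^ (- (hdim - th)))^-1); first by rewrite mulr_gt0// invr_gt0 subr_gt0.
move=> c len len0; apply/lee_addgt0Pr => e ee0.
pose K := (Num.truncn e^-1).+1.
have Ke : 2 ^- K <= e.
  rewrite -[leRHS]invrK lef_pV2 ?posrE ?exprn_gt0 ?invr_gt0//.
  rewrite (le_trans (ltW (truncnS_gt _)))// -natrX ler_nat.
  by apply: ltnW; exact: ltn_expl.
apply: le_trans (mass_tail K (measurable_in_itv_pre alpha_gt0 n sg c len)) _.
rewrite leeD ?lee_fin//.
apply: (@le_trans _ _ (\sum_(0 <= k < K) (C * len `^ th * 2 `^ (- ((hdim - th) * k.+1%:R)))%:E)%E).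
  by apply: lee_sum => k _; exact: HC.
rewrite sumEFin lee_fin -mulr_sumr [leRHS]mulrAC ler_wpM2l ?mulr_ge0 ?powR_ge0 ?(ltW C0)//.
exact: sum_pow2_le.
Qed.

(** Undoing the dilation costs about [2 ^ (gam * k.+1 / fdim)], which the mass [2 ^- k.+1] of the
    piece outweighs as [gam < fdim]; the pieces then sum geometrically with ratio [2 ^ (- e)]. *)
Lemma hat_decay (gam : R) : 0 <= gam -> gam < fdim ->
  exists2 C : R, 0 < C & forall xi,
    cabs (hat (tail 0) ymap xi) <= C * (1 + `|xi|) `^ (- gam).
Proof.
move=> g0 g1; have /andP[f0 f1] := fdim_itv.
have al0 := alpha_gt0; have b0 := beta_ge0; have b1 := beta_lt1.
have g2 : gam < 1 / (2 + alpha).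
  rewrite (lt_le_trans g1)// /fdim ler_wpM2r ?invr_ge0; lra.
have [C C0 HC] := pt_hat_decay al0 g0 g2.
pose e := 1 - gam / fdim.
have e0 : 0 < e by rewrite subr_gt0 ltr_pdivrMr// mul1r.
have r1 : 2 `^ (- e) < 1.
  exact: pow2N_lt1.
have piece k xi : cabs (hat (dyad k) ymap xi) <=
    C * 2 `^ gam * (1 + `|xi|) `^ (- gam) * 2 `^ (- (e * k.+1%:R)).
  have [l Hl] := HC (- (2 ^- n k * xi)).
  apply: le_trans (cabs_hat_dyad al0 lgstep_gt Hl) _.
  have n0 := exp2V_gt0 R (n k); have n1 := exp2V_le1 R (n k).
  have x0 : 0 <= `|xi| by [].
  have P : (1 + `|- (2 ^- n k * xi)|) `^ (- gam) <=
      2 `^ (gam * (n k)%:R) * (1 + `|xi|) `^ (- gam).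
    rewrite normrN normrM (gtr0_norm n0).
    rewrite (@le_trans _ _ ((2 ^- n k * (1 + `|xi|)) `^ (- gam)))//.
      have a0 : 0 < 2 ^- n k * (1 + `|xi|) by rewrite mulr_gt0// ltr_pwDl.
      have ab : 2 ^- n k * (1 + `|xi|) <= 1 + 2 ^- n k * `|xi| by rewrite mulrDr mulr1 lerD2r.
      exact: powR_anti a0 ab g0.
    rewrite powRM ?(ltW n0) ?addr_ge0//.
    by rewrite -pow2N_nat -powRrM mulrNN [(n k)%:R * gam]mulrC.
  have Q : 2 ^- k.+1 * 2 `^ (gam * (n k)%:R) <= 2 `^ gam * 2 `^ (- (e * k.+1%:R)).
    rewrite -pow2N_nat -!pow2D ler_pow2//.
    have /andP[_ h] := lgdil_itv k.
    have : gam * (n k)%:R <= gam * (k.+1%:R / fdim + 1) by rewrite ler_wpM2l.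
    rewrite /e mulrDr mulr1 mulrBl mul1r mulrAC -mulrA; lra.
  rewrite mulrCA (le_trans (ler_wpM2l (ltW C0) (ler_wpM2l (ltW (exp2V_gt0 R _)) P)))//.
  rewrite [2 ^- _ * _]mulrA -!mulrA ler_wpM2l ?(ltW C0)// !mulrA [leRHS]mulrAC.
  by rewrite ler_wpM2r ?powR_ge0.
pose C2 := C * 2 `^ gam * (1 - 2 `^ (- e))^-1.
exists C2; first by rewrite !mulr_gt0 ?powR_gt0// invr_gt0 subr_gt0.
move=> xi; apply/ler_addgt0Pr => d d0.
pose K := (Num.truncn (2 / d)).+1.
have Kd : 2 * 2 ^- K <= d.
  rewrite -ler_pdivlMl// mulrC -[leRHS]invrK lef_pV2 ?posrE ?exprn_gt0 ?invr_gt0 ?divr_gt0//.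
  rewrite invf_div (le_trans (ltW (truncnS_gt _)))// -natrX ler_nat.
  by apply: ltnW; exact: ltn_expl.
apply: le_trans (cabs_hat_tail xi K (measurable_ymap al0 n sg)) _.
rewrite lerD// (le_trans (ler_sum _ (fun k _ => piece k xi)))//.
rewrite -mulr_sumr /C2 [leRHS]mulrAC ler_wpM2l ?mulr_ge0 ?powR_ge0 ?(ltW C0)//.
exact: sum_pow2_le.
Qed.

End GlobalEstimates.

(** * The law as a probability measure *)

Section UniformLaw.
Variables (R : realType) (Y : measurableTypeR R -> measurableTypeR R).
Hypothesis mY : measurable_fun setT Y.
Local Notation leb := (@lebesgue_measure R).

(** The explicit formula gives the values of the law by definition; the proof of measurability is an
    argument so that the probability structure is attached canonically. *)
Definition uniform_law (_ : measurable_fun setT Y) (A : set (measurableTypeR R)) : \bar R :=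
  leb (Y @^-1` A `&` @tail R 0).

Let law_measure : {measure set (measurableTypeR R) -> \bar R} :=
  measure_function_pushforward__canonical__measure_function_Measure
    (mrestr leb (measurable_tail 0 : measurable (@tail R 0 : set (measurableTypeR R)))) mY.

Let uniform_law0 : uniform_law mY set0 = 0%E.
Proof. exact: (measure0 law_measure). Qed.

Let uniform_law_ge0 A : (0 <= uniform_law mY A)%E.
Proof. exact: (measure_ge0 law_measure). Qed.

Let uniform_law_sigma_additive : semi_sigma_additive (uniform_law mY).
Proof. exact: (@measure_semi_sigma_additive _ _ _ law_measure). Qed.

HB.instance Definition _ := isMeasure.Build _ _ _ (uniform_law mY)
  uniform_law0 uniform_law_ge0 uniform_law_sigma_additive.

Let uniform_law1 : uniform_law mY setT = 1%E.
Proof.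
rewrite /uniform_law preimage_setT setTI.
by have := leb_tail R 0; rewrite expr0 invr1.
Qed.

HB.instance Definition _ := Measure_isProbability.Build _ _ _ (uniform_law mY) uniform_law1.

End UniformLaw.

(** * Frostman and Fourier bounds for the law *)

Section LawOfY.
Variables (R : realType) (alpha beta : R).
Hypotheses (alpha_gt0 : 0 < alpha) (beta_ge0 : 0 <= beta) (beta_lt1 : beta < 1).
Local Notation cabs := (@Normc.normc R).
Local Notation leb := (@lebesgue_measure R).
Local Notation n := (lgdil alpha beta).
Local Notation sg := (lgstep alpha beta).
Local Notation ymap := (ymap alpha n sg).
Local Notation tail := (@tail R).
Local Notation hdim := (hdim alpha).
Local Notation fdim := (fdim alpha beta).

Lemma fourier_norm_law (nu : {measure set (measurableTypeR R) -> \bar R}) (D : set R)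
    (Y : R -> R) (xi : R) :
  measurable D -> (leb D < +oo)%E -> measurable_fun setT Y ->
  (forall A : set R, measurable A -> nu A = leb (Y @^-1` A `&` D)) ->
  fourier_norm nu xi = cabs (hat D Y xi).
Proof.
move=> mD Dfin mY nuE; rewrite /fourier_norm /fourier /cintegral /hat /expi /=.
have [mc ms] := @measurable_trig R id xi (@measurable_id _ _ _).
have := Rintegral_law mD Dfin mY nuE mc (fun x => cos_max _).
have := Rintegral_law mD Dfin mY nuE ms (fun x => sin_max _).
by rewrite /comp /= => -> ->.
Qed.

Lemma interval_cases (I : interval R) :
  leb [set` I] = +oo%E \/
  exists2 xl : R * R, 0 <= xl.2 /\ leb [set` I] = (xl.2)%:E &
    [set` I] `<=` `[xl.1, xl.1 + xl.2]%classic.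
Proof.
have itvE := lebesgue_measure_itv I.
case: I itvE => [[b x|[]] [b' y|[]]] /= ->.
- right; have [xy|yx] := ltP x y.
    exists (x, y - x) => /=; first by rewrite lte_fin xy subr_ge0 ltW.
    move=> u /=; rewrite !in_itv/= subrKC => /andP[h1 h2].
    by rewrite (lteifW h1) (lteifW h2).
  exists (x, 0) => /=; first by rewrite lte_fin ltNge yx.
  move=> u /=; rewrite !in_itv/= addr0 => /andP[/lteifW h1 /lteifW h2].
  by rewrite h1 (le_trans h2 yx).
- right; exists (x, 0) => //=; move=> u /=; rewrite in_itv/= andbF//.
- by left; rewrite ltry.
- by left; rewrite ltNyr.
- right; exists (0, 0) => //=; move=> u /=; rewrite in_itv/=.
- by left.
- right; exists (0, 0) => //=; move=> u /=; rewrite in_itv/=.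
- right; exists (0, 0) => //=; move=> u /=; rewrite in_itv/=.
- right; exists (0, 0) => //=; move=> u /=; rewrite in_itv/=.
Qed.

Variable mu : probability (measurableTypeR R) R.
Hypothesis muE : forall A : set R, measurable A -> mu A = leb (ymap @^-1` A `&` tail 0).

Lemma law_itv_le (th : R) : 0 <= th -> th < hdim ->
  exists2 C : R, 0 < C & forall (I : interval R) c len, 0 < len ->
    [set` I] `<=` `[c, c + len]%classic -> (mu [set` I] <= (C * len `^ th)%:E)%E.
Proof.
move=> th0 th1; have [C C0 HC] := mass_pow alpha_gt0 beta_ge0 beta_lt1 th0 th1.
exists C => // I c len len0 Ic; apply: le_trans (HC c len len0).
apply: (@le_trans _ _ (mu (`[c, c + len]%classic : set R))).
  by apply: le_measure; rewrite ?inE//; exact: measurable_itv.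
by rewrite muE//; exact: measurable_itv.
Qed.

(** Enlarge the point to length [len] with [C * len ^ (hdim / 2) = e]. This settles intervals of
    length 0, whose Frostman bound may vanish. *)
Lemma law_point (I : interval R) (c : R) : [set` I] `<=` `[c, c]%classic -> mu [set` I] = 0%E.
Proof.
move=> Ic; have /andP[h0 h1] := hdim_itv alpha_gt0.
have t0 : 0 <= hdim / 2 by rewrite divr_ge0// ltW.
have t1 : hdim / 2 < hdim by lra.
have [C C0 HC] := law_itv_le t0 t1.
apply/eqP; rewrite eq_le measure_ge0 andbT; apply/lee_addgt0Pr => e e0.
rewrite add0e; pose len := (e / C) `^ (hdim / 2)^-1.
have eC : 0 < e / C by rewrite divr_gt0.
have len0 : 0 < len by rewrite powR_gt0.
have lenE : C * len `^ (hdim / 2) = e.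
  rewrite /len -powRrM mulVf ?powRr1 ?(ltW eC)//; last by rewrite lt0r_neq0//; lra.
  by rewrite mulrCA divff ?mulr1// lt0r_neq0.
rewrite -lenE; apply: (HC _ c) => //.
apply: (subset_trans Ic) => u /=; rewrite !in_itv/= => /andP[-> h]/=.
by rewrite (le_trans h)// lerDl ltW.
Qed.

Lemma law_frostman (eps : R) : 0 < eps ->
  exists2 C : R, 0 < C & forall I : interval R,
    eps <= 2 / (2 + alpha) \/ (leb [set` I] <= 1)%E ->
    (mu [set` I] <= C%:E * leb [set` I] `^ (2 / (2 + alpha) - eps))%E.
Proof.
move=> eps0; have /andP[h0 h1] := hdim_itv alpha_gt0.
rewrite (_ : 2 / (2 + alpha) = hdim)//.
have mu1 (I : interval R) : (mu [set` I] <= 1)%E by apply: probability_le1; exact: measurable_itv.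
(* If [eps > hdim] the exponent is negative, and for positive lengths at most 1 the power is at
   least 1, hence at least any probability. *)
have [le|gt] := leP eps hdim; last first.
  exists 1 => // I [//|I1].
  rewrite mul1e; have [Iy|[[x l] /= [l0 lE] Il]] := interval_cases I.
    by move: I1; rewrite Iy leye_eq.
  move: l0; rewrite le_eqVlt => /orP[/eqP l0|l0].
    by rewrite (@law_point _ x) ?poweR_ge0//; move: Il; rewrite -l0 addr0.
  rewrite (le_trans (mu1 _))// lE poweR_EFin lee_fin -[leLHS](powRr0 l).
  have l1 : l <= 1 by move: I1; rewrite lE lee_fin.
  by rewrite ger_powR ?l0//; lra.
have th0 : 0 <= hdim - eps by rewrite subr_ge0.
have th1 : hdim - eps < hdim by lra.
have [C C0 HC] := law_itv_le th0 th1.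
(* The added 1 serves [eps = hdim] with infinite length, where the power is 1. *)
exists (C + 1) => [|I _]; first by lra.
have [Iy|[[x l] /= [l0 lE] Il]] := interval_cases I.
  rewrite Iy; have [->|ne] := eqVneq (hdim - eps) 0.
    by rewrite poweRe0 mule1 (le_trans (mu1 _))// lee_fin; lra.
  by rewrite poweRyr// gt0_muley ?leey// lte_fin; lra.
move: l0; rewrite le_eqVlt => /orP[/eqP l0|l0].
  rewrite (@law_point _ x) ?mule_ge0 ?poweR_ge0 ?lee_fin//; first by lra.
  by move: Il; rewrite -l0 addr0.
rewrite lE poweR_EFin -EFinM (le_trans (HC _ x _ l0 Il))// lee_fin.
by rewrite ler_wpM2r ?powR_ge0//; lra.
Qed.

Lemma law_fourier_decay (eps : R) : 0 < eps ->
  exists2 C : R, 0 < C & forall xi : R,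
    fourier_norm mu xi <= C * (1 + `|xi|) `^ (- ((1 - beta) / (2 + alpha)) + eps).
Proof.
move=> eps0; have /andP[f0 _] := fdim_itv alpha_gt0 beta_ge0 beta_lt1.
rewrite (_ : (1 - beta) / (2 + alpha) = fdim)//.
(* When [eps >= fdim] the claimed exponent is nonnegative and [gam = 0] suffices. *)
pose gam := Num.max 0 (fdim - eps).
have g0 : 0 <= gam by rewrite le_max lexx.
have g1 : gam < fdim by rewrite gt_max f0; lra.
have [C C0 HC] := hat_decay alpha_gt0 beta_ge0 beta_lt1 g0 g1.
exists C => // xi.
rewrite (@fourier_norm_law _ (tail 0) ymap)//; last 3 first.
- exact: measurable_tail.
- exact: leb_tail_lty.
- exact: measurable_ymap.
rewrite (le_trans (HC xi))// ler_wpM2l ?(ltW C0)// ler_powR ?lerDl//.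
have : fdim - eps <= gam by rewrite le_max lexx orbT.
lra.
Qed.

End LawOfY.

(** * Support and rational approximation *)

Section SupportOfLaw.
Variables (R : realType) (alpha beta : R).
Hypotheses (alpha_gt0 : 0 < alpha) (beta_ge0 : 0 <= beta) (beta_lt1 : beta < 1).
Local Notation leb := (@lebesgue_measure R).
Local Notation n := (lgdil alpha beta).
Local Notation sg := (lgstep alpha beta).
Local Notation ymap := (ymap alpha n sg).
Local Notation dyad := (@dyad R).
Local Notation tail := (@tail R).
Local Notation lev := (lev alpha).
Local Notation lgM := (lgM alpha).
Local Notation cells := (cells alpha).
Local Notation pt := (pt alpha).
Local Notation node := (node alpha n sg).

Lemma infinite_set_unbounded (P : int * int -> Prop) :
  (forall N : nat, exists2 qr : int * int, P qr & (N < `|qr.1|)%N) ->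
  infinite_set [set qr | P qr].
Proof.
move=> H /finite_seqP[s sE].
have [qr Pqr] := H (\sum_(q <- s) `|q.1|)%N.
have qs : qr \in s by move: Pqr; rewrite -[P qr]/([set qr | P qr] qr) sE.
by rewrite (big_rem qr)//= ltnNge leq_addr.
Qed.

Lemma addn_lev_le (c d m : nat) : (c < d)%N -> (c + (2 * d + m) < m + 3 * d)%N.
Proof. by lia. Qed.

(** The fraction is left unreduced: its denominator keeps the factor [2 ^ lev l], so denominators
    are unbounded, and the factors [q], [2 ^ lev l] and [p] give the upper bound. *)
Lemma pt_rational_next l :
  (forall i, exists q r : nat, [/\ (0 < q)%N, (q <= 2 ^ lev l)%N & pt l i = r%:R / q%:R]) ->
  forall i, exists q r : nat,
    [/\ (2 ^ lev l <= q)%N, (q <= 2 ^ (2 * lev l + lgM l))%N & pt l.+1 i = r%:R / q%:R].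
Proof.
move=> IH i; have [q [r [q0 ql E]]] := IH (i %/ size (digits alpha l))%N.
have : nth 0 (digits alpha l) (i %% size (digits alpha l)) \in digits alpha l.
  by apply: mem_nth; rewrite ltn_mod size_digits_gt0.
case/mem_fracs => p [r' [pp pm _ xE]].
exists (q * 2 ^ lev l * p)%N, (r * 2 ^ lev l * p + r' * q)%N; split.
- by rewrite mulnAC leq_pmull// muln_gt0 q0 prime_gt0.
- by rewrite expnD mul2n -addnn expnD leq_mul// leq_mul2r ql orbT.
rewrite [pt l.+1 i]/= E xE !natrD !natrM natrX.
have q0' : q%:R != 0 :> R by rewrite pnatr_eq0 -lt0n.
have p0' : p%:R != 0 :> R by rewrite pnatr_eq0 -lt0n prime_gt0.
by field; rewrite q0' p0' expf_neq0// pnatr_eq0.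
Qed.

Lemma pt_rational l i : exists q r : nat,
  [/\ (0 < q)%N, (q <= 2 ^ lev l)%N & pt l i = r%:R / q%:R].
Proof.
elim: l i => [|l IHl] i; first by exists 1%N, 0%N; rewrite mul0r.
have [q [r [q1 q2 E]]] := pt_rational_next IHl i.
exists q, r; split=> //; first by rewrite (leq_trans _ q1)// expn_gt0.
rewrite (leq_trans q2)// leq_exp2l//.
by have := lev_geM alpha_gt0 l; lia.
Qed.

(** Clearing [1 / 2], [2 ^- sg k] and [2 ^- n k] multiplies the denominator by a factor independent
    of the level. *)
Lemma node_rational k l i : exists (q : nat) (z : int),
  [/\ (2 ^ lev l <= q)%N, (q <= 2 ^ (1 + sg k + n k + (2 * lev l + lgM l)))%N &
      node k l.+1 i = z%:~R / q%:R].
Proof.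
have [q [r [q1 q2 E]]] := pt_rational_next (pt_rational l) (i %% cells l.+1).
have q0 : q%:R != 0 :> R by rewrite pnatr_eq0 -lt0n (leq_trans _ q1)// expn_gt0.
exists (2 ^ (1 + sg k + n k) * q)%N,
  (- (2 ^ (sg k + n k) * q)%N%:Z + (2 ^ (1 + n k) * q * (i %/ cells l.+1))%N%:Z +
   (2 ^ (1 + sg k) * r)%N%:Z); split.
- by rewrite (leq_trans q1)// leq_pmull// expn_gt0.
- by rewrite [X in (_ <= X)%N]expnD leq_mul2l q2 orbT.
rewrite /node E; move: (sg k) (n k) => s m.
rewrite !intrD intrN -!pmulrn !natrM !natrX !exprD expr1.
by field; rewrite q0 !expf_neq0 ?pnatr_eq0.
Qed.

Variable mu : probability (measurableTypeR R) R.
Hypothesis muE : forall A : set R, measurable A -> mu A = leb (ymap @^-1` A `&` tail 0).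

Lemma ymap_dyad k u : dyad k u -> dyad k (ymap u + 1 / 2).
Proof.
move=> ku; rewrite /ymap (dyad_idxE ku).
by apply: cmap_dyad => // j; [exact: lgstep_gt|exact: lgdil_ge_step].
Qed.

Lemma tail0_dyad u : tail 0 u -> exists k, dyad k u.
Proof. by rewrite /tail /= in_itv/= expr0 invr1; exact: dyad_ex. Qed.

Lemma msupport_close (x rho : R) : msupport mu x -> 0 < rho ->
  exists k u, dyad k u /\ `|ymap u - x| < rho.
Proof.
move=> sx r0; apply: contrapT => H.
have P : (0 < mu (ball x rho : set R))%E := sx _ (ball_open x rho) (ballxx x r0).
move: P; rewrite muE; last exact: measurable_ball.
rewrite (_ : _ `&` _ = set0) ?measure0 ?ltxx//.
apply/seteqP; split => // u [bu /tail0_dyad[k ku]]; apply: H.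
by exists k, u; split => //; move: bu; rewrite /ball /= distrC.
Qed.

Lemma msupport_itv (x : R) : msupport mu x -> - (1 / 2) <= x <= 1 / 2.
Proof.
move=> sx.
have H rho : 0 < rho -> - (1 / 2) - rho <= x <= 1 / 2 + rho.
  move=> r0; have [k [u [ku]]] := msupport_close sx r0.
  have := ymap_dyad ku; rewrite /dyad /= in_itv/= => /andP[y1 y2].
  have k1 := exp2V_le1 R k; have k0 := exp2V_gt0 R k.+1.
  rewrite ltr_distl => /andP[h1 h2]; apply/andP; split; lra.
apply/andP; split; apply/ler_addgt0Pr => e /H /andP[h1 h2]; lra.
Qed.

(** The pieces accumulate at this point, so it must be treated apart; the pairs [(2 * N.+1, - N.+1)]
    all represent it exactly. *)
Lemma well_approximable_half : well_approximable alpha (- (1 / 2) : R).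
Proof.
apply: infinite_set_unbounded => N; exists ((2 * N.+1)%N%:Z, - N.+1%:Z) => /=; last by lia.
split; first by [].
rewrite intrN -!pmulrn natrM invfM mulNr mulrCA divff ?pnatr_eq0// mulr1.
by rewrite opprK mul1r addNr normr0 powR_ge0.
Qed.

(** Away from [-1/2] only finitely many pieces come near [x], so [sg k] and [n k] are bounded while
    the level is free to grow; nodes of high level then approximate [x] with exponent
    [2 + alpha]. *)
Lemma msupport_well_approximable (x : R) : msupport mu x -> well_approximable alpha x.
Proof.
move=> sx; have /andP[x1 _] := msupport_itv sx.
move: x1; rewrite le_eqVlt => /orP[/eqP <-|x1]; first exact: well_approximable_half.
apply: infinite_set_unbounded => N.
pose eta := (x + 1 / 2) / 2.
have eta0 : 0 < eta by rewrite /eta; lra.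
pose K := (Num.truncn eta^-1).+1.
have Ke : 2 ^- K <= eta.
  rewrite -[leRHS]invrK lef_pV2 ?posrE ?exprn_gt0 ?invr_gt0//.
  rewrite (le_trans (ltW (truncnS_gt _)))// -natrX ler_nat.
  by apply: ltnW; exact: ltn_expl.
(* Dominates [1 + sg k + n k] for every piece that can come near [x], and is fixed before the
   level. *)
pose c := (\sum_(k < K) (1 + sg k + n k))%N.
pose l := maxn N c.+1.
have rho0 : 0 < Num.min eta (2 ^- lev l.+1) by rewrite lt_min eta0 exp2V_gt0.
have [k [u [ku]]] := msupport_close sx rho0.
rewrite lt_min => /andP[ux1 ux2].
have kK : (k < K)%N.
  have := ymap_dyad ku; rewrite /dyad /= in_itv/= => /andP[_ yk].
  rewrite ltnNge; apply/negP => /(exp2V_le R) h.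
  have := lt_le_trans yk (le_trans h Ke); move: ux1.
  rewrite ltr_distl => /andP[h1 _] h3.
  have : x + 1 / 2 < eta + eta by rewrite -ltrBlDr (lt_trans _ h3)// addrAC ltrD2r.
  by rewrite /eta -splitr ltxx.
have ck : (1 + sg k + n k <= c)%N.
  by rewrite /c (bigD1 (Ordinal kK))//= leq_addr.
have lN : (N <= l)%N by rewrite leq_maxl.
have lc : (c < l)%N by rewrite leq_maxr.
clearbody l; clearbody c; clearbody K; clearbody eta.
have [h1 h2] := cmap_bounds alpha_gt0 n sg k l.+1 u.
rewrite -[cmap _ _ _ _ _]/(cmap alpha n sg k u) in h1 h2.
have yE : ymap u = cmap alpha n sg k u by rewrite /ymap (dyad_idxE ku).
rewrite -yE /apx in h1 h2.
have [q [z [q1 q2 E]]] := node_rational k l (Num.truncn (u / wd alpha sg k l.+1)).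
rewrite E in h1 h2.
have q0 : (0 < q)%N by rewrite (leq_trans _ q1)// expn_gt0.
have qR : 0 < q%:R :> R by rewrite ltr0n.
exists (q%:Z, z) => /=; last first.
  rewrite (leq_trans _ q1)// (leq_ltn_trans lN)//.
  by rewrite (leq_ltn_trans (lev_ge alpha_gt0 l))// ltn_expl.
split; first by rewrite -lt0n.
rewrite -pmulrn [`|q%:R|]gtr0_norm//.
apply: (@le_trans _ _ (2 * 2 ^- lev l.+1)).
  have n1 : 2 ^- n k * 2 ^- lev l.+1 <= 2 ^- lev l.+1 :> R.
    by rewrite ler_piMl ?(ltW (exp2V_gt0 _ _))// exp2V_le1.
  move: ux2; rewrite ltr_distl => /andP[h3 h4]; rewrite ler_distl; apply/andP; split; lra.
have a2 : 0 < 2 + alpha by rewrite addr_gt0.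
have q2R : q%:R <= 2 ^+ (c + (2 * lev l + lgM l)) :> R.
  by rewrite -natrX ler_nat (leq_trans q2)// leq_exp2l// leq_add2r.
apply: le_trans (powR_anti qR q2R (ltW a2)).
rewrite -pow2_nat -powRrM -pow2N_nat -{1}[2]powRr1// -pow2D ler_pow2//.
have /andP[D1 _] := lev_itv alpha_gt0 l.
have cl : (c.+1 <= lev l)%N by rewrite (leq_trans lc)// lev_ge.
(* One of the three copies of [lev l] in [lev_itv] absorbs [c]; the extra 1 absorbs the factor 2 in
   the distance to the node. *)
have E2 : (2 + alpha) * ((c + (2 * lev l + lgM l))%:R + 1) <= (2 + alpha) * (lgM l + 3 * lev l)%:R.
  by rewrite ler_wpM2l ?(ltW a2)// natr1 ler_nat addn_lev_le.
rewrite mulrN lerNr opprB lerBrDr (le_trans _ (ltW D1))// (le_trans _ E2)//.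
rewrite [leRHS]mulrDr mulr1 [X in X + 1 <= _]mulrC lerD2l.
by apply: (@le_trans _ _ 2); [rewrite ler1n|rewrite lerDl ltW].
Qed.

End SupportOfLaw.

(** * Lower bound for the transform at resonant frequencies *)

Section PieceFourierLower.
Variables (R : realType) (alpha : R).
Hypothesis alpha_gt0 : 0 < alpha.
Variables (n sg : nat -> nat).
Hypothesis sg_gt : forall k, (k < sg k)%N.
Local Notation cabs := (@Normc.normc R).
Local Notation leb := (@lebesgue_measure R).
Local Notation ymap := (ymap alpha n sg).
Local Notation dyad := (@dyad R).

Lemma leb_dyad k : leb (dyad k) = (2 ^- k.+1)%:E.
Proof.
rewrite /dyad lebesgue_itvco ?exp2V_le//; congr EFin.
by rewrite exprS; field; rewrite expf_neq0// pnatr_eq0.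
Qed.

Lemma leb_dyad_lty k : (leb (dyad k) < +oo)%E.
Proof. by rewrite leb_dyad ltry. Qed.

Lemma cos_near_nat (m : nat) (x : R) : 0 <= x <= 1 / 8 ->
  1 / 2 <= cos (2 * pi * (m%:R + x)).
Proof.
move=> /andP[x0 x1].
have -> : cos (2 * pi * (m%:R + x)) = complex.Re (ex (m%:R + x)) by [].
rewrite exD ex_nat mul1r /ex /expi /= -mulrA mulr_natl cos_mulr2n.
have pi4 : (pi : R) <= 4 by have := pihalf_lt2 R; lra.
have pi0 := pi_gt0 R.
have s1 : `|sin (pi * x)| <= 1 / 2.
  have := sin_lip (pi * x) 0; rewrite sin0 !subr0 => /le_trans; apply.
  rewrite ger0_norm ?mulr_ge0 ?(ltW pi0)//; nra.
have s2 : sin (pi * x) ^+ 2 <= 1 / 4.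
  rewrite -real_normK ?num_real//; have := normr_ge0 (sin (pi * x)); nra.
by rewrite cos2sin2 -mulr_natl; lra.
Qed.

(** The phases of all points of the piece agree modulo whole turns up to an eighth of a turn: the
    drift along the progression is at most [1/32], the position within a copy adds at most [1/16].
    After rotation by [phi], the phase of the left end, the integrand has real part at least
    [1/2]. *)
Lemma hat_dyad_ge k (l : nat) (xi : R) :
  l%:R * 2 ^+ sg k <= xi < l%:R * 2 ^+ sg k + 2 ^+ k / 16 -> xi * 2 ^- n k <= 1 / 16 ->
  2 ^- k.+2 <= cabs (hat (dyad k) ymap xi).
Proof.
move=> /andP[xi1 xi2] xin.
have S0 : 0 < 2 ^+ sg k :> R by rewrite exprn_gt0.
have xi0 : 0 <= xi by rewrite (le_trans _ xi1)// mulr_ge0// ltW.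
have n0 := exp2V_gt0 R (n k); have s0 := exp2V_gt0 R (sg k).
pose phi : R := 2 * pi * (- (1 / 2) + 2 ^- k.+1) * xi.
have [mc ms] := measurable_trig xi (measurable_ymap alpha_gt0 n sg).
have md : measurable (dyad k) by exact: measurable_dyad.
have point u : dyad k u -> 1 / 2 <= cos (phi - 2 * pi * ymap u * xi).
  move=> ku; have [c1 c2] := cmap_cell alpha_gt0 n sg k u.
  have /andP[t1 t2] := dyad_truncn sg_gt ku; have [E1 E2] := dyad_natE R sg_gt k.
  have yE : ymap u = cmap alpha n sg k u by rewrite /ymap (dyad_idxE ku).
  rewrite -yE in c1 c2; move: c1 c2 t1 t2.
  set j := Num.truncn _; set j0 := (2 ^ (sg k - k.+1))%N => c1 c2 t1 t2.
  have jR : (j - j0)%:R = j%:R - j0%:R :> R by rewrite natrB.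
  have jw : 2 ^- sg k * (j - j0)%:R <= 2 ^- k.+1 :> R.
    rewrite jR -E1 mulrC ler_wpM2r ?(ltW s0)// -/j0.
    have : j%:R <= (2 ^ (sg k - k))%:R :> R by rewrite ler_nat ltnW.
    rewrite -[(2 ^ (sg k - k))%N](subnK (_ : j0 <= _)%N) ?natrD.
      by rewrite (exp_dyad_sub alpha_gt0 sg_gt) -/j0; lra.
    by rewrite leq_exp2l//; lia.
  pose rho := ymap u - (- (1 / 2) + 2 ^- sg k * j%:R).
  pose x := (xi - l%:R * 2 ^+ sg k) * (2 ^- sg k * (j - j0)%:R) + xi * rho.
  have jge : 0 <= 2 ^- sg k * (j - j0)%:R :> R by rewrite mulr_ge0 ?(ltW s0).
  have x1 : (xi - l%:R * 2 ^+ sg k) * (2 ^- sg k * (j - j0)%:R) <= 1 / 32.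
    rewrite (@le_trans _ _ (2 ^+ k / 16 * 2 ^- k.+1))//.
      by rewrite ler_pM ?subr_ge0//; lra.
    rewrite exprS le_eqVlt; apply/orP; left; apply/eqP; field.
    by rewrite expf_neq0// pnatr_eq0.
  have x2 : xi * rho <= 1 / 16.
    by rewrite (le_trans _ xin)// ler_wpM2l// /rho; lra.
  have x3 : 0 <= (xi - l%:R * 2 ^+ sg k) * (2 ^- sg k * (j - j0)%:R).
    by rewrite mulr_ge0// subr_ge0.
  have x4 : 0 <= xi * rho by rewrite mulr_ge0// /rho; lra.
  rewrite -cosN (_ : - (phi - _) = 2 * pi * ((l * (j - j0))%N%:R + x)).
    by apply: cos_near_nat; rewrite /x; apply/andP; split; lra.
  rewrite /x /phi /rho natrM jR -E1 -/j0; field.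
  by rewrite expf_neq0// pnatr_eq0.
pose z := hat (dyad k) ymap xi.
have bi (g : R -> R) : measurable_fun setT g -> (forall x, `|g x| <= 1) ->
    leb.-integrable (dyad k) (EFin \o g).
  move=> mg g1; apply: (bounded_integrable md (leb_dyad_lty k) _ (fun x _ => g1 x)).
  exact: measurable_funTS.
have ic := bi _ mc (fun x => cos_max _); have is_ := bi _ ms (fun x => sin_max _).
have mf : measurable_fun setT (fun u => - cos (phi - 2 * pi * ymap u * xi)).
  apply: measurableT_comp => //.
  apply: (measurableT_comp (f := cos)).
    by apply: continuous_measurable_fun; exact: continuous_cos.
  apply: measurable_funB => //; apply: measurable_funM => //; apply: measurable_funM => //.
  exact: measurable_ymap.
have fE u : - cos (phi - 2 * pi * ymap u * xi) =
    (- cos phi) * cos (- (2 * pi * ymap u * xi)) + sin phi * sin (- (2 * pi * ymap u * xi)).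
  by rewrite cosD; ring.
have zE : Rintegral leb (dyad k) (fun u => - cos (phi - 2 * pi * ymap u * xi)) =
    - cos phi * complex.Re z + sin phi * complex.Im z.
  under eq_Rintegral do rewrite fE.
  rewrite RintegralD//; last 2 first.
  - by apply: bi => [|u]; [exact: measurable_funM|rewrite normrM mulr_ile1// ?normrN ?cos_max].
  - by apply: bi => [|u]; [exact: measurable_funM|rewrite normrM mulr_ile1// sin_max].
  by rewrite !RintegralZl.
have key : Rintegral leb (dyad k) (fun u => - cos (phi - 2 * pi * ymap u * xi)) <=
    - (1 / 2) * fine (leb (dyad k)).
  apply: (@Rintegral_le_cst _ _ _ 1) => //.
  - exact: leb_dyad_lty.
  - exact: measurable_funTS.
  - by move=> u _; rewrite normrN cos_max.
  - by move=> u ku; rewrite lerN2; exact: point.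
rewrite leb_dyad /= zE in key.
have wE : complex.Re (expi phi * z) = cos phi * complex.Re z - sin phi * complex.Im z.
  by rewrite /expi; case: (z).
have cw : cabs z = cabs (expi phi * z) by rewrite cabsM cabs_expi mul1r.
rewrite -/z cw (le_trans _ (Re_le_cabs _))// wE.
have -> : 2 ^- k.+2 = 2 ^- k.+1 / 2 :> R by rewrite [2 ^+ k.+2]exprS invfM mulrC.
lra.
Qed.

End PieceFourierLower.

(** * Elementary bounds for norms *)

Section LnormBounds.
Context d (T : measurableType d) (R : realType) (mu : {measure set T -> \bar R}).
Local Open Scope ereal_scope.
Import HBNNSimple.

(** The integral is a supremum over simple functions below [f], and [c] times the indicator of [E]
    is one of them. *)
Lemma integral_ge_measure (f : T -> \bar R) (E : set T) (c : R) : measurable E ->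
  (forall x, 0 <= f x) -> (0 <= c)%R -> (forall x, E x -> c%:E <= f x) ->
  c%:E * mu E <= \int[mu]_x f x.
Proof.
move=> mE f0 c0 Ef; rewrite ge0_integralTE//.
apply: ereal_sup_ubound; exists (scale_nnsfun (indic_nnsfun R mE) c0) => /=.
  move=> x; rewrite mindicE; case: (boolP (x \in E)) => [/set_mem /Ef|_].
    by rewrite mulr1.
  by rewrite mulr0.
rewrite -[in RHS]sintegral_indic; exact: (sintegralrM mu c (indic_nnsfun R mE)).
Qed.

Lemma Lnorm_ge (F : T -> R) (E : set T) (c m p : R) : measurable E ->
  (forall x, 0 <= F x)%R -> (0 <= c)%R -> (0 <= m)%R -> (0 < p)%R ->
  (forall x, E x -> c <= F x)%R -> m%:E <= mu E ->
  (c * m `^ p^-1)%:E <= 'N[mu]_(p%:E)[EFin \o F].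
Proof.
move=> mE F0 c0 m0 p0 EF mE'; rewrite unlock.
have I : (c `^ p * m)%:E <= \int[mu]_x (`|(EFin \o F) x| `^ p).
  apply: (@le_trans _ _ ((c `^ p)%:E * mu E)).
    by rewrite EFinM lee_wpmul2l ?lee_fin ?powR_ge0.
  apply: integral_ge_measure => //.
  - by move=> x; rewrite poweR_ge0.
  - by rewrite powR_ge0.
  move=> x Ex; rewrite /= ger0_norm// lee_fin ge0_ler_powR ?nnegrE ?(ltW p0) ?EF ?F0//.
have -> : (c * m `^ p^-1)%:E = (c `^ p * m)%:E `^ p^-1.
  rewrite poweR_EFin powRM ?powR_ge0// -powRrM divff ?lt0r_neq0// powRr1//.
apply: gt0_ler_poweR => //; first by rewrite invr_ge0 ltW.
- by rewrite in_itv/= leey lee_fin mulr_ge0// powR_ge0.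
- by rewrite in_itv/= leey integral_ge0// => x _; rewrite poweR_ge0.
Qed.

Lemma Lnorm_indic (E : set T) (q : R) : measurable E -> (0 < q)%R ->
  'N[mu]_(q%:E)[EFin \o (\1_E : T -> R)] = mu E `^ q^-1.
Proof.
move=> mE q0; rewrite unlock; congr (_ `^ _).
rewrite -[in RHS](setIT E) -(integral_indic mu measurableT mE).
apply: eq_integral => x _ /=; rewrite indicE.
by case: (x \in E); rewrite /= ?normr1 ?powR1// normr0 powR0// lt0r_neq0.
Qed.

End LnormBounds.

(** * The set of resonant frequencies *)

Section PieceFrequencies.
Variables (R : realType) (alpha : R).
Hypothesis alpha_gt0 : 0 < alpha.
Variables (n sg : nat -> nat).
Hypotheses (sg_gt : forall k, (k < sg k)%N) (n_ge : forall k, (sg k <= n k)%N).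
Local Notation cabs := (@Normc.normc R).
Local Notation leb := (@lebesgue_measure R).
Local Notation ymap := (ymap alpha n sg).
Local Notation dyad := (@dyad R).

(** Subtraction is truncated: if [m - s <= 5], only [l = 0] qualifies. The 5 keeps [l * 2 ^ s]
    within [2 ^ m / 32], half of the allowance in [hat_dyad_ge]. *)
Lemma expn_block_le (l s m : nat) : (s <= m)%N -> (l < 2 ^ (m - s - 5))%N ->
  (32 * (l * 2 ^ s) <= 2 ^ m)%N.
Proof.
move=> sm; case: (leqP (m - s) 5) => h.
  by rewrite (eqP (_ : m - s - 5 == 0))%N ?subn_eq0// expn0 ltnS leqn0 => /eqP ->; rewrite muln0.
move=> ll; rewrite -[m in (_ <= 2 ^ m)%N](_ : 5 + (m - s - 5) + s = m)%N; last by lia.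
by rewrite !expnD -mulnA leq_mul2l /= leq_mul2r ltnW ?orbT.
Qed.

Lemma sum_multiples (L r : nat) : (0 < r)%N ->
  (L <= \sum_(i < L * r) (i %% r == 0)%N)%N.
Proof.
move=> r0; rewrite -(big_mkord xpredT (fun i => (i %% r == 0)%N : nat)).
rewrite -[X in \sum_(X <= i < _) _](mul0n r) sum_blocks//.
rewrite -[leqLHS]muln1 -[X in (X * _)%N]subn0 -sum_nat_const_nat.
apply: leq_sum => j _.
by rewrite (bigD1 (Ordinal r0))//= addn0 modnMl.
Qed.

(** The spacing [2 ^ sg k] is exactly [r] times [h = 2 ^ k / 16], so the resonant frequencies form
    the cells of length [h] whose index is a multiple of [r]. *)
Lemma hat_dyad_large k : exists E : set R,
  [/\ measurable E, ((2 ^+ k / 16 * (2 ^ (n k - sg k - 5))%:R)%:E <= leb E)%E &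
      forall xi, E xi -> 2 ^- k.+2 <= cabs (hat (dyad k) ymap xi)].
Proof.
set L := (2 ^ (n k - sg k - 5))%N.
pose h : R := 2 ^+ k / 16; pose r := (2 ^ (sg k - k + 4))%N.
have h0 : 0 < h by rewrite divr_gt0// exprn_gt0.
have r0 : (0 < r)%N by rewrite expn_gt0.
have rh : r%:R * h = 2 ^+ sg k.
  rewrite /r natrX exprD /h -[sg k in RHS](subnK (ltnW (sg_gt k))) exprD.
  by move: (2 ^+ (sg k - k)) (2 ^+ k) => x y; field.
pose Q i := ((i %% r == 0) && (i < L * r))%N.
have mQ := measurable_truncn (fun i => (Q i)%:R) h0.
(* Negative reals also truncate to 0; the half-line excludes them. *)
pose E : set R := `[0, +oo[%classic `&` [set u | Q (Num.truncn (u / h))].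
have mE : measurable E.
  apply: measurableI => //.
  rewrite [X in measurable X](_ : _ = [set u | (Q (Num.truncn (u / h)))%:R = 1 :> R]).
    by have := mQ measurableT [set 1] (measurable_set1 _); rewrite setTI.
  by apply/seteqP; split => u /=; case: (Q _) => // /esym /eqP; rewrite oner_eq0.
exists E; split => //.
  have H i (u : R) : (i < L * r)%N -> i%:R * h <= u < i.+1%:R * h -> (i %% r == 0)%N -> E u.
    move=> iL /andP[u1 u2] ir; split.
      by rewrite /= in_itv/= andbT (le_trans _ u1)// mulr_ge0// ltW.
    rewrite /= (truncn_def (n := i)) /Q ?ir//.
    by rewrite ler_pdivlMr// ltr_pdivrMr// u1.
  apply: le_trans (measure_ge_step h0 mE H).
  by rewrite lee_fin ler_pM2l// ler_nat sum_multiples.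
move=> u [/=]; rewrite in_itv/= andbT => u0 /andP[/eqP ir iL].
set i := Num.truncn (u / h) in ir iL.
have /andP[u1 u2] : i%:R * h <= u < i.+1%:R * h.
  by rewrite -ler_pdivlMr// -ltr_pdivrMr// truncn_itv// divr_ge0// ltW.
pose l := (i %/ r)%N.
have il : i = (l * r)%N by rewrite [LHS](divn_eq i r) ir addn0.
have lh : i%:R * h = l%:R * 2 ^+ sg k by rewrite il natrM -mulrA rh.
have lL : (l < L)%N by rewrite ltn_divLR.
have n5 : 32 * (l%:R * 2 ^+ sg k) <= 2 ^+ n k :> R.
  by have := expn_block_le (n_ge k) lL; rewrite -(ler_nat R) !natrM !natrX.
have nk : 2 * 2 ^+ k <= 2 ^+ n k :> R.
  by rewrite -exprS ler_weXn2l ?ler1n// (leq_trans (sg_gt k)).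
have u3 : l%:R * 2 ^+ sg k <= u < l%:R * 2 ^+ sg k + 2 ^+ k / 16.
  by move: u1 u2; rewrite -natr1 mulrDl mul1r lh => -> ->.
apply: (hat_dyad_ge alpha_gt0 sg_gt u3).
rewrite ler_pdivrMr ?exprn_gt0//; case/andP: u3 => _.
move: nk n5; move: (l%:R * _) (2 ^+ k) (2 ^+ n k) => x y z; lra.
Qed.

End PieceFrequencies.

(** * Growth of the quotient *)

Section RatioGrowth.
Variables (R : realType).

Lemma pow2_unbounded (kappa c A : R) : 0 < kappa ->
  exists2 k, (1 <= k)%N & A <= 2 `^ (kappa * k.+1%:R - c).
Proof.
move=> kp; have [C C0 H] := polynomial_le_pow2 R 0.
pose B := `|A| * C * 2 `^ c / kappa.
pose k := (Num.truncn B).+1; exists k => //.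
have kB : B <= k.+1%:R by rewrite (le_trans (ltW (truncnS_gt _)))// ler_nat.
have := H (kappa * k.+1%:R) (mulr_ge0 (ltW kp) (ler0n _ _)); rewrite expr1 => Hk.
rewrite pow2D powRN (le_trans (ler_norm _))// ler_pdivlMr ?powR_gt0//.
rewrite -(ler_pM2l C0) (le_trans _ Hk)// mulrC [leRHS]mulrC -ler_pdivrMr//.
by rewrite (_ : _ / _ = B)// /B; congr (_ / _); ring.
Qed.

Lemma pow2_truncated_sub_ge (a b : nat) : 2 `^ (a%:R - b%:R) <= (2 ^ (a - b))%:R :> R.
Proof.
rewrite natrX -pow2_nat ler_pow2// lerBlDr -natrD ler_nat; lia.
Qed.

(** The 11 is 1 from [P] plus at most 10 from the loss in [m], whose root is taken with [p >= 1]. *)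
Lemma pow2_ratio_ge (K P Q m gamma p q : R) : 1 <= p -> 1 < q -> 
  P = 2 `^ (- (K + 1)) -> Q = 2 `^ (- K) -> 2 `^ (gamma * K - 10) <= m ->
  2 `^ ((gamma / p - (q - 1) / q) * K - 11) <= P * m `^ p^-1 / Q `^ q^-1.
Proof.
move=> p1 q1 -> -> mK; have p0 : 0 < p by lra.
have q0 : 0 < q by lra.
rewrite -powRN -[X in _ <= X]mulrA -powRrM.
apply: (@le_trans _ _ (2 `^ (- (K + 1)) * ((2 `^ (gamma * K - 10)) `^ p^-1 * 2 `^ (- K * - q^-1)))).
  rewrite -powRrM -!pow2D ler_pow2//.
  have ip0 : 0 < p^-1 by rewrite invr_gt0.
  have ip1 : p^-1 <= 1 by rewrite invf_le1.
  have -> : (q - 1) / q = 1 - q^-1 by field; lra.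
  move: (p^-1) (q^-1) ip0 ip1 => x y x0 x1; lra.
rewrite ler_pM2l ?powR_gt0// ler_pM2r ?powR_gt0// ge0_ler_powR ?nnegrE ?powR_ge0 ?invr_ge0 ?(ltW p0)//.
by rewrite (le_trans _ mK)// powR_ge0.
Qed.


End RatioGrowth.

(** * The quotient for one piece *)

Section PieceRatio.
Variables (R : realType) (alpha beta : R).
Hypotheses (alpha_gt0 : 0 < alpha) (beta_ge0 : 0 <= beta) (beta_lt1 : beta < 1).
Local Notation cabs := (@Normc.normc R).
Local Notation leb := (@lebesgue_measure R).
Local Notation n := (lgdil alpha beta).
Local Notation sg := (lgstep alpha beta).
Local Notation ymap := (ymap alpha n sg).
Local Notation dyad := (@dyad R).
Local Notation gamma := ((1 + alpha - beta) / (1 - beta)).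

(** Origin of [gamma = 1 + alpha / (1 - beta)]: [N - S] is at least
    [N * (1 - hdim) = N * alpha / (2 + alpha)], hence at least [K * alpha / (1 - beta)]. *)
Lemma frequency_exponent (K N S : R) : K / fdim alpha beta <= N -> S <= hdim alpha * N ->
  gamma * K <= K + (N - S).
Proof.
have al0 := alpha_gt0; have b1 : 0 < 1 - beta by rewrite subr_gt0.
have a2 : 0 < 2 + alpha by lra.
rewrite /fdim /hdim => KN SN.
have -> : gamma * K = K + K / ((1 - beta) / (2 + alpha)) * (alpha / (2 + alpha)).
  by field; rewrite !lt0r_neq0.
rewrite lerD2l (@le_trans _ _ (N * (alpha / (2 + alpha))))//.
  by rewrite ler_wpM2r// ltW// divr_gt0.
have -> : alpha / (2 + alpha) = 1 - 2 / (2 + alpha) by field; rewrite lt0r_neq0.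
by rewrite mulrBr mulr1 lerD2l lerN2 mulrC.
Qed.

(** The 10 is 1 for [k] against [k.+1], 4 for the factor 16 and 5 for the shortened range of
    multiples. *)
Lemma frequency_mass_ge k :
  2 `^ (gamma * k.+1%:R - 10) <= 2 ^+ k / 16 * (2 ^ (n k - sg k - 5))%:R.
Proof.
have /andP[/ltW n1 _] := lgdil_itv alpha_gt0 beta_ge0 beta_lt1 k.
have /andP[s1 _] := lgstep_itv beta alpha_gt0 k.
have := frequency_exponent n1 s1.
move: (n k) (sg k) => N S H {n1 s1}.
rewrite -subnDA (@le_trans _ _ (2 `^ (k%:R - 4) * 2 `^ (N%:R - (S + 5)%:R)))//.
  rewrite -pow2D ler_pow2// natrD; move: H; rewrite -[k.+1%:R]natr1.
  by move: (gamma * _) => x; lra.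
rewrite ler_pM ?powR_ge0// ?pow2_truncated_sub_ge//.
rewrite pow2D pow2_nat powRN (pow2_nat R 4) (_ : 2 ^+ 4 = 16)//.
by rewrite -natrX.
Qed.

Lemma Lnorm_ratio_ge k (F : R -> R) (p q : R) : 1 <= p -> 1 < q ->
  (forall xi, F xi = cabs (hat (dyad k) ymap xi)) ->
  ((2 `^ ((gamma / p - (q - 1) / q) * k.+1%:R - 11))%:E <=
     'N[leb]_(p%:E)[EFin \o F] / ((2 ^- k.+1) `^ q^-1)%:E)%E.
Proof.
move=> p1 q1 FE.
have [E [mE El EF]] := hat_dyad_large alpha_gt0 (lgstep_gt alpha_gt0 beta_ge0 beta_lt1)
  (lgdil_ge_step beta alpha_gt0) k.
have p0 : 0 < p by rewrite (lt_le_trans _ p1).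
have m0 : 0 <= 2 ^+ k / 16 * (2 ^ (n k - sg k - 5))%:R :> R by rewrite mulr_ge0// divr_ge0.
have F0 xi : 0 <= F xi by rewrite FE cabs_ge0.
have EF' xi : E xi -> 2 ^- k.+2 <= F xi by move=> /EF; rewrite FE.
have := @Lnorm_ge _ _ _ leb F E _ _ p mE F0 (ltW (exp2V_gt0 R k.+2)) m0 p0 EF' El.
have := frequency_mass_ge k; move: (2 ^+ k / 16 * _) => m mK H.
have Q0 : 0 < (2 ^- k.+1) `^ q^-1 :> R by rewrite powR_gt0// exp2V_gt0.
rewrite inver gt_eqF// lee_pdivlMr//.
apply: le_trans H.
rewrite -EFinM lee_fin -ler_pdivlMr//.
apply: pow2_ratio_ge mK => //; rewrite -pow2N_nat//.
by congr (2 `^ - _); rewrite natr1.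
Qed.

End PieceRatio.

(** * Failure of the extension estimate *)

Section ExtensionFails.
Variables (R : realType) (alpha beta : R).
Hypotheses (alpha_gt0 : 0 < alpha) (beta_ge0 : 0 <= beta) (beta_lt1 : beta < 1).
Local Notation leb := (@lebesgue_measure R).
Local Notation n := (lgdil alpha beta).
Local Notation sg := (lgstep alpha beta).
Local Notation ymap := (ymap alpha n sg).
Local Notation dyad := (@dyad R).
Local Notation tail := (@tail R).
Local Notation gamma := ((1 + alpha - beta) / (1 - beta)).

Variable mu : probability (measurableTypeR R) R.
Hypothesis muE : forall A : set R, measurable A -> mu A = leb (ymap @^-1` A `&` tail 0).

(** [dyad k] shifted by [-1/2]. Within [tail 0], exactly the points of [dyad k] are mapped into it
    by [ymap], so the k-th piece of the law is cut out by the indicator of an interval of the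
    line. *)
Definition piece (k : nat) : set (measurableTypeR R) :=
  `[2 ^- k.+1 - 1 / 2, 2 ^- k - 1 / 2[%classic.

Lemma measurable_piece k : measurable (piece k).
Proof. exact: measurable_itv. Qed.

Lemma piece_dyad k x : piece k x <-> dyad k (x + 1 / 2).
Proof.
rewrite /piece /dyad /= !in_itv/=; split => /andP[x1 x2]; apply/andP; split; lra.
Qed.

Lemma ymap_piece k u : tail 0 u -> piece k (ymap u) <-> dyad k u.
Proof.
move=> /tail0_dyad[k' k'u]; have Yu := ymap_dyad alpha_gt0 beta_ge0 beta_lt1 k'u.
by split => [/piece_dyad /(dyad_uniq Yu) <-//|/(dyad_uniq k'u) <-]; apply/piece_dyad.
Qed.

Lemma dyad_tail0 k u : dyad k u -> tail 0 u.
Proof.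
rewrite /tail /dyad /= !in_itv/= expr0 invr1 => /andP[u1 u2].
by rewrite (lt_le_trans _ u1) ?exp2V_gt0//= (lt_le_trans u2)// exp2V_le1.
Qed.

Lemma law_piece k (A : set R) : measurable A ->
  mu (piece k `&` A) = leb (ymap @^-1` A `&` dyad k).
Proof.
move=> mA; rewrite muE; last exact: measurableI (measurable_piece k) mA.
congr (leb _); apply/seteqP; split => u /=.
  by move=> [[ku Au] u0]; split => //; apply/ymap_piece.
by move=> [Au ku]; have u0 := dyad_tail0 ku; do 2!split => //; apply/ymap_piece.
Qed.

Definition piece_indic k : {mfun measurableTypeR R >-> R} :=
  indic_mfun (piece k) (measurable_piece k).

Lemma piece_indic_ge0 k x : 0 <= piece_indic k x.
Proof. by rewrite /= /mindic indicE. Qed.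

Lemma density_piece k (A : set R) : measurable A ->
  density mu (piece_indic_ge0 k) A = leb (ymap @^-1` A `&` dyad k).
Proof.
move=> mA; rewrite -law_piece//.
exact: (integral_indic mu mA (measurable_piece k)).
Qed.

Lemma fourier_norm_piece k xi :
  fourier_norm (density mu (piece_indic_ge0 k)) xi =
  Normc.normc (hat (dyad k) ymap xi).
Proof.
apply: fourier_norm_law => //.
- exact: measurable_dyad.
- exact: leb_dyad_lty.
- exact: measurable_ymap.
- exact: density_piece.
Qed.

Lemma Lnorm_piece k (q : R) : 0 < q ->
  ('N[mu]_(q%:E)[EFin \o piece_indic k] = ((2 ^- k.+1) `^ q^-1)%:E)%E.
Proof.
move=> q0; rewrite (Lnorm_indic mu (measurable_piece k) q0) -poweR_EFin; congr (_ `^ _)%E.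
have := law_piece k measurableT; rewrite setIT preimage_setT setTI leb_dyad; exact.
Qed.

Lemma law_no_extension : exists (f : nat -> {mfun measurableTypeR R >-> R})
    (f0 : forall k x, 0 <= f k x),
  (forall (k : nat) (q : R), 1 < q -> (0 < 'N[mu]_(q%:E)[EFin \o f k] < +oo)%E) /\
  (forall q p : R, 1 < q -> 1 <= p -> p < q / (q - 1) * gamma ->
     ereal_sup
       [set ('N[leb]_(p%:E)[EFin \o fourier_norm (density mu (f0 k))]
             / 'N[mu]_(q%:E)[EFin \o f k])%E
       | k in [set j : nat | (1 <= j)%N]] = +oo%E).
Proof.
exists piece_indic, piece_indic_ge0; split => [k q q1|q p q1 p1 pq].
  rewrite Lnorm_piece; last by rewrite (lt_trans _ q1).
  by rewrite lte_fin powR_gt0 ?exp2V_gt0// ltry.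
apply/eqyP => A _.
(* The growth rate of the quotient in [k]; it is positive exactly when [p < p_+(q)]. *)
have kp : 0 < gamma / p - (q - 1) / q.
  rewrite subr_gt0 ltr_pdivlMr; last by lra.
  have E : q / (q - 1) * gamma = gamma / ((q - 1) / q) by rewrite invf_div mulrC.
  by rewrite mulrC -ltr_pdivlMr -?E// divr_gt0//; lra.
have [k k1 Ak] := pow2_unbounded 11 A kp.
apply: (@le_trans _ _ ('N[leb]_(p%:E)[EFin \o fourier_norm (density mu (piece_indic_ge0 k))]
             / 'N[mu]_(q%:E)[EFin \o piece_indic k])%E); last first.
  by apply: ereal_sup_ubound; exists k.
rewrite Lnorm_piece; last by rewrite (lt_trans _ q1).
apply: le_trans (Lnorm_ratio_ge alpha_gt0 beta_ge0 beta_lt1 p1 q1 (fourier_norm_piece k)).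
by rewrite lee_fin.
Qed.

End ExtensionFails.

Unset Implicit Arguments.

Theorem theorem1p7 (R : realType) (alpha beta : R)
    (alpha_gt0 : 0 < alpha) (beta_ge0 : 0 <= beta) (beta_lt1 : beta < 1) :
  exists mu : probability (measurableTypeR R) R,
  [/\ msupport mu `<=` [set` `[- (1 / 2), 1 / 2]%R] `&` well_approximable alpha,
      forall eps : R, 0 < eps ->
        exists2 C : R, 0 < C &
          forall I : interval R,
            eps <= 2 / (2 + alpha) \/ (lebesgue_measure [set` I] <= 1)%E ->
            (mu [set` I] <=
               C%:E * lebesgue_measure [set` I] `^ (2 / (2 + alpha) - eps))%E,
      forall eps : R, 0 < eps ->
        exists2 C : R, 0 < C &
          forall xi : R,
            fourier_norm mu xi <=
              C * (1 + `|xi|) `^ (- ((1 - beta) / (2 + alpha)) + eps)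
    & exists (f : nat -> {mfun measurableTypeR R >-> R})
             (f0 : forall k x, 0 <= f k x),
        (forall (k : nat) (q : R), 1 < q ->
           (0 < 'N[mu]_(q%:E)[EFin \o f k] < +oo)%E) /\
        (forall q p : R, 1 < q -> 1 <= p ->
           p < q / (q - 1) * ((1 + alpha - beta) / (1 - beta)) ->
           ereal_sup
             [set ('N[@lebesgue_measure R]_(p%:E)
                      [EFin \o fourier_norm (density mu (f0 k))]
                   / 'N[mu]_(q%:E)[EFin \o f k])%E
             | k in [set j : nat | (1 <= j)%N]] = +oo%E)].
Proof.
have mY := measurable_ymap alpha_gt0 (lgdil alpha beta) (lgstep alpha beta).
pose mu := uniform_law mY.
exists mu; split.
- move=> x sx; split; last first.
    exact: (msupport_well_approximable alpha_gt0 beta_ge0 beta_lt1 (mu := mu) _ sx).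
  rewrite /= in_itv/=.
  exact: (msupport_itv alpha_gt0 beta_ge0 beta_lt1 (mu := mu) _ sx).
- move=> eps; exact: (law_frostman alpha_gt0 beta_ge0 beta_lt1 (mu := mu)).
- move=> eps; exact: (law_fourier_decay alpha_gt0 beta_ge0 beta_lt1 (mu := mu)).
- exact: (law_no_extension alpha_gt0 beta_ge0 beta_lt1 (mu := mu)).
Qed.
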